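(* Let $(E,\|\cdot\|_E)$ be a real Banach space of Rademacher type $p\in[1,2]$, let $q\in[p,\infty)$ and $k,L\in\mathbb{N}$. Suppose that, for every $\ell\in\{1,\ldots,L\}$, $X_\ell\in L_{kq}(\Omega;E)$, $M_\ell\in\mathbb{N}$, and $\xi_{\ell,1},\ldots,\xi_{\ell,M_\ell}$ are independent copies of the $\otimes^{k,s}_{\varepsilon_s}E$-valued random variable $$\xi_\ell:=\otimes^kX_\ell-\otimes^kX_{\ell-1}\in L_q(\Omega;\otimes^{k,s}_{\varepsilon_s}E),\qquad X_0:=0\in E.$$ Then, for every $U\in\otimes^{k,s}_{\varepsilon_s}E$, $$\Bigl\|U-\sum_{\ell=1}^L\frac1{M_\ell}\sum_{j=1}^{M_\ell}\xi_{\ell,j}\Bigr\|_{L_q(\Omega;\otimes^{k,s}_{\varepsilon_s}E)}\le\bigl\|U-\mathbb{M}^k_\varepsilon[X_L]\bigr\|_{\varepsilon_s}+C^{\mathsf{ML}}_{q,p,k}\sum_{\ell=1}^L\biggl[M_\ell^{-\left(1-\frac1p\right)}\|X_\ell-X_{\ell-1}\|_{L_{kq}(\Omega;E)}\,\Sigma_\ell\biggr],$$ where $$\Sigma_\ell:=\sum_{i=0}^{k-1}\Bigl[\Bigl(\tbinom{k}{i+1}\|X_\ell-X_{\ell-1}\|_{L_{kq}(\Omega;E)}^i+\|X_\ell\|_{L_k(\Omega;E)}^i\Bigr)\|X_{\ell-1}\|_{L_{kq}(\Omega;E)}^{k-i-1}\Bigr],$$ $C^{\mathsf{ML}}_{q,p,k}:=2\max\{C^{\mathsf{diff}}_{q,p,k},B_q\}$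 and $C^{\mathsf{diff}}_{q,p,k}:=16k\sqrt{\pi}\,K_{q,p}\,\tau_p(E)\,K_{q,2}$.
   Context: $(\Omega,\mathcal{A},\mathbb{P})$ is a complete probability space with expectation $\mathbb{E}$. For a real Banach space $F$ and $q\in[1,\infty)$, $L_q(\Omega;F)$ is the space of (classes of) Bochner measurable $\eta\colon\Omega\to F$ with $\|\eta\|_{L_q(\Omega;F)}:=(\mathbb{E}[\|\eta\|_F^q])^{1/q}<\infty$. $E'$ is the dual of $E$ and $B_{E'}$ its closed unit ball. Zeroth powers equal $1$. No independence is assumed between samples on different levels $\ell$. Tensor products: $\otimes^kE$ is the $k$-fold algebraic tensor product, $\otimes^k x:=x\otimes\cdots\otimes x$ ($k$ times), and $\otimes^{k,s}E$ is the symmetric $k$-fold algebraic tensor product, i.e. the set of finite sums $U=\sum_{j=1}^M\lambda_j\otimes^kx_j$ with $\lambda_j\in\mathbb{R}$, $x_j\in E$. The injective norm of $U=\sum_{j} x_{j,1}\otimes\cdots\otimes x_{j,k}\in\otimes^kE$ is $\|U\|_\varepsilon:=\sup\{|\sum_j\prod_{n=1}^kf_n(x_{j,n})|: f_1,\ldots,f_k\in B_{E'}\}$; the symmetric injective norm of $U=\sum_j\lambda_j\otimes^kx_j\in\otimes^{k,s}E$ is $\|U\|_{\varepsilon_s}:=\sup\{|\sum_j\lambda_jf(x_j)^k|: f\in B_{E'}\}$. $\otimes^k_\varepsilon E$ and $\otimes^{k,s}_{\varepsilon_s}E$ are the completions of $\otimes^kE$ and $\otimes^{k,s}E$ in these norms;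 the two norms are equivalent on symmetric tensors. For $\xi\in L_k(\Omega;E)$ the injective $k$th moment is the Bochner integral $\mathbb{M}^k_\varepsilon[\xi]:=\mathbb{E}[\otimes^k\xi]$ in $\otimes^k_\varepsilon E$; it belongs to $\otimes^{k,s}_{\varepsilon_s}E$. Constants: a Rademacher family is a family of independent random variables $r_j$ with values in $\{-1,1\}$, each value having probability $\tfrac12$, on a complete probability space $(\widetilde\Omega,\widetilde{\mathcal A},\widetilde{\mathbb P})$. $K_{q,p}$ (Kahane--Khintchine constant, $p,q\in[1,\infty)$) is the smallest $K\in(0,\infty)$ with $\|\sum_{j=1}^nr_jx_j\|_{L_q(\widetilde\Omega;F)}\le K\|\sum_{j=1}^nr_jx_j\|_{L_p(\widetilde\Omega;F)}$ for all Rademacher families, all real Banach spaces $F$, all $n$ and all $x_j\in F$. $F$ has Rademacher type $p\in[1,2]$ if there is $\tau\in(0,\infty)$ with $\|\sum_{j=1}^nr_jx_j\|_{L_p(\widetilde\Omega;F)}\le\tau(\sum_{j=1}^n\|x_j\|_F^p)^{1/p}$ for all Rademacher families, all $n$ and all $x_j\in F$; the smallest such $\tau$ is $\tau_p(F)$. $B_q\in(0,\infty)$ is a constant depending only on $q$ for which the classical Khintchine inequality $\|\sum_{j=1}^nr_ja_j\|_{L_q(\widetilde\Omega;\mathbb{R})}\le B_q(\sum_{j=1}^na_j^2)^{1/2}$ holds for all finite real sequences $(a_j)$ and all Rademacher families. *)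

(* Defs.v *)
From HB Require Import structures.
From mathcomp Require Import all_boot all_order all_algebra.
From mathcomp Require Import all_classical all_reals all_analysis.

Set Implicit Arguments.
Unset Strict Implicit.
Unset Printing Implicit Defensive.

Import Order.TTheory GRing.Theory Num.Theory.
Import numFieldNormedType.Exports.

Local Open Scope classical_set_scope.
Local Open Scope ring_scope.

Section BochnerSpaces.
Context d (Om : measurableType d) (R : realType) (P : probability Om R).
Variable F : completeNormedModType R.
Implicit Types (s f g : Om -> F).

Definition simple_rv s : Prop :=
  finite_set (range s) /\ forall y, measurable (s @^-1` [set y]).

Definition bochner_measurable f : Prop :=
  exists s : nat -> Om -> F, (forall n, simple_rv (s n)) /\
    {ae P, forall w, s n w @[n --> \oo] --> f w}.

(* Extended-real valued, so that an infinite norm is not mistaken for 0. *)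
Definition normL (q : R) f : \bar R := ('N[P]_(q%:E)[(fun w => `|f w|%:E)])%E.

Definition inL (q : R) f : Prop :=
  bochner_measurable f /\ (normL q f < +oo)%E.

Definition simple_integral s : F :=
  \sum_(y \in range s) fine (P (s @^-1` [set y])) *: y.

Definition is_bochner_integral f (m : F) : Prop :=
  bochner_measurable f /\
  exists s : nat -> Om -> F, [/\ forall n, simple_rv (s n),
    (\int[P]_w `|f w - s n w|%:E)%E @[n --> \oo] --> 0%E &
    simple_integral (s n) @[n --> \oo] --> m].

(* The value is arbitrary when f is not Bochner integrable. *)
Definition bochner_integral f : F := get (is_bochner_integral f).

End BochnerSpaces.

Section Independence.
Context d (Om : measurableType d) (R : realType) (P : probability Om R).
Variable F : topologicalType.

Definition borel_set : set (set F) := <<s [set A : set F | open A] >>.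

Definition independent_family (I : finType) (Y : I -> Om -> F) : Prop :=
  forall (J : {set I}) (A : I -> set F), (forall i, borel_set (A i)) ->
    P (\bigcap_(i in [set i | i \in J]) (Y i @^-1` A i)) =
    (\prod_(i in J) P (Y i @^-1` A i))%E.

Definition same_law (Y Z : Om -> F) : Prop :=
  forall A, borel_set A -> P (Y @^-1` A) = P (Z @^-1` A).

End Independence.

Definition independent_copies d (Om : measurableType d) (R : realType)
    (P : probability Om R) (F : completeNormedModType R)
    (I : finType) (Y : I -> Om -> F) (Z : Om -> F) : Prop :=
  [/\ forall i, bochner_measurable P (Y i),
      forall i, same_law P (Y i) Z &
      independent_family P Y].

Section Rademacher.
Variable R : realType.

Definition rademacher_family d (Om : measurableType d) (P : probability Om R)
    n (r : 'I_n -> Om -> R) : Prop :=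
  [/\ forall j, measurable_fun setT (r j),
      forall j w, r j w = -1 \/ r j w = 1,
      forall j, P (r j @^-1` [set (-1)]) = (2^-1)%:E /\
                P (r j @^-1` [set 1]) = (2^-1)%:E &
      independent_family P r].

Definition rad_sum d (Om : measurableType d) (F : completeNormedModType R)
    n (r : 'I_n -> Om -> R) (x : 'I_n -> F) : Om -> F :=
  fun w => \sum_j r j w *: x j.

Definition kahane_khintchine_bound (q p K : R) : Prop :=
  0 < K /\
  forall d (Om : measurableType d) (P : probability Om R),
    measure_is_complete P ->
  forall n (r : 'I_n -> Om -> R), rademacher_family P r ->
  forall (F : completeNormedModType R) (x : 'I_n -> F),
    (normL P q (rad_sum r x) <= K%:E * normL P p (rad_sum r x))%E.

(* The admissible constants are closed under limits in ]0, +oo[ and bounded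
   below by 1, so the infimum is the smallest one as soon as there is one. *)
Definition kahane_khintchine (q p : R) : \bar R :=
  ereal_inf [set K%:E | K in [set K | kahane_khintchine_bound q p K]].

Definition type_bound (F : completeNormedModType R) (p tau : R) : Prop :=
  0 < tau /\
  forall d (Om : measurableType d) (P : probability Om R),
    measure_is_complete P ->
  forall n (r : 'I_n -> Om -> R), rademacher_family P r ->
  forall x : 'I_n -> F,
    (normL P p (rad_sum r x) <=
     (tau * (\sum_j `|x j| `^ p) `^ p^-1)%:E)%E.

Definition rademacher_type (F : completeNormedModType R) (p : R) : Prop :=
  exists tau, type_bound F p tau.

(* The infimum is the smallest admissible constant, except that it is 0 when
   F = {0}, where every tau > 0 is admissible. *)
Definition type_constant (F : completeNormedModType R) (p : R) : \bar R :=
  ereal_inf [set tau%:E | tau in [set tau | type_bound F p tau]].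

Definition khintchine_bound (q B : R) : Prop :=
  0 < B /\
  forall d (Om : measurableType d) (P : probability Om R),
    measure_is_complete P ->
  forall n (r : 'I_n -> Om -> R), rademacher_family P r ->
  forall a : 'I_n -> R,
    ('N[P]_(q%:E)[(fun w => (\sum_j r j w * a j)%:E)] <=
     (B * Num.sqrt (\sum_j a j ^+ 2))%:E)%E.

End Rademacher.

Section TensorPower.
Context (R : realType) (E : completeNormedModType R) (k : nat).

Definition update (x : 'I_k -> E) (i : 'I_k) (u : E) : 'I_k -> E :=
  fun j => if j == i then u else x j.

Record mform := MForm {
  mform_fun :> ('I_k -> E) -> R;
  mform_linear : forall x i (a : R) (u v : E),
    mform_fun (update x i (a *: u + v)) =
    a * mform_fun (update x i u) + mform_fun (update x i v) }.

(* The k-fold algebraic tensor product is realised inside the linear dual of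
   the space of k-linear forms on E: the elementary tensor of x is evaluation
   at x.  Two finite sums of elementary tensors agree on all k-linear forms
   iff they are equal in the algebraic tensor product. *)
Definition prealg_tensor : lmodType R := mform -> R^o.

Definition elem_tensor (x : 'I_k -> E) : prealg_tensor := fun B => B x.

Definition tpow (x : E) : prealg_tensor := elem_tensor (fun=> x).

Definition alg_tensor : set prealg_tensor :=
  [set U | exists n (x : 'I_n -> 'I_k -> E), U = \sum_j elem_tensor (x j)].

Definition sym_tensor : set prealg_tensor :=
  [set U | exists n (a : 'I_n -> R) (x : 'I_n -> E),
     U = \sum_j a j *: tpow (x j)].

Definition dual_ball : set {linear E -> R^o} :=
  [set f | forall x, `|f x| <= `|x|].

Lemma prod_form_subproof (f : 'I_k -> {linear E -> R^o}) x i (a : R) (u v : E) :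
  \prod_n (f n (update x i (a *: u + v) n) : R) =
  a * (\prod_n (f n (update x i u n) : R)) + \prod_n (f n (update x i v n) : R).
Proof.
have splitE w : \prod_n (f n (update x i w n) : R) =
                (f i w : R) * \prod_(n | n != i) (f n (x n) : R).
  rewrite (bigD1 i) //= /update eqxx; congr (_ * _).
  by apply: eq_bigr => n /negbTE ->.
by rewrite !splitE linearP mulrDl mulrA.
Qed.

Definition prod_form (f : 'I_k -> {linear E -> R^o}) : mform :=
  @MForm (fun x => \prod_n (f n (x n) : R)) (prod_form_subproof f).

Definition eps_norm (U : prealg_tensor) : R :=
  sup [set `|U (prod_form f)| | f in
       [set f : 'I_k -> {linear E -> R^o} | forall n, dual_ball (f n)]].

Definition eps_s_norm (U : prealg_tensor) : R :=
  sup [set `|U (prod_form (fun=> f))| | f in dual_ball].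

Lemma sum_tensorE n (V : 'I_n -> prealg_tensor) B :
  (\sum_j V j) B = \sum_j V j B.
Proof. exact: (big_morph (fun U : prealg_tensor => U B)). Qed.

Lemma eps_normE n (x : 'I_n -> 'I_k -> E) :
  eps_norm (\sum_j elem_tensor (x j)) =
  sup [set `|\sum_j \prod_m (f m (x j m) : R)| | f in
       [set f : 'I_k -> {linear E -> R^o} | forall m, dual_ball (f m)]].
Proof. by congr (sup (image _ _)); apply/funext => f; rewrite sum_tensorE. Qed.

Lemma eps_s_normE n (a : 'I_n -> R) (x : 'I_n -> E) :
  eps_s_norm (\sum_j a j *: tpow (x j)) =
  sup [set `|\sum_j a j * (f (x j) : R) ^+ k| | f in dual_ball].
Proof.
congr (sup (image _ _)); apply/funext => f; rewrite sum_tensorE.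
congr (`|_|); apply: eq_bigr => j _; congr (a j * _).
by rewrite /tpow /elem_tensor /= prodr_const card_ord.
Qed.

End TensorPower.

Arguments tpow {R E} k x.
Arguments alg_tensor {R} E k.
Arguments sym_tensor {R} E k.
Arguments eps_norm {R E k} U.
Arguments eps_s_norm {R E k} U.

(* A completion of the subspace S of V for the norm N on S: a Banach space with
   a linear isometric embedding of S onto a dense subspace.  It is unique up to
   isometric isomorphism; values of the embedding outside S are irrelevant. *)
Record completion (R : realType) (V : lmodType R) (S : set V) (N : V -> R) :=
  Completion {
    compl_space :> completeNormedModType R;
    compl_emb : V -> compl_space;
    compl_emb_linear : forall (a : R) u v, S u -> S v ->
      compl_emb (a *: u + v) = a *: compl_emb u + compl_emb v;
    compl_emb_norm : forall u, S u -> `|compl_emb u| = N u;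
    compl_emb_dense : closure (compl_emb @` S) = setT }.

Section InjectiveMoments.
Context (R : realType) (E : completeNormedModType R) (k : nat).

Definition inj_tensor := completion (alg_tensor E k) eps_norm.
Definition sym_inj_tensor := completion (sym_tensor E k) eps_s_norm.

(* The canonical map from the symmetric injective tensor product into the full
   one, i.e. the continuous extension of the inclusion of symmetric tensors. *)
Definition canonical_inclusion (Ts : sym_inj_tensor) (Tf : inj_tensor)
    (J : {linear Ts -> Tf}) : Prop :=
  continuous J /\
  forall u, sym_tensor E k u -> J (compl_emb Ts u) = compl_emb Tf u.

Definition inj_moment d (Om : measurableType d) (P : probability Om R)
    (Tf : inj_tensor) (xi : Om -> E) : Tf :=
  bochner_integral P (fun w => compl_emb Tf (tpow k (xi w))).

End InjectiveMoments.

Section Constants.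
Context (R : realType) (E : completeNormedModType R).
Local Open Scope ereal_scope.

Definition C_diff (q p : R) (k : nat) : \bar R :=
  (16 * k%:R * Num.sqrt pi)%R%:E * kahane_khintchine q p * type_constant E p *
  kahane_khintchine q 2.

Definition C_ML (q p : R) (k : nat) (B : R) : \bar R :=
  2%:E * maxe (C_diff q p k) B%:E.

Context d (Om : measurableType d) (P : probability Om R).

Definition Sigma_ML (q : R) (k : nat) (X : nat -> Om -> E) (l : nat) : \bar R :=
  \sum_(0 <= i < k)
    (('C(k, i.+1)%:R%:E * normL P (k%:R * q) (X l \- X l.-1)%R ^+ i
      + normL P k%:R (X l) ^+ i)
     * normL P (k%:R * q) (X l.-1) ^+ (k - i - 1)).

End Constants.

(* Main.v *)
(* Telescoping the means reduces the claim to one level: the error of an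
   empirical mean of n copies of T X - T Y, where T x is the k-fold tensor power.
   Everything is approximated by finitely valued variables (Borel roundings of
   the copies, which keep independence and laws, and simple functions for X and
   Y), so that only finite sums over A^n and over the sign cube remain.  After
   symmetrization one has to bound the mean of
     sup_f |sum_j e_j (f(x_j)^k - f(y_j)^k)|
   over signs e, f ranging in the dual ball.  The binomial formula in
   f(x_j - y_j) and f(y_j) splits this into mixed powers, and the Ledoux-Talagrand
   contraction principle, applied twice, replaces those by linear functionals;
   this gives the norm of a Rademacher sum in E, to which the type of E and the
   Kahane-Khintchine inequality apply.  The resulting numerical factor 16 k is
   below the 32 k sqrt(pi) of the statement, which comes from a comparison with
   Gaussian processes. *)

Require Import Defs.
From HB Require Import structures.
From mathcomp Require Import all_boot all_order all_algebra.
From mathcomp Require Import all_classical all_reals all_analysis.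
From mathcomp Require Import measurable_realfun ring lra.

Set Implicit Arguments.
Unset Strict Implicit.
Unset Printing Implicit Defensive.

Import Order.TTheory GRing.Theory Num.Theory.
Import numFieldNormedType.Exports.

Local Open Scope classical_set_scope.
Local Open Scope ring_scope.

(** * Weighted l_q norms *)

(** The copies [xi l j] are copies of the tensor [T X - T Y] only: nothing says that they come from
    independent copies of the pair [(X, Y)], while symmetrization and contraction need the numbers
    [f(x_j)] and [f(y_j)]. Finite values remove this obstacle. Each copy is rounded by a fixed Borel
    map, so the rounded copies have a product law; each factor is a marginal of the joint law, on a
    finite set [A], of the rounded tensor and of simple approximations of [X] and [Y]. The error can
    therefore be computed on [A^n] under the product of that joint law, where the pairs exist.
    Suprema over the dual ball then occur only inside finite sums and raise no question of
    measurability. The factor 16 is 2 times 8: 2 from symmetrization, and 8 from polarisation, which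
    produces two squares, each costing two contractions with a factor 2 apiece. The factor [k] is
    the sum of the degrees of the two powers. The constants of the statement are infima over bounds
    valid on all probability spaces; until the end a single real [C] stands for the product of
    [K_{q,p}] and [tau_p(E)]. *)

Section WeightedNorm.
Context {R : realType}.
Implicit Types q : R.

Lemma ler_powR2 q (x y : R) : 0 <= q -> 0 <= x -> x <= y -> x `^ q <= y `^ q.
Proof.
move=> q0 x0 xy; apply: ge0_ler_powR => //; rewrite nnegrE //.
exact: le_trans xy.
Qed.

Lemma powRK q (x : R) : q != 0 -> 0 <= x -> (x `^ q) `^ q^-1 = x.
Proof. by move=> q0 x0; rewrite -powRrM mulfV// powRr1. Qed.

Lemma powRVK q (x : R) : q != 0 -> 0 <= x -> (x `^ q^-1) `^ q = x.
Proof. by move=> q0 x0; rewrite -powRrM mulVf// powRr1. Qed.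

(** Young's inequality for the product of [t] and 1, with conjugate exponents [q] and
    [(1 - q^-1)^-1]. *)
Lemma bernoulli_powR q (t : R) : 1 <= q -> 0 <= t -> 1 + q * (t - 1) <= t `^ q.
Proof.
rewrite le_eqVlt => /predU1P[<-|q1] t0; first by rewrite powRr1//; lra.
have q0 : 0 < q by lra.
have := @conjugate_powR R t 1 q (1 - q^-1)^-1 t0 ler01 q0.
have iq : q^-1 < 1 by rewrite invf_lt1.
rewrite invr_gt0 subr_gt0 iq => /(_ isT).
rewrite invrK addrCA subrr addr0 => /(_ erefl).
rewrite powR1 mulr1 mul1r -(ler_pM2l q0) => H.
rewrite -(ler_pM2l q0) in H.
have e1 : q * (q * (t `^ q / q + (1 - q^-1))) = q * (t `^ q + q - 1).
  by field; lra.
rewrite e1 !(ler_pM2l q0) in H.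
lra.
Qed.

(** Bernoulli's inequality at [g t / m], with [m] the mean, is the supporting line at [m]; its
    linear part averages to zero. *)
Lemma jensen_powR (T : finType) (w g : T -> R) q :
  1 <= q -> (forall t, 0 <= w t) -> (forall t, 0 <= g t) ->
  \sum_t w t = 1 -> (\sum_t w t * g t) `^ q <= \sum_t w t * g t `^ q.
Proof.
move=> q1 w0 g0 w1; set m := \sum_t w t * g t.
have m0 : 0 <= m by apply: sumr_ge0 => t _; rewrite mulr_ge0.
have [->|mn0] := eqVneq m 0.
  rewrite powR0; last by apply/eqP; lra.
  by apply: sumr_ge0 => t _; rewrite mulr_ge0// powR_ge0.
have mp : 0 < m by rewrite lt_neqAle eq_sym mn0.
have H : m `^ q * (\sum_t w t * (1 + q * (g t / m - 1))) <=
    m `^ q * \sum_t w t * (g t / m) `^ q.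
  apply: ler_wpM2l; first exact: powR_ge0.
  apply: ler_sum => t _; apply: ler_wpM2l => //.
  by apply: bernoulli_powR => //; rewrite divr_ge0.
have e1 : \sum_t w t * (1 + q * (g t / m - 1)) = 1.
  transitivity (\sum_t ((1 - q) * w t + (q / m) * (w t * g t))).
    by apply: eq_bigr => t _; field.
  rewrite big_split/= -!mulr_sumr w1 -/m; field; exact: mn0.
have e2 : m `^ q * (\sum_t w t * (g t / m) `^ q) = \sum_t w t * g t `^ q.
  rewrite mulr_sumr; apply: eq_bigr => t _.
  rewrite mulrCA -powRM//; last by rewrite divr_ge0.
  by rewrite mulrCA mulfV// mulr1.
by move: H; rewrite e1 e2 mulr1.
Qed.

Lemma convex_powR2 q (s x y : R) : 1 <= q -> 0 <= s <= 1 -> 0 <= x -> 0 <= y ->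
  (s * x + (1 - s) * y) `^ q <= s * x `^ q + (1 - s) * y `^ q.
Proof.
move=> q1 /andP[s0 s1] x0 y0.
have := @jensen_powR bool (fun b => if b then s else 1 - s)
  (fun b => if b then x else y) q q1.
rewrite !big_bool /=; apply.
- by case; lra.
- by case.
- by lra.
Qed.

Definition wnorm (T : finType) (w : T -> R) q (g : T -> R) : R :=
  (\sum_t w t * `|g t| `^ q) `^ q^-1.

Section Fixed.
Context (T : finType) (w : T -> R) (q : R).
Hypothesis q1 : 1 <= q.
Hypothesis w0 : forall t, 0 <= w t.
Implicit Types g h : T -> R.

Let q0 : 0 < q. Proof. exact: lt_le_trans q1. Qed.
Let qn0 : q != 0. Proof. by rewrite gt_eqF. Qed.

Lemma wsum_ge0 g : 0 <= \sum_t w t * `|g t| `^ q.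
Proof. by apply: sumr_ge0 => t _; rewrite mulr_ge0// powR_ge0. Qed.

Lemma wnorm_ge0 g : 0 <= wnorm w q g.
Proof. exact: powR_ge0. Qed.

Lemma wnorm_powR g : wnorm w q g `^ q = \sum_t w t * `|g t| `^ q.
Proof. by rewrite powRVK// wsum_ge0. Qed.

Lemma le_wnorm g h : (forall t, `|g t| <= `|h t|) -> wnorm w q g <= wnorm w q h.
Proof.
move=> gh; apply: ler_powR2; first by rewrite invr_ge0 ltW.
  exact: wsum_ge0.
apply: ler_sum => t _; apply: ler_wpM2l => //.
by apply: ler_powR2 => //; exact: ltW.
Qed.

Lemma wnormZ (c : R) g : wnorm w q (fun t => c * g t) = `|c| * wnorm w q g.
Proof.
rewrite /wnorm.
have -> : \sum_t w t * `|c * g t| `^ q = `|c| `^ q * \sum_t w t * `|g t| `^ q.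
  by rewrite mulr_sumr; apply: eq_bigr => t _; rewrite normrM powRM// mulrCA.
by rewrite powRM ?powR_ge0 ?wsum_ge0// powRK.
Qed.

(** Convexity of the power, applied to [|g| / a] and [|h| / b] with weights [a / (a + b)] and
    [b / (a + b)], where [a] and [b] are the two norms. *)
Lemma wnormD g h : wnorm w q (fun t => g t + h t) <= wnorm w q g + wnorm w q h.
Proof.
(* A vanishing norm cannot be divided by; in that case the function is zero wherever the weight is
   not. *)
have eq0 g' h' : wnorm w q g' = 0 ->
    wnorm w q (fun t => g' t + h' t) <= wnorm w q h'.
  move=> /powR_eq0_eq0 /eqP; rewrite psumr_eq0; last first.
    by move=> t _; rewrite mulr_ge0// powR_ge0.
  move=> /allP g0; apply: ler_powR2; first by rewrite invr_ge0 ltW.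
    exact: wsum_ge0.
  apply: ler_sum => t _; have /implyP/(_ isT) := g0 t (mem_index_enum t).
  rewrite mulf_eq0 => /orP[/eqP->|]; first by rewrite !mul0r.
  by rewrite powR_eq0 => /andP[+ _]; rewrite normr_eq0 => /eqP->; rewrite add0r.
have [g0|gn0] := eqVneq (wnorm w q g) 0; first by rewrite g0 add0r eq0.
have [h0|hn0] := eqVneq (wnorm w q h) 0.
  rewrite h0 addr0; under [X in wnorm _ _ X]eq_fun do rewrite addrC.
  exact: eq0.
have := wnorm_powR h; have := wnorm_powR g.
have : 0 < wnorm w q g by rewrite lt_neqAle eq_sym gn0 wnorm_ge0.
have : 0 < wnorm w q h by rewrite lt_neqAle eq_sym hn0 wnorm_ge0.
move: {gn0 hn0} (wnorm w q g) (wnorm w q h) => a b b0 a0 aE bE.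
have ab0 : 0 < a + b by apply: addr_gt0.
rewrite -(@powRK q (a + b) qn0 (ltW ab0)).
rewrite {1}/wnorm; apply: ler_powR2; first by rewrite invr_ge0 ltW.
  exact: wsum_ge0.
set s := a / (a + b).
have s01 : 0 <= s <= 1.
  apply/andP; split; first by apply: divr_ge0; exact: ltW.
  by rewrite /s ler_pdivrMr// mul1r lerDl ltW.
have [s0 s1] : 0 <= s /\ 0 <= 1 - s by case/andP: s01; split; lra.
have key t : `|g t + h t| `^ q <= (a + b) `^ q *
    (s * (`|g t| `^ q / a `^ q) + (1 - s) * (`|h t| `^ q / b `^ q)).
  have e x y : 0 <= x -> 0 < y -> x `^ q / y `^ q = (x / y) `^ q.
    move=> x0 y0; rewrite powRM ?invr_ge0 ?(ltW y0)//; congr (_ * _).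
    by rewrite -(powR_inv1 (ltW y0)) powRAC powR_inv1// powR_ge0.
  rewrite !e//.
  apply: (@le_trans _ _ ((a + b) `^ q *
      (s * (`|g t| / a) + (1 - s) * (`|h t| / b)) `^ q)); last first.
    apply: ler_wpM2l; first exact: powR_ge0.
    by apply: convex_powR2 => //; apply: divr_ge0 => //; exact: ltW.
  rewrite -powRM; last 2 first.
  - exact: ltW.
  - by apply: addr_ge0; apply: mulr_ge0 => //; apply: divr_ge0 => //; exact: ltW.
  apply: ler_powR2 => //; rewrite ?(ltW q0)//.
  suff -> : (a + b) * (s * (`|g t| / a) + (1 - s) * (`|h t| / b)) =
    `|g t| + `|h t| by exact: ler_normD.
  by rewrite /s; field; lra.
apply: (@le_trans _ _ ((a + b) `^ q * (s * ((\sum_t w t * `|g t| `^ q) / a `^ q)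
   + (1 - s) * ((\sum_t w t * `|h t| `^ q) / b `^ q)))).
  rewrite !mulr_suml !mulr_sumr -big_split/= mulr_sumr.
  apply: ler_sum => t _.
  apply: (le_trans (ler_wpM2l (w0 t) (key t))).
  by rewrite le_eqVlt; apply/orP; left; apply/eqP; ring.
rewrite -aE -bE !divff ?gt_eqF ?powR_gt0//.
by rewrite !mulr1 (addrC s) subrK mulr1.
Qed.

Lemma wnorm_sum (I : Type) (r : seq I) (g : I -> T -> R) :
  wnorm w q (fun t => \sum_(i <- r) g i t) <= \sum_(i <- r) wnorm w q (g i).
Proof.
elim: r => [|i r IH].
  rewrite big_nil /wnorm big1 ?powR0 ?invr_eq0//.
  by move=> t _; rewrite big_nil normr0 powR0// mulr0.
rewrite big_cons; under [X in wnorm _ _ X]eq_fun do rewrite big_cons.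
by apply: (le_trans (wnormD _ _)); rewrite lerD2l.
Qed.

Lemma wnorm_cst (c : R) : \sum_t w t = 1 -> wnorm w q (fun=> c) = `|c|.
Proof. by move=> w1; rewrite /wnorm -mulr_suml w1 mul1r powRK. Qed.

Lemma le_wnorm_cst g (c : R) : \sum_t w t = 1 -> 0 <= c ->
  (forall t, `|g t| <= c) -> wnorm w q g <= c.
Proof.
move=> w1 c0 gc; rewrite -[leRHS]ger0_norm// -(wnorm_cst c w1).
by apply: le_wnorm => t; rewrite (ger0_norm c0).
Qed.

End Fixed.
End WeightedNorm.

(** * Contraction principle on the sign cube *)

(** The hypotheses say that [(P, Q)] is weakly majorized by [(A, B)], an order that sums of an
    increasing convex function respect. *)
Lemma two_point_powR {R : realType} (q P Q A B : R) : 1 <= q ->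
  0 <= P -> 0 <= Q -> 0 <= A -> 0 <= B ->
  P <= Num.max A B -> Q <= Num.max A B -> P + Q <= A + B ->
  P `^ q + Q `^ q <= A `^ q + B `^ q.
Proof.
move=> q1.
wlog BA : A B / B <= A => [H|].
  case/orP: (le_total B A) => [/H//|AB P0 Q0 A0 B0].
  by rewrite maxC (addrC A) (addrC (A `^ q)) => PA QA PQ; exact: H.
wlog QP : P Q / Q <= P => [H|].
  case/orP: (le_total Q P) => [/H//|AB P0 Q0 A0 B0 PA QA].
  by rewrite (addrC P) (addrC (P `^ q)) => PQ; exact: H.
move=> P0 Q0 A0 B0; rewrite (max_idPl BA) => PA QA PQ.
have q0 : 0 <= q by lra.
have [QB|BQ] := leP Q B; first by apply: lerD; exact: ler_powR2.
have AB : 0 < A - B by lra.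
(* [P] lies between [B] and [A], with barycentric weight [s]; the bound on [P + Q] puts [Q] below
   the mirror image [A + B - P], which has weight [1 - s]. *)
pose s := (P - B) / (A - B).
have s01 : 0 <= s <= 1.
  by rewrite /s divr_ge0 ?(ltW AB)//=; [rewrite ler_pdivrMr//; lra|lra].
have Pe : P = s * A + (1 - s) * B by rewrite /s; field; lra.
have Qe : Q <= (1 - s) * A + (1 - (1 - s)) * B by lra.
have h1 : P `^ q <= s * A `^ q + (1 - s) * B `^ q.
  by rewrite {1}Pe; exact: convex_powR2.
have h2 : Q `^ q <= (1 - s) * A `^ q + (1 - (1 - s)) * B `^ q.
  apply: (@le_trans _ _ (((1 - s) * A + (1 - (1 - s)) * B) `^ q)).
    by apply: ler_powR2.
  by apply: convex_powR2 => //; lra.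
lra.
Qed.

Section SupOn.
Context {R : realType} {T : Type}.
Implicit Types (D : set T) (F : T -> R).

Definition bounded_on D F := exists B, forall t, D t -> `|F t| <= B.

Definition supon D F := sup (F @` D).

Lemma supon_ge D F t : bounded_on D F -> D t -> F t <= supon D F.
Proof.
move=> [B FB] Dt; apply: ub_le_sup; last by exists t.
by exists B => _ [s Ds <-]; exact: le_trans (ler_norm _) (FB _ Ds).
Qed.

Lemma supon_le D F t0 c : D t0 -> (forall t, D t -> F t <= c) -> supon D F <= c.
Proof.
move=> D0 Fc; apply: ge_sup; first by exists (F t0), t0.
by move=> _ [s Ds <-]; exact: Fc.
Qed.

Lemma supon_addr_le D F G t0 c : D t0 -> (forall t s, D t -> D s -> F t + G s <= c) ->
  supon D F + supon D G <= c.
Proof.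
move=> D0 H; rewrite -lerBrDr; apply: (supon_le D0) => t Dt.
rewrite lerBrDr addrC -lerBrDr; apply: (supon_le D0) => s Ds.
by rewrite lerBrDr addrC; exact: H.
Qed.

Lemma bounded_onD D F G : bounded_on D F -> bounded_on D G ->
  bounded_on D (fun t => F t + G t).
Proof.
move=> [A FA] [B GB]; exists (A + B) => t Dt.
by rewrite (le_trans (ler_normD _ _))// lerD ?FA ?GB.
Qed.

Lemma bounded_onZ D (c : R) F : bounded_on D F -> bounded_on D (fun t => c * F t).
Proof.
move=> [A FA]; exists (`|c| * A) => t Dt.
by rewrite normrM ler_wpM2l// FA.
Qed.

Lemma bounded_onN D F : bounded_on D F -> bounded_on D (fun t => - F t).
Proof. by move=> [A FA]; exists A => t Dt; rewrite normrN FA. Qed.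

Lemma bounded_on_norm D F : bounded_on D F -> bounded_on D (fun t => `|F t|).
Proof. by move=> [A FA]; exists A => t Dt; rewrite normr_id FA. Qed.

Lemma bounded_on_sum D (I : finType) (P : pred I) (F : I -> T -> R) :
  (forall i, bounded_on D (F i)) ->
  bounded_on D (fun t => \sum_(i | P i) F i t).
Proof.
move=> FB; have [B HB] := choice FB; exists (\sum_(i | P i) B i) => t Dt.
by rewrite (le_trans (ler_norm_sum _ _ _))// ler_sum// => i _; exact: HB.
Qed.

(** The contraction principle for a single sign. The bound on the maximum needs only [|u| <= |v|],
    that is, the Lipschitz condition against the base point [t0]; the bound on the sum needs it for
    arbitrary pairs. Vanishing at [t0] also makes the suprema nonnegative. *)
Lemma supon_two_point D (a u v : T -> R) t0 q : 1 <= q ->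
  bounded_on D a -> bounded_on D u -> bounded_on D v ->
  D t0 -> a t0 = 0 -> u t0 = 0 -> v t0 = 0 ->
  (forall t s, D t -> D s -> `|u t - u s| <= `|v t - v s|) ->
  supon D (fun t => a t + u t) `^ q + supon D (fun t => a t - u t) `^ q <=
  supon D (fun t => a t + v t) `^ q + supon D (fun t => a t - v t) `^ q.
Proof.
move=> q1 ba bu bv D0 a0 u0 v0 uv.
have bp w : bounded_on D w -> bounded_on D (fun t => a t + w t).
  exact: bounded_onD.
have bm w : bounded_on D w -> bounded_on D (fun t => a t - w t).
  by move=> bw; apply: bounded_onD => //; exact: bounded_onN.
have gep w : bounded_on D w -> w t0 = 0 -> 0 <= supon D (fun t => a t + w t).
  move=> bw w0; have := supon_ge (bp _ bw) D0.
  by rewrite a0 w0 addr0.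
have gem w : bounded_on D w -> w t0 = 0 -> 0 <= supon D (fun t => a t - w t).
  move=> bw w0; have := supon_ge (bm _ bw) D0.
  by rewrite a0 w0 subr0.
have uv1 t : D t -> `|u t| <= `|v t|.
  by move=> Dt; have := uv t t0 Dt D0; rewrite u0 v0 !subr0.
apply: two_point_powR => //; try by [exact: gep|exact: gem].
- apply: (supon_le D0) => t Dt; rewrite le_max.
  have [v0t|vt0] := leP 0 (v t).
    apply/orP; left; apply: le_trans (supon_ge (bp _ bv) Dt).
    by rewrite lerD2l (le_trans (ler_norm _))// (le_trans (uv1 _ Dt))// ger0_norm.
  apply/orP; right; apply: le_trans (supon_ge (bm _ bv) Dt).
  by rewrite lerD2l (le_trans (ler_norm _))// (le_trans (uv1 _ Dt))// ltr0_norm.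
- apply: (supon_le D0) => t Dt; rewrite le_max.
  have [v0t|vt0] := leP 0 (v t).
    apply/orP; left; apply: le_trans (supon_ge (bp _ bv) Dt).
    rewrite lerD2l (le_trans (ler_norm _))// normrN (le_trans (uv1 _ Dt))//.
    by rewrite ger0_norm.
  apply/orP; right; apply: le_trans (supon_ge (bm _ bv) Dt).
  rewrite lerD2l (le_trans (ler_norm _))// normrN (le_trans (uv1 _ Dt))//.
  by rewrite ltr0_norm.
- apply: (supon_addr_le D0) => t s Dt Ds.
  have H := uv _ _ Dt Ds.
  have H1 := supon_ge (bp _ bv) Dt; have H2 := supon_ge (bm _ bv) Ds.
  have H3 := supon_ge (bp _ bv) Ds; have H4 := supon_ge (bm _ bv) Dt.
  have H5 := ler_norm (u t - u s).
  have [vts|vts] := leP 0 (v t - v s).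
    by rewrite (ger0_norm vts) in H; lra.
  by rewrite (ltr0_norm vts) in H; lra.
Qed.

End SupOn.

Section Signs.
Context {R : realType} (n : nat).
Local Notation signs := {ffun 'I_n -> bool}.
Implicit Types e : signs.

Definition sg e (j : 'I_n) : R := (-1) ^+ (e j).

Definition cube_weight (_ : signs) : R := 2^-1 ^+ n.

Definition flip (j : 'I_n) e : signs :=
  [ffun i => if i == j then ~~ e i else e i].

Definition neg e : signs := [ffun i => ~~ e i].

Lemma cube_weight_ge0 e : 0 <= cube_weight e.
Proof. by rewrite /cube_weight exprn_ge0// invr_ge0. Qed.

Lemma cube_weight1 : \sum_e cube_weight e = 1.
Proof.
rewrite sumr_const card_ffun card_bool card_ord /cube_weight.
by rewrite -[_ *+ (2 ^ n)]mulr_natr natrX -exprMn mulVf// expr1n.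
Qed.

Lemma flipK j : involutive (flip j).
Proof.
move=> e; apply/ffunP => i; rewrite !ffunE.
by case: eqVneq => // _; rewrite negbK.
Qed.

Lemma negK : involutive neg.
Proof. by move=> e; apply/ffunP => i; rewrite !ffunE negbK. Qed.

Lemma normr_sg e j : `|sg e j| = 1.
Proof. by rewrite /sg normrX normrN1 expr1n. Qed.

Lemma sg_neg e j : sg (neg e) j = - sg e j.
Proof. by rewrite /sg ffunE; case: (e j); rewrite !(expr0, expr1, opprK). Qed.

Context {T : Type} (D : set T) (t0 : T) (D0 : D t0).
Implicit Types h u v : 'I_n -> T -> R.

Definition rproc h e (t : T) : R := \sum_j sg e j * h j t.

Lemma bounded_rproc h e : (forall j, bounded_on D (h j)) ->
  bounded_on D (rproc h e).
Proof. by move=> hb; apply: bounded_on_sum => j; exact: bounded_onZ. Qed.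

(** With every sign but the [j0]-th frozen, the process is [a] plus or minus one term; pairing [e]
    with [flip j0 e] leaves [supon_two_point] to be applied to each pair. *)
Lemma contraction_step h h' j0 q : 1 <= q ->
  (forall j, bounded_on D (h j)) -> (forall j, bounded_on D (h' j)) ->
  (forall j, h j t0 = 0) -> (forall j, h' j t0 = 0) ->
  (forall j, j != j0 -> h j = h' j) ->
  (forall t s, D t -> D s -> `|h j0 t - h j0 s| <= `|h' j0 t - h' j0 s|) ->
  \sum_e supon D (rproc h e) `^ q <= \sum_e supon D (rproc h' e) `^ q.
Proof.
move=> q1 bh bh' h0 h'0 hh' lip.
have half (G : signs -> R) : \sum_e G e = 2^-1 * \sum_e (G e + G (flip j0 e)).
  have fG : \sum_e G e = \sum_e G (flip j0 e).
    exact: (reindex_inj (inv_inj (flipK j0))).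
  by rewrite big_split/= -fG; field.
rewrite half (half (fun e => supon D (rproc h' e) `^ q)).
apply: ler_wpM2l; first by rewrite invr_ge0.
apply: ler_sum => e _.
pose a t := \sum_(j | j != j0) sg e j * h j t.
have split1 g (ee : signs) : (forall j, j != j0 -> g j = h j) ->
    (forall j, j != j0 -> ee j = e j) ->
    rproc g ee = (fun t => a t + sg ee j0 * g j0 t).
  move=> gh eee; apply/funext => t; rewrite /rproc (bigD1 j0)//= addrC.
  by congr (_ + _); apply: eq_bigr => j jj0; rewrite gh// /sg eee.
have fe j : j != j0 -> flip j0 e j = e j by move=> /negbTE jj; rewrite ffunE jj.
rewrite !(split1 h)// !(split1 h')//; try by move=> j jj0; rewrite hh'.
have ba : bounded_on D a by apply: bounded_on_sum => j; exact: bounded_onZ.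
have a0 : a t0 = 0 by rewrite /a big1// => j _; rewrite h0 mulr0.
have := supon_two_point q1 ba (bh j0) (bh' j0) D0 a0 (h0 _) (h'0 _) lip.
rewrite /sg ffunE eqxx; case: (e j0) => /=; rewrite !(expr0, expr1).
  under [fun t => a t + -1 * h j0 t]eq_fun do rewrite mulN1r.
  under [fun t => a t + -1 * h' j0 t]eq_fun do rewrite mulN1r.
  under [fun t => a t + 1 * h j0 t]eq_fun do rewrite mul1r.
  under [fun t => a t + 1 * h' j0 t]eq_fun do rewrite mul1r.
  by rewrite addrC [leRHS]addrC.
under [fun t => a t + -1 * h j0 t]eq_fun do rewrite mulN1r.
under [fun t => a t + -1 * h' j0 t]eq_fun do rewrite mulN1r.
under [fun t => a t + 1 * h j0 t]eq_fun do rewrite mul1r.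
by under [fun t => a t + 1 * h' j0 t]eq_fun do rewrite mul1r.
Qed.

Lemma contraction_sup u v q : 1 <= q ->
  (forall j, bounded_on D (u j)) -> (forall j, bounded_on D (v j)) ->
  (forall j, u j t0 = 0) -> (forall j, v j t0 = 0) ->
  (forall j t s, D t -> D s -> `|u j t - u j s| <= `|v j t - v j s|) ->
  \sum_e supon D (rproc u e) `^ q <= \sum_e supon D (rproc v e) `^ q.
Proof.
move=> q1 bu bv u0 v0 lip.
(* Interpolation: the first [m] coordinates already carry [v], the others still [u], and one
   coordinate changes at a time. *)
pose H m (j : 'I_n) := if (j < m)%N then v j else u j.
have step m : (m <= n)%N ->
    \sum_e supon D (rproc u e) `^ q <= \sum_e supon D (rproc (H m) e) `^ q.
  elim: m => [_|m IH mn]; first by rewrite /H.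
  apply: (le_trans (IH (ltnW mn))).
  apply: (@contraction_step _ _ (Ordinal mn)) => //.
  - by move=> j; rewrite /H; case: ifP.
  - by move=> j; rewrite /H; case: ifP.
  - by move=> j; rewrite /H; case: ifP.
  - by move=> j; rewrite /H; case: ifP.
  - move=> j jm; rewrite /H ltnS.
    have -> : (j <= m)%N = (j < m)%N; last by [].
    by rewrite [RHS]ltn_neqAle; move: jm; rewrite -val_eqE/= => ->.
  - by move=> t s Dt Ds; rewrite /H/= ltnn leqnn; exact: lip.
apply: (le_trans (step n (leqnn n))).
suff -> : H n = v by [].
by apply/funext => j; rewrite /H ltn_ord.
Qed.

Definition rad_norm q h : R :=
  wnorm cube_weight q (fun e => supon D (fun t => `|rproc h e t|)).

(** The factor 2 is the price of the absolute value: the supremum of the modulus is the larger of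
    the suprema at [e] and at [neg e], which have the same law. This doubles the [q]-th moment, and
    2 to the power [1/q] is at most 2. *)
Lemma contraction u v q : 1 <= q ->
  (forall j, bounded_on D (u j)) -> (forall j, bounded_on D (v j)) ->
  (forall j, u j t0 = 0) -> (forall j, v j t0 = 0) ->
  (forall j t s, D t -> D s -> `|u j t - u j s| <= `|v j t - v j s|) ->
  rad_norm q u <= 2 * rad_norm q v.
Proof.
move=> q1 bu bv u0 v0 lip.
have q0 : 0 <= q by lra.
have rp0 h e : (forall j, h j t0 = 0) -> rproc h e t0 = 0.
  by move=> h0; rewrite /rproc big1// => j _; rewrite h0 mulr0.
have sup0 h e : (forall j, bounded_on D (h j)) -> (forall j, h j t0 = 0) ->
    0 <= supon D (rproc h e).
  move=> bh h0; rewrite -(rp0 h e h0); apply: supon_ge => //.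
  exact: bounded_rproc.
have supn0 h e : (forall j, bounded_on D (h j)) -> (forall j, h j t0 = 0) ->
    0 <= supon D (fun t => `|rproc h e t|).
  move=> bh h0; rewrite -(@normr0 _ R) -(rp0 h e h0).
  apply: (@supon_ge _ _ D (fun t => `|rproc h e t|)) => //.
  by apply: bounded_on_norm; exact: bounded_rproc.
have H1 e : supon D (fun t => `|rproc u e t|) `^ q <=
    supon D (rproc u e) `^ q + supon D (rproc u (neg e)) `^ q.
  have ne t : rproc u (neg e) t = - rproc u e t.
    by rewrite /rproc -sumrN; apply: eq_bigr => j _; rewrite sg_neg mulNr.
  apply: (@le_trans _ _ (Num.max (supon D (rproc u e)) (supon D (rproc u (neg e))) `^ q)).
    apply: ler_powR2 => //; first exact: supn0.
    apply: (supon_le D0) => t Dt; rewrite le_max.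
    have [ut|ut] := leP 0 (rproc u e t).
      by rewrite (ger0_norm ut) supon_ge//; exact: bounded_rproc.
    rewrite (ltr0_norm ut) -ne (@supon_ge _ _ D (rproc u (neg e)))// ?orbT//.
    exact: bounded_rproc.
  by rewrite maxEle; case: ifP => _; rewrite ?lerDl ?lerDr powR_ge0.
have H2 : \sum_e supon D (fun t => `|rproc u e t|) `^ q <=
    2 * \sum_e supon D (fun t => `|rproc v e t|) `^ q.
  apply: (le_trans (ler_sum _ (fun e _ => H1 e))).
  have nS : \sum_e supon D (rproc u e) `^ q = \sum_e supon D (rproc u (neg e)) `^ q.
    exact: (reindex_inj (inv_inj negK)).
  rewrite big_split/= -nS -[leLHS]mulr2n -[leLHS]mulr_natl.
  apply: ler_wpM2l => //.
  apply: (le_trans (contraction_sup q1 bu bv u0 v0 lip)).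
  apply: ler_sum => e _; apply: ler_powR2 => //; first exact: sup0.
  apply: (supon_le D0) => t Dt; apply: (le_trans (ler_norm _)).
  apply: (@supon_ge _ _ D (fun t => `|rproc v e t|)) => //.
  by apply: bounded_on_norm; exact: bounded_rproc.
rewrite /rad_norm /wnorm /cube_weight -!mulr_sumr.
have nE h : (forall j, bounded_on D (h j)) -> (forall j, h j t0 = 0) ->
    \sum_e `|supon D (fun t => `|rproc h e t|)| `^ q =
    \sum_e supon D (fun t => `|rproc h e t|) `^ q.
  by move=> bh h0; apply: eq_bigr => e _; rewrite ger0_norm// supn0.
rewrite !nE//.
have S0 h : 0 <= \sum_e supon D (fun t => `|rproc h e t|) `^ q.
  by apply: sumr_ge0 => e _; exact: powR_ge0.
have c0 : 0 <= (2^-1 ^+ n : R) by rewrite exprn_ge0// invr_ge0.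
have qi0 : 0 <= q^-1 by rewrite invr_ge0.
apply: (@le_trans _ _ ((2 * (2^-1 ^+ n * \sum_e supon D (fun t => `|rproc v e t|) `^ q)) `^ q^-1)).
  apply: ler_powR2 => //; first exact: (@mulr_ge0 R _ _ c0 (S0 u)).
  by rewrite mulrCA; apply: ler_wpM2l.
rewrite (powRM _ _ (mulr_ge0 c0 (S0 v)))//.
apply: ler_wpM2r; first exact: powR_ge0.
by apply: ler1_powR; [rewrite ler1n|rewrite invf_le1//; lra].
Qed.

Lemma rad_normD q u v : 1 <= q ->
  (forall j, bounded_on D (u j)) -> (forall j, bounded_on D (v j)) ->
  rad_norm q (fun j t => u j t + v j t) <= rad_norm q u + rad_norm q v.
Proof.
move=> q1 bu bv.
apply: le_trans (wnormD q1 cube_weight_ge0 _ _).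
apply: le_wnorm => // [|e]; first exact: cube_weight_ge0.
have ge0 h : (forall j, bounded_on D (h j)) -> 0 <= supon D (fun t => `|rproc h e t|).
  move=> bh; apply: le_trans (normr_ge0 (rproc h e t0)) _.
  apply: (@supon_ge _ _ D (fun t => `|rproc h e t|)) => //.
  by apply: bounded_on_norm; exact: bounded_rproc.
rewrite !ger0_norm//; [|by rewrite addr_ge0// ge0|]; last first.
  by apply: ge0 => j; exact: bounded_onD.
apply: (supon_le D0) => t Dt.
have -> : rproc (fun j t => u j t + v j t) e t = rproc u e t + rproc v e t.
  by rewrite /rproc -big_split; apply: eq_bigr => j _; rewrite mulrDr.
apply: (le_trans (ler_normD _ _)); apply: lerD.
  apply: (@supon_ge _ _ D (fun t => `|rproc u e t|)) => //.
  by apply: bounded_on_norm; exact: bounded_rproc.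
apply: (@supon_ge _ _ D (fun t => `|rproc v e t|)) => //.
by apply: bounded_on_norm; exact: bounded_rproc.
Qed.

End Signs.

Section PowerDifferences.
Context {R : realType}.

Lemma lip_exp_unit (a : nat) (x y : R) : `|x| <= 1 -> `|y| <= 1 ->
  `|x ^+ a - y ^+ a| <= a%:R * `|x - y|.
Proof.
move=> x1 y1; rewrite subrXX normrM mulrC ler_wpM2r//.
apply: (le_trans (ler_norm_sum _ _ _)).
rewrite -[leRHS](_ : \sum_(i < a) 1 = _); last first.
  by rewrite sumr_const card_ord.
apply: ler_sum => i _; rewrite normrM !normrX.
by rewrite mulr_ile1// ?exprn_ge0// exprn_ile1.
Qed.

Lemma lip_sqr4 (x y : R) : `|x| <= 2 -> `|y| <= 2 ->
  `|4^-1 * x ^+ 2 - 4^-1 * y ^+ 2| <= `|x - y|.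
Proof.
move=> x2 y2; rewrite -mulrBr subr_sqr mulrCA normrM -[leRHS]mulr1.
apply: ler_wpM2l => //; rewrite normrM ger0_norm ?invr_ge0//.
by have := ler_normD x y; lra.
Qed.

(** Every term retains a factor [s - t]; this is the source of the norm of [X_l - X_{l-1}] in the
    final estimate. *)
Lemma expr_diff_expand (k : nat) (s t : R) :
  s ^+ k - t ^+ k =
  \sum_(i < k) 'C(k, i.+1)%:R * ((s - t) ^+ i.+1 * t ^+ (k - i - 1)).
Proof.
rewrite -{1}[s](subrKC t) exprDn big_ord_recl/= bin0 mulr1n subn0 expr0 mulr1.
rewrite addrC addKr; apply: eq_bigr => i _.
by rewrite /bump/= add1n mulr_natl mulrC -subnDA addn1.
Qed.

End PowerDifferences.

(** * Signed sums of mixed powers of functionals *)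

Section MixedPowers.
Context {R : realType} (E : completeNormedModType R) (n : nat) (p q C : R).
Hypotheses (p1 : 1 <= p) (q1 : 1 <= q) (C0 : 0 <= C).
Implicit Types (f : {linear E -> R^o}) (z x y d : 'I_n -> E).

(** All that the argument uses of the geometry of [E]: the type inequality with an [L_q] norm on the
    left. One real [C] replaces the constants of the statement, so that they can be optimised
    last. *)
Definition sign_type_bound := forall z,
  wnorm (@cube_weight R n) q (fun e => `|\sum_j sg e j *: z j|) <=
  C * (\sum_j `|z j| `^ p) `^ p^-1.

Hypothesis HC : sign_type_bound.

Let D : set {linear E -> R^o} := @dual_ball R E.
Let f0 : {linear E -> R^o} := \0%R.

Let p0 : 0 < p. Proof. exact: lt_le_trans ltr01 p1. Qed.

Let D0 : D f0.
Proof. by move=> x; rewrite normr0. Qed.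

Let Df f (u : E) : D f -> `|u| <= 1 -> `|(f u : R)| <= 1.
Proof. by move=> /(_ u) /le_trans; exact. Qed.

Let fZ f (c : R) (u : E) : (f (c *: u) : R) = c * (f u : R).
Proof. by rewrite linearZ. Qed.

(** For linear entries the process at [f] is [f] applied to the signed sum, so its supremum over the
    dual ball is at most the norm of that sum. *)
Lemma rad_norm_linear z : rad_norm D q (fun j f => f (z j) : R) <=
  C * (\sum_j `|z j| `^ p) `^ p^-1.
Proof.
apply: le_trans (HC z).
apply: (le_wnorm q1 (@cube_weight_ge0 R n)) => e.
have bd : bounded_on D (rproc (fun j f => f (z j) : R) e).
  by apply: bounded_rproc => j; exists `|z j| => f; exact.
rewrite ger0_norm; last first.
  apply: le_trans (normr_ge0 (rproc (fun j f => f (z j) : R) e f0)) _.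
  by apply: (@supon_ge _ _ D (fun f => `|rproc _ e f|)) => //; exact: bounded_on_norm.
rewrite normr_id.
apply: (supon_le D0) => f Hf.
suff -> : rproc (fun j f => f (z j) : R) e f = f (\sum_j sg e j *: z j) by exact: Hf.
by rewrite linear_sum; apply: eq_bigr => j _; rewrite linearZ.
Qed.

(** On [[-1, 1]] the power [a] has Lipschitz constant [a]; with the vectors scaled by
    [lam j * a%:R], the linear process dominates the increments and one contraction suffices. *)
Lemma rad_norm_exp (a : nat) (lam : 'I_n -> R) z : (0 < a)%N ->
  (forall j, 0 <= lam j) -> (forall j, `|z j| <= 1) ->
  rad_norm D q (fun j f => lam j * (f (z j) : R) ^+ a) <=
  2 * (a%:R * (C * (\sum_j lam j `^ p) `^ p^-1)).
Proof.
move=> a0 lam0 z1.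
have bd j : bounded_on D (fun f => f (z j) : R) by exists `|z j| => f; exact.
apply: (@le_trans _ _ (2 * rad_norm D q (fun j f => f ((lam j * a%:R) *: z j) : R))).
  apply: (contraction D0) => //.
  - move=> j; exists (lam j) => f Hf; rewrite normrM (ger0_norm (lam0 j)).
    by rewrite ler_piMr// normrX exprn_ile1// Df.
  - by move=> j; exists `|(lam j * a%:R) *: z j| => f; exact.
  - by move=> j; rewrite /= expr0n eqn0Ngt a0 mulr0.
  - move=> j f g Hf Hg; rewrite !fZ -mulrBr -mulrBr.
    rewrite !normrM (ger0_norm (lam0 j)) -mulrA ler_wpM2l//.
    by rewrite normr_nat; apply: lip_exp_unit; exact: Df.
rewrite ler_wpM2l//; apply: (le_trans (rad_norm_linear _)).
rewrite mulrCA ler_wpM2l//.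
have a0' : (0 : R) <= a%:R by [].
have S0 : 0 <= \sum_j lam j `^ p by apply: sumr_ge0 => j _; exact: powR_ge0.
rewrite -[X in X * _](@powRK _ p) ?gt_eqF// -powRM ?powR_ge0//.
apply: ler_powR2; first by rewrite invr_ge0 ltW.
  by apply: sumr_ge0 => j _; exact: powR_ge0.
rewrite mulr_sumr; apply: ler_sum => j _; rewrite -powRM//.
apply: ler_powR2 => //; first exact: ltW.
rewrite normrZ ger0_norm ?mulr_ge0// mulrC -[leRHS]mul1r [a%:R * _]mulrC.
by apply: ler_wpM2r => //; rewrite mulr_ge0.
Qed.

(* Polarisation [s^a t^b = ((s^a + t^b)^2 - (s^a - t^b)^2) / 4] makes the mixed
   power accessible to the scalar contraction principle: on [-2, 2] the map
   [x^2 / 4] is a contraction. *)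
Lemma rad_norm_mixed (a b : nat) d y : (0 < a)%N ->
  rad_norm D q (fun j f => (f (d j) : R) ^+ a * (f (y j) : R) ^+ b) <=
  8 * (a + b)%:R *
  (C * (\sum_j (`|d j| ^+ a * `|y j| ^+ b) `^ p) `^ p^-1).
Proof.
move=> a0.
(* Normalised vectors keep the values of functionals in [[-1, 1]], where powers are Lipschitz; the
   sizes go into the weights [lam]. The zero vector is normalised to zero. *)
pose nz (u : E) := `|u|^-1 *: u.
have nzE u : u = `|u| *: nz u.
  rewrite /nz scalerA; have [->|u0] := eqVneq u 0; first by rewrite scaler0.
  by rewrite divff ?scale1r// normr_eq0.
have fnz f u : (f u : R) = `|u| * (f (nz u) : R) by rewrite {1}(nzE u) fZ.
have nz1 u : `|nz u| <= 1.
  rewrite /nz normrZ; have [->|u0] := eqVneq u 0; first by rewrite normr0 mulr0.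
  by rewrite ger0_norm ?invr_ge0// mulVf// normr_eq0.
pose lam j := `|d j| ^+ a * `|y j| ^+ b.
have lam0 j : 0 <= lam j by rewrite mulr_ge0// exprn_ge0.
set S := C * _; have S0 : 0 <= S by rewrite mulr_ge0// powR_ge0.
pose s j f : R := (f (nz (d j)) : R) ^+ a.
pose t j f : R := (f (nz (y j)) : R) ^+ b.
have s1 j f : D f -> `|s j f| <= 1 by move=> Hf; rewrite normrX exprn_ile1// Df.
have t1 j f : D f -> `|t j f| <= 1 by move=> Hf; rewrite normrX exprn_ile1// Df.
have s0 j : s j f0 = 0 by rewrite /s /= expr0n eqn0Ngt a0.
have dyE : (fun j f => (f (d j) : R) ^+ a * (f (y j) : R) ^+ b) =
    (fun j f => lam j * (s j f * t j f)).
  apply/funext => j; apply/funext => f; rewrite (fnz f (d j)) (fnz f (y j)).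
  by rewrite !exprMn /lam /s /t; ring.
have bs j : bounded_on D (fun f => lam j * s j f).
  by apply: bounded_onZ; exists 1 => f; exact: s1.
have bt j : bounded_on D (fun f => lam j * t j f).
  by apply: bounded_onZ; exists 1 => f; exact: t1.
have Hs : rad_norm D q (fun j f => lam j * s j f) <= 2 * (a%:R * S).
  exact: rad_norm_exp.
(* For [b = 0] the second power is constantly 1 and does not vanish at the zero functional, as the
   contraction principle requires. *)
have [b0|b0] := posnP b.
  rewrite dyE.
  have -> : (fun j f => lam j * (s j f * t j f)) = (fun j f => lam j * s j f).
    by apply/funext => j; apply/funext => f; rewrite /t b0 expr0 mulr1.
  apply: (le_trans Hs); rewrite b0 addn0 mulrA ler_wpM2r// ler_wpM2r// ler_nat; exact: (@leq_trans 2).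
have t0 j : t j f0 = 0 by rewrite /t /= expr0n eqn0Ngt b0.
have Ht : rad_norm D q (fun j f => lam j * t j f) <= 2 * (b%:R * S).
  exact: rad_norm_exp.
clearbody S.
(* The sign [c] selects the sum or the difference in the polarisation. The outer factor 2 comes from
   contracting the square, the inner ones from [rad_norm_exp]; the two choices of [c] together give
   [8 * (a + b)]. *)
have sq (c : R) : `|c| = 1 ->
    rad_norm D q (fun j f => c * (lam j * (4^-1 * (s j f + c * t j f) ^+ 2))) <=
    2 * (2 * (a%:R * S) + 2 * (b%:R * S)).
  move=> c1.
  have st2 j f : D f -> `|s j f + c * t j f| <= 2.
    move=> Hf; apply: (le_trans (ler_normD _ _)); rewrite normrM c1 mul1r.
    exact: (le_trans (lerD (s1 j f Hf) (t1 j f Hf))).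
  apply: (@le_trans _ _ (2 * rad_norm D q
      (fun j f => lam j * s j f + c * (lam j * t j f)))).
    apply: (contraction D0) => //.
    - move=> j; do 3 apply: bounded_onZ; exists 4 => f Hf.
      by rewrite normrX (le_trans (lerXn2r 2 _ _ (st2 j f Hf))) ?nnegrE// -natrX.
    - by move=> j; apply: bounded_onD => //; exact: bounded_onZ.
    - by move=> j; rewrite s0 t0 mulr0 addr0 expr0n/= !mulr0.
    - by move=> j; rewrite s0 t0 !mulr0 addr0.
    - move=> j f g Hf Hg.
      have -> : lam j * s j f + c * (lam j * t j f) - (lam j * s j g + c * (lam j * t j g))
        = lam j * ((s j f + c * t j f) - (s j g + c * t j g)) by ring.
      rewrite -mulrBr normrM c1 mul1r -mulrBr !normrM ger0_norm// ler_wpM2l//.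
      by apply: lip_sqr4; exact: st2.
  rewrite ler_wpM2l//; apply: (le_trans (rad_normD D0 q1 _ _)) => //.
    by move=> j; exact: bounded_onZ.
  apply: (lerD Hs); apply: le_trans Ht.
  rewrite -[leRHS]mul1r -c1 -(wnormZ q1 (@cube_weight_ge0 R n)).
  apply: (le_wnorm q1 (@cube_weight_ge0 R n)) => e.
  rewrite normrM c1 mul1r le_eqVlt; apply/orP; left; apply/eqP.
  congr (`|supon _ _|); apply/funext => f.
  rewrite -[RHS]mul1r -[X in X * _]c1 -normrM; congr (`|_|).
  by rewrite /rproc mulr_sumr; apply: eq_bigr => j _; ring.
rewrite dyE.
have -> : (fun j f => lam j * (s j f * t j f)) = (fun j f =>
    1 * (lam j * (4^-1 * (s j f + 1 * t j f) ^+ 2)) +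
    (-1) * (lam j * (4^-1 * (s j f + (-1) * t j f) ^+ 2))).
  by apply/funext => j; apply/funext => f; field.
have bst (c : R) j : bounded_on D (fun f => c * (lam j * (4^-1 * (s j f + c * t j f) ^+ 2))).
  do 3 apply: bounded_onZ; exists ((1 + `|c|) ^+ 2) => f Hf.
  rewrite normrX ler_pXn2r// ?nnegrE// ?addr_ge0//.
  apply: (le_trans (ler_normD _ _)); rewrite normrM lerD ?s1//.
  by rewrite ler_piMr// t1.
apply: (le_trans (rad_normD D0 q1 _ _)); [exact: bst|exact: bst|].
have h1 := sq 1 (normr1 _).
have h2 := sq (-1) (normrN1 _).
apply: (le_trans (lerD h1 h2)).
by rewrite le_eqVlt; apply/orP; left; apply/eqP; rewrite natrD; ring.
Qed.

End MixedPowers.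

(** * Symmetric tensors *)

Section SymmetricTensors.
Context {R : realType} {E : completeNormedModType R} {k : nat}.
Local Notation preT := (prealg_tensor E k).

Lemma sym_tensor_lin (a : R) (u v : preT) :
  sym_tensor E k u -> sym_tensor E k v -> sym_tensor E k (a *: u + v).
Proof.
move=> [n [b [x ->]]] [m [c [y ->]]]; exists (n + m)%N.
exists (fun i => match fintype.split i with inl j => a * b j | inr j => c j end).
exists (fun i => match fintype.split i with inl j => x j | inr j => y j end).
rewrite big_split_ord/= scaler_sumr; congr (_ + _); apply: eq_bigr => i _.
  by rewrite (unsplitK (inl i)) scalerA.
by rewrite (unsplitK (inr i)).
Qed.

Lemma sym_tensor0 : sym_tensor E k 0.
Proof. by exists 0, (fun=> 0), (fun=> 0); rewrite big_ord0. Qed.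

Lemma sym_tpow x : sym_tensor E k (tpow k x).
Proof.
by exists 1, (fun=> 1), (fun=> x); rewrite big_ord1 scale1r.
Qed.

Lemma sym_tensor_diff x y : sym_tensor E k (tpow k x - tpow k y).
Proof.
rewrite addrC -scaleN1r; exact: sym_tensor_lin (sym_tpow y) (sym_tpow x).
Qed.

Section Completion.
Variables (N : preT -> R) (S : set preT) (W : completion S N).
Hypotheses (S0 : S 0) (Slin : forall (a : R) u v, S u -> S v -> S (a *: u + v)).

Lemma compl_emb0 : compl_emb W 0 = 0.
Proof.
have := compl_emb_linear W 1 S0 S0; rewrite !scale1r addr0 => /eqP.
by rewrite -subr_eq0 opprD addNKr oppr_eq0 => /eqP.
Qed.

Lemma compl_emb_sum (I : Type) (r : seq I) (a : I -> R) (u : I -> preT) :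
  (forall i, S (u i)) ->
  S (\sum_(i <- r) a i *: u i) /\
  compl_emb W (\sum_(i <- r) a i *: u i) = \sum_(i <- r) a i *: compl_emb W (u i).
Proof.
move=> Su; elim: r => [|i r [Sr Er]]; first by rewrite !big_nil compl_emb0.
by rewrite !big_cons; split; [exact: Slin|rewrite compl_emb_linear ?Er].
Qed.

End Completion.

Variable Ts : sym_inj_tensor E k.
Let D : set {linear E -> R^o} := @dual_ball R E.

Definition Tpow (x : E) : Ts := compl_emb Ts (tpow k x).

Lemma Tpow_diff x y : Tpow x - Tpow y = compl_emb Ts (tpow k x - tpow k y).
Proof.
rewrite [in RHS]addrC -[- tpow k y]scaleN1r compl_emb_linear; last 2 first.
- exact: sym_tpow.
- exact: sym_tpow.
by rewrite scaleN1r addrC.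
Qed.

Lemma Tpow0 : (0 < k)%N -> Tpow 0 = 0.
Proof.
move=> k0; rewrite /Tpow -[RHS](compl_emb0 Ts sym_tensor0); congr compl_emb.
apply/funext => B; rewrite /tpow /elem_tensor.
have := mform_linear B (fun=> 0) (Ordinal k0) 1 0 0.
rewrite mul1r scale1r addr0.
have -> : update (fun _ : 'I_k => (0 : E)) (Ordinal k0) 0 = (fun=> 0).
  by apply/funext => i; rewrite /update; case: ifP.
move/eqP; rewrite -subr_eq0 opprD addNKr oppr_eq0 => /eqP ->.
by [].
Qed.

Lemma eps_s_norm_le (u : preT) (B : R) : 0 <= B ->
  (forall f, D f -> `|u (prod_form (fun=> f))| <= B) -> eps_s_norm u <= B.
Proof.
move=> B0 H; rewrite /eps_s_norm; apply: ge_sup; last by move=> _ [f Hf <-]; exact: H.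
exists `|u (prod_form (fun=> (\0%R : {linear E -> R^o})))|.
by exists (\0%R : {linear E -> R^o}) => // x; rewrite normr0.
Qed.

Lemma tpow_prod_form x (f : {linear E -> R^o}) :
  (tpow k x : preT) (prod_form (fun=> f)) = (f x : R) ^+ k.
Proof. by rewrite /tpow /elem_tensor /= prodr_const card_ord. Qed.

(** The norm of a symmetric tensor is a supremum of scalar sums over functionals, so a scalar
    estimate uniform in [f] passes to the completion. *)
Lemma norm_Tpow_sum_le n (c : 'I_n -> R) (x y : 'I_n -> E) (B : R) : 0 <= B ->
  (forall f, D f ->
    `|\sum_j c j * ((f (x j) : R) ^+ k - (f (y j) : R) ^+ k)| <= B) ->
  `|\sum_j c j *: (Tpow (x j) - Tpow (y j))| <= B.
Proof.
move=> B0 H; have [Su Eu] := compl_emb_sum Ts sym_tensor0 sym_tensor_lin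
  (index_enum 'I_n) c (fun j => sym_tensor_diff (x j) (y j)).
under eq_bigr do rewrite Tpow_diff.
rewrite -Eu compl_emb_norm//; apply: eps_s_norm_le => // f Hf.
rewrite sum_tensorE; apply: le_trans (H f Hf); rewrite le_eqVlt; apply/orP; left.
apply/eqP; congr (`|_|); apply: eq_bigr => j _.
by rewrite -!tpow_prod_form.
Qed.

Lemma norm_Tpow_diff_le x y :
  `|Tpow x - Tpow y| <=
  \sum_(i < k) 'C(k, i.+1)%:R * (`|x - y| ^+ i.+1 * `|y| ^+ (k - i - 1)).
Proof.
have := @norm_Tpow_sum_le 1 (fun=> 1) (fun=> x) (fun=> y)
  (\sum_(i < k) 'C(k, i.+1)%:R * (`|x - y| ^+ i.+1 * `|y| ^+ (k - i - 1))).
rewrite big_ord1 scale1r; apply.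
  by apply: sumr_ge0 => i _; rewrite !mulr_ge0// exprn_ge0.
move=> f Hf; rewrite big_ord1 mul1r expr_diff_expand.
apply: (le_trans (ler_norm_sum _ _ _)); apply: ler_sum => i _.
rewrite normrM normr_nat ler_wpM2l// normrM !normrX -linearB.
by apply: ler_pM; rewrite ?exprn_ge0// lerXn2r ?nnegrE//; exact: Hf.
Qed.

(** After the binomial expansion the [i]-th term is a mixed power with exponents [i.+1] and
    [k - i - 1]. Their sum is always [k], hence the common factor [8 * k]. *)
Lemma wnorm_sign_Tpow_le n (p q C : R) (x y : 'I_n -> E) :
  1 <= p -> 1 <= q -> 0 <= C -> sign_type_bound E n p q C ->
  wnorm (@cube_weight R n) q
    (fun e => `|\sum_j sg e j *: (Tpow (x j) - Tpow (y j))|) <=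
  \sum_(i < k) 'C(k, i.+1)%:R * (8 * k%:R *
    (C * (\sum_j (`|x j - y j| ^+ i.+1 * `|y j| ^+ (k - i - 1)) `^ p) `^ p^-1)).
Proof.
move=> p1 q1 C0 HC.
pose h (i : 'I_k) (j : 'I_n) (f : {linear E -> R^o}) : R :=
  (f (x j - y j) : R) ^+ i.+1 * (f (y j) : R) ^+ (k - i - 1).
have D0 : D (\0%R : {linear E -> R^o}) by move=> u; rewrite normr0.
have bh i j : bounded_on D (h i j).
  exists (`|x j - y j| ^+ i.+1 * `|y j| ^+ (k - i - 1)) => f Hf.
  rewrite normrM !normrX.
  by apply: ler_pM; rewrite ?exprn_ge0// lerXn2r ?nnegrE//; exact: Hf.
have bs i e : bounded_on D (fun f => `|rproc (h i) e f|).
  by apply: bounded_on_norm; exact: bounded_rproc.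
have s0 i e : 0 <= supon D (fun f => `|rproc (h i) e f|).
  by apply: le_trans (supon_ge (bs i e) D0).
have w0 := @cube_weight_ge0 R n.
apply: (@le_trans _ _ (\sum_(i < k) 'C(k, i.+1)%:R * rad_norm D q (h i))).
  apply: (@le_trans _ _ (wnorm (@cube_weight R n) q (fun e =>
      \sum_(i < k) 'C(k, i.+1)%:R * supon D (fun f => `|rproc (h i) e f|)))).
    apply: (le_wnorm q1 w0) => e.
    have B0 : 0 <= \sum_(i < k) 'C(k, i.+1)%:R * supon D (fun f => `|rproc (h i) e f|).
      by apply: sumr_ge0 => i _; rewrite mulr_ge0.
    rewrite normr_id (ger0_norm B0); apply: norm_Tpow_sum_le => // f Hf.
    have -> : \sum_j sg e j * ((f (x j) : R) ^+ k - (f (y j) : R) ^+ k) =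
        \sum_(i < k) 'C(k, i.+1)%:R * rproc (h i) e f.
      under eq_bigr do rewrite expr_diff_expand mulr_sumr.
      rewrite exchange_big; apply: eq_bigr => i _; rewrite /rproc mulr_sumr.
      by apply: eq_bigr => j _; rewrite mulrCA /h linearB.
    apply: (le_trans (ler_norm_sum _ _ _)); apply: ler_sum => i _.
    by rewrite normrM normr_nat ler_wpM2l//; exact: (supon_ge (bs i e) Hf).
  apply: (le_trans (wnorm_sum q1 w0 _ _)); apply: ler_sum => i _.
  by rewrite wnormZ// normr_nat.
apply: ler_sum => i _; rewrite ler_wpM2l//.
have ik : (i.+1 + (k - i - 1) = k)%N by rewrite -subnDA addn1 subnKC.
have := @rad_norm_mixed R E n p q C p1 q1 C0 HC i.+1 (k - i - 1) (fun j => x j - y j) y (ltn0Sn i).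
by rewrite ik.
Qed.

Lemma eps_s_norm_le_eps n (a : 'I_n -> R) (x : 'I_n -> E) :
  eps_s_norm (\sum_j a j *: tpow k (x j)) <= eps_norm (\sum_j a j *: tpow k (x j)).
Proof.
set u := \sum_j _.
have ub (f : 'I_k -> {linear E -> R^o}) : (forall i, D (f i)) ->
    `|u (prod_form f)| <= \sum_j `|a j| * `|x j| ^+ k.
  move=> Hf; rewrite /u sum_tensorE; apply: (le_trans (ler_norm_sum _ _ _)).
  apply: ler_sum => j _.
  rewrite [(_ *: _) _](_ : _ = a j * \prod_i (f i (x j) : R))//.
  rewrite normrM ler_wpM2l// normr_prod.
  apply: (@le_trans _ _ (\prod_(i < k) `|x j|)).
    by apply: ler_prod => i _; rewrite normr_ge0 /=; exact: Hf.
  by rewrite prodr_const card_ord.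
have e0 : 0 <= eps_norm u.
  rewrite /eps_norm; apply: le_trans (normr_ge0 (u (prod_form (fun=> (\0%R : {linear E -> R^o}))))) _.
  apply: ub_le_sup; first by exists (\sum_j `|a j| * `|x j| ^+ k) => _ [f Hf <-]; exact: ub.
  by exists (fun=> (\0%R : {linear E -> R^o})) => // i z; rewrite normr0.
apply: eps_s_norm_le => // f Hf; apply: ub_le_sup.
  by exists (\sum_j `|a j| * `|x j| ^+ k) => _ [g Hg <-]; exact: ub.
by exists (fun=> f).
Qed.

(** The scalar coefficient is absorbed into the first slot of the elementary tensor, which exists
    because [0 < k]. *)
Lemma sym_alg_tensor u : (0 < k)%N -> sym_tensor E k u -> alg_tensor E k u.
Proof.
move=> k0 [n [a [x ->]]]; exists n.
exists (fun j => update (fun=> x j) (Ordinal k0) (a j *: x j)).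
apply: eq_bigr => j _; apply/funext => B; rewrite /elem_tensor.
have M := mform_linear B (fun=> x j) (Ordinal k0).
have B0 : B (update (fun=> x j) (Ordinal k0) 0) = 0.
  have := M 1 0 0; rewrite mul1r scale1r addr0 => /eqP.
  by rewrite -subr_eq0 opprD addNKr oppr_eq0 => /eqP.
have := M (a j) (x j) 0; rewrite addr0 B0 addr0 => ->.
rewrite [LHS](_ : _ = a j * B (fun=> x j))//; congr (_ * B _).
by apply/funext => i; rewrite /update; case: ifP.
Qed.

(** The symmetric norm tests on fewer functionals than the full one, and the inequality is a closed
    condition, so it extends from the dense set of symmetric tensors. It makes [J] injective: a
    moment given in the full tensor product has at most one preimage. *)
Lemma canonical_inclusion_ge (Tf : inj_tensor E k) (J : {linear Ts -> Tf}) v :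
  (0 < k)%N -> canonical_inclusion J -> `|v| <= `|J v|.
Proof.
move=> k0 [Jc JE].
pose A := [set v : Ts | 0 <= `|J v| - `|v| ].
suff: A v by rewrite /A /= subr_ge0.
have Acl : closed A.
  apply: (@closed_comp _ _ (fun v : Ts => `|J v| - `|v|) [set x | 0 <= x]).
    move=> w _; apply: cvgB; last exact: norm_continuous.
    by apply: (@continuous_comp _ _ _ J (fun x => `|x|)); [exact: Jc|exact: norm_continuous].
  exact: closed_ge.
have : closure (compl_emb Ts @` sym_tensor E k) v by rewrite compl_emb_dense.
rewrite (closure_id A).1//; apply: closure_subset => _ [u Su <-].
rewrite /A /= subr_ge0 JE// !compl_emb_norm//; last exact: sym_alg_tensor.
by case: Su => [n [a [x ->]]]; exact: eps_s_norm_le_eps.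
Qed.

End SymmetricTensors.

(** * Symmetrization *)

Section ProductWeights.
Context {R : realType} {A : finType} (n : nat) (w : A -> R).
Hypotheses (w0 : forall x, 0 <= w x) (w1 : \sum_x w x = 1).
Implicit Types a : {ffun 'I_n -> A}.

Definition prodw a : R := \prod_j w (a j).

Lemma prodw_ge0 a : 0 <= prodw a.
Proof. by apply: prodr_ge0. Qed.

Lemma prodw1 : \sum_a prodw a = 1.
Proof. by rewrite -(bigA_distr_bigA (fun _ x => w x)) big1. Qed.

Lemma prodw_marginal j0 x : \sum_(a : {ffun 'I_n -> A} | a j0 == x) prodw a = w x.
Proof.
pose F (j : 'I_n) y := if j == j0 then (y == x)%:R * w y else w y.
rewrite big_mkcond/=.
transitivity (\sum_(a : {ffun 'I_n -> A}) \prod_j F j (a j)).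
  apply: eq_bigr => a _; rewrite /prodw (bigD1 j0)//= [RHS](bigD1 j0)//=.
  rewrite {1}/F eqxx; have -> : \prod_(i | i != j0) F i (a i) =
      \prod_(i | i != j0) w (a i).
    by apply: eq_bigr => i /negbTE; rewrite /F => ->.
  by case: eqP => _; rewrite ?mul1r ?mul0r.
rewrite -bigA_distr_bigA (bigD1 j0)//= [X in _ * X]big1 ?mulr1; last first.
  by move=> j /negbTE jj; rewrite /F jj.
rewrite /F eqxx (bigD1 x)//= eqxx mul1r big1 ?addr0// => y /negbTE ->.
by rewrite mul0r.
Qed.

Lemma prodw_expect (V : lmodType R) (g : A -> V) j0 :
  \sum_(a : {ffun 'I_n -> A}) prodw a *: g (a j0) = \sum_x w x *: g x.
Proof.
rewrite (partition_big (fun a : {ffun 'I_n -> A} => a j0) xpredT)//=.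
apply: eq_bigr => x _; rewrite -(prodw_marginal j0) scaler_suml.
by apply: eq_bigr => a /eqP ->.
Qed.

Lemma prodw_expectR (g : A -> R) j0 :
  \sum_(a : {ffun 'I_n -> A}) prodw a * g (a j0) = \sum_x w x * g x.
Proof. exact: (@prodw_expect R^o). Qed.

Lemma wnorm_prodw q (g : A -> R) j0 :
  wnorm prodw q (fun a => g (a j0)) = wnorm w q g.
Proof. by rewrite /wnorm (prodw_expectR (fun x => `|g x| `^ q)). Qed.

(** Jensen's inequality with exponent [q / p] for the uniform average over [j], then the marginals
    of [prodw]. The power [1/p] of [n] becomes the Monte Carlo rate after division by [n]. *)
Lemma wnorm_lp_sum_le (p q : R) (lam : A -> R) : 1 <= p -> p <= q -> (0 < n)%N ->
  (forall x, 0 <= lam x) ->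
  wnorm prodw q (fun a => (\sum_j lam (a j) `^ p) `^ p^-1) <=
  n%:R `^ p^-1 * wnorm w q lam.
Proof.
move=> p1 pq n0 lam0.
have p0 : 0 < p by lra.
have q0 : 0 < q by lra.
have n0' : (0 : R) < n%:R by rewrite ltr0n.
pose r := q / p.
have r1 : 1 <= r by rewrite /r ler_pdivlMr// mul1r.
have key a : (\sum_j lam (a j) `^ p) `^ r <=
    n%:R `^ r * (\sum_j n%:R^-1 * lam (a j) `^ q).
  have H : (\sum_(j < n) n%:R^-1 * lam (a j) `^ p) `^ r <=
      \sum_(j < n) n%:R^-1 * (lam (a j) `^ p) `^ r.
    apply: (@jensen_powR R 'I_n (fun=> n%:R^-1)) => //.
    - by move=> j; exact: powR_ge0.
    - by rewrite sumr_const card_ord -[LHS]mulr_natr mulVf ?gt_eqF.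
  have -> : \sum_j lam (a j) `^ p = n%:R * \sum_(j < n) n%:R^-1 * lam (a j) `^ p.
    by rewrite -mulr_sumr mulrA divff ?mul1r// gt_eqF.
  rewrite powRM ?(ltW n0')//; last first.
    by apply: sumr_ge0 => j _; rewrite mulr_ge0 ?powR_ge0// invr_ge0 ltW.
  apply: ler_wpM2l; first exact: powR_ge0.
  apply: (le_trans H); apply: ler_sum => j _.
  by rewrite -powRrM /r mulrCA divff ?gt_eqF// mulr1.
have e1 : n%:R `^ p^-1 = (n%:R `^ r) `^ q^-1 :> R.
  by rewrite -powRrM /r mulrAC divff ?mul1r// gt_eqF.
rewrite e1 /wnorm -powRM ?powR_ge0//; last exact: wsum_ge0.
apply: ler_powR2; first by rewrite invr_ge0 ltW.
  by apply: wsum_ge0; exact: prodw_ge0.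
apply: (@le_trans _ _ (\sum_(a : {ffun 'I_n -> A}) prodw a * (n%:R `^ r * (\sum_j n%:R^-1 * lam (a j) `^ q)))).
  apply: ler_sum => a _; apply: ler_wpM2l; first exact: prodw_ge0.
  rewrite ger0_norm ?powR_ge0// -powRrM mulrC; exact: key.
under eq_bigr do rewrite mulrCA mulr_sumr.
rewrite -mulr_sumr ler_wpM2l ?powR_ge0// exchange_big/=.
have eqj (j : 'I_n) : \sum_a prodw a * (n%:R^-1 * lam (a j) `^ q) =
    n%:R^-1 * \sum_x w x * `|lam x| `^ q.
  rewrite -(prodw_expectR _ j) mulr_sumr; apply: eq_bigr => a _.
  by rewrite mulrCA ger0_norm.
under eq_bigr do rewrite eqj.
by rewrite sumr_const card_ord -[_ *+ n]mulr_natl mulrA divff ?mul1r// gt_eqF.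
Qed.

End ProductWeights.

Section Symmetrization.
Context {R : realType} {A : finType} (n : nat) (w : A -> R) (q : R).
Context {F : completeNormedModType R} (zeta : A -> F).
Hypotheses (w0 : forall x, 0 <= w x) (w1 : \sum_x w x = 1) (q1 : 1 <= q).
Local Notation ffA := {ffun 'I_n -> A}.
Local Notation signs := {ffun 'I_n -> bool}.
Local Notation W := (prodw (n := n) w).

Let q0 : 0 <= q. Proof. exact: le_trans ler01 q1. Qed.
Let W0 := prodw_ge0 (n := n) w0.
Let W1 := prodw1 n w1.

(** Exchanges the two samples exactly where the sign is -1. The product law of the pair is invariant
    under this, and each difference picks up its sign. *)
Definition swap_by (e : signs) (ab : ffA * ffA) : ffA * ffA :=
  ([ffun j => if e j then ab.2 j else ab.1 j],
   [ffun j => if e j then ab.1 j else ab.2 j]).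

Lemma swap_byK e : involutive (swap_by e).
Proof.
move=> [a b]; congr (_, _); apply/ffunP => j; rewrite !ffunE /=.
  by case: (e j).
by case: (e j).
Qed.

Lemma swap_by_sum e :
  \sum_(a : ffA) \sum_(b : ffA) W a * W b * `|\sum_j (zeta (a j) - zeta (b j))| `^ q =
  \sum_(a : ffA) \sum_(b : ffA) W a * W b * `|\sum_j sg e j *: (zeta (a j) - zeta (b j))| `^ q.
Proof.
rewrite !pair_big/= [RHS](reindex_inj (inv_inj (swap_byK e)))/=.
apply: eq_bigr => -[a b] _ /=; congr (_ * _ `^ q).
  rewrite /prodw -!big_split/=; apply: eq_bigr => j _; rewrite !ffunE.
  by case: (e j) => //; rewrite mulrC.
congr (`|_|); apply: eq_bigr => j _; rewrite !ffunE /sg.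
by case: (e j); rewrite ?expr0 ?expr1 ?scale1r// scaleN1r opprB.
Qed.

(** The mean is an average over a second sample [b]; Jensen's inequality pulls that average out, and
    the differences, being symmetric, may be multiplied by arbitrary signs. *)
Lemma symmetrization :
  wnorm W q (fun a => `|\sum_j (zeta (a j) - \sum_x w x *: zeta x)|) <=
  2 * wnorm W q (fun a => wnorm (@cube_weight R n) q
     (fun e => `|\sum_j sg e j *: zeta (a j)|)).
Proof.
set m := \sum_x w x *: zeta x.
pose G (a : ffA) := \sum_e cube_weight e * `|\sum_j sg e j *: zeta (a j)| `^ q :> R.
have cw0 := @cube_weight_ge0 R n.
have step1 a : `|\sum_j (zeta (a j) - m)| `^ q <=
    \sum_(b : ffA) W b * `|\sum_j (zeta (a j) - zeta (b j))| `^ q.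
  have -> : \sum_j (zeta (a j) - m) = \sum_(b : ffA) W b *: \sum_j (zeta (a j) - zeta (b j)).
    under [RHS]eq_bigr do rewrite scaler_sumr.
    rewrite exchange_big; apply: eq_bigr => j _ /=.
    under [RHS]eq_bigr do rewrite scalerBr.
    by rewrite sumrB -scaler_suml W1 scale1r prodw_expect.
  apply: le_trans (jensen_powR q1 W0 _ W1); last by move=> b; exact: normr_ge0.
  apply: ler_powR2 => //; apply: (le_trans (ler_norm_sum _ _ _)).
  by apply: ler_sum => b _; rewrite normrZ ger0_norm.
have step2 : \sum_(a : ffA) W a * `|\sum_j (zeta (a j) - m)| `^ q <=
    2 `^ q * \sum_(a : ffA) W a * G a.
  apply: (@le_trans _ _ (\sum_(a : ffA) \sum_(b : ffA) W a * W b *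
      `|\sum_j (zeta (a j) - zeta (b j))| `^ q)).
    apply: ler_sum => a _; under [leRHS]eq_bigr do rewrite -mulrA.
    by rewrite -mulr_sumr ler_wpM2l.
  rewrite -[leLHS]mul1r -[X in X * _ <= _](@cube_weight1 R n) mulr_suml.
  under eq_bigr => e _ do rewrite (swap_by_sum e).
  (* By convexity the two samples, which have the same law, each contribute half, so 2 to the power
     [q] is the whole loss. *)
  have half (u v : F) : `|u - v| `^ q <=
      2 `^ q * (2^-1 * `|u| `^ q + 2^-1 * `|v| `^ q).
    apply: (@le_trans _ _ (2 `^ q * (2^-1 * `|u| + (1 - 2^-1) * `|v|) `^ q)).
      rewrite -powRM//; last by rewrite addr_ge0// mulr_ge0//; lra.
      apply: ler_powR2 => //.
      have -> : 2 * (2^-1 * `|u| + (1 - 2^-1) * `|v|) = `|u| + `|v| by field.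
      exact: ler_normB.
    apply: ler_wpM2l; first exact: powR_ge0.
    have e2 : (2^-1 : R) = 1 - 2^-1 by field.
    rewrite [X in _ + X * _]e2; apply: convex_powR2 => //; lra.
  apply: (@le_trans _ _ (\sum_(e : signs) cube_weight e * \sum_(a : ffA) \sum_(b : ffA) W a * W b *
      (2 `^ q * (2^-1 * `|\sum_j sg e j *: zeta (a j)| `^ q +
                 2^-1 * `|\sum_j sg e j *: zeta (b j)| `^ q)))).
    apply: ler_sum => e _; apply: ler_wpM2l => //.
    apply: ler_sum => a _; apply: ler_sum => b _.
    apply: ler_wpM2l; first exact: mulr_ge0.
    under eq_bigr do rewrite scalerBr.
    by rewrite sumrB; exact: half.
  have one e : \sum_(a : ffA) \sum_(b : ffA) W a * W b *
      (2 `^ q * (2^-1 * `|\sum_j sg e j *: zeta (a j)| `^ q +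
                 2^-1 * `|\sum_j sg e j *: zeta (b j)| `^ q)) =
      2 `^ q * \sum_(a : ffA) W a * `|\sum_j sg e j *: zeta (a j)| `^ q.
    pose H (a : ffA) := `|\sum_j sg e j *: zeta (a j)| `^ q.
    transitivity (2 `^ q * (2^-1 * \sum_(a : ffA) \sum_(b : ffA) W b * (W a * H a) +
       2^-1 * \sum_(a : ffA) W a * \sum_(b : ffA) W b * H b)).
      rewrite mulrDr !mulr_sumr -big_split/=; apply: eq_bigr => a _.
      rewrite !mulr_sumr -big_split/=; apply: eq_bigr => b _.
      rewrite /H; ring.
    under eq_bigr do rewrite -mulr_suml W1 mul1r.
    by rewrite -[X in _ + _ * X]mulr_suml W1 mul1r -mulrDl; congr (_ * _);
      rewrite -[RHS]mul1r; congr (_ * _); field.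
  under eq_bigr => e _ do rewrite one.
  under eq_bigr => e _ do rewrite mulrCA.
  rewrite -[leLHS]mulr_sumr; apply: ler_wpM2l; first exact: powR_ge0.
  rewrite /G.
  under [leRHS]eq_bigr do rewrite mulr_sumr.
  rewrite [leRHS]exchange_big/=; apply: ler_sum => e _.
  rewrite mulr_sumr; apply: ler_sum => a _.
  by rewrite mulrCA.
have qn0 : q != 0 by rewrite gt_eqF// (lt_le_trans ltr01 q1).
rewrite -[X in X * _](@powRK _ q)// {1 2}/wnorm -powRM ?powR_ge0//; last exact: wsum_ge0.
apply: ler_powR2; first by rewrite invr_ge0.
  by apply: wsum_ge0.
under eq_bigr do rewrite normr_id.
apply: (le_trans step2); rewrite ler_wpM2l ?powR_ge0//.
apply: ler_sum => a _; apply: ler_wpM2l => //.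
rewrite (ger0_norm (wnorm_ge0 _ _ _)) wnorm_powR//.
by apply: ler_sum => e _; rewrite normr_id.
Qed.

End Symmetrization.

(** The 16 is the 2 of [symmetrization] times the 8 of [wnorm_sign_Tpow_le]. Since [A] and [w] are
    arbitrary, [w] may be a joint law that carries more data than [x] and [y]. *)
Lemma discrete_sampling_error {R : realType} (E : completeNormedModType R) (k n : nat)
    (Ts : sym_inj_tensor E k) (A : finType) (w : A -> R) (p q C : R) (x y : A -> E)
    (zeta : A -> Ts) : (forall a, zeta a = Tpow Ts (x a) - Tpow Ts (y a)) ->
  (forall a, 0 <= w a) -> \sum_a w a = 1 -> (0 < n)%N ->
  1 <= p -> p <= q -> 0 <= C -> sign_type_bound E n p q C ->
  wnorm (prodw (n := n) w) q
    (fun a => `|\sum_j (zeta (a j) - \sum_b w b *: zeta b)|) <=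
  16 * k%:R * C * n%:R `^ p^-1 * \sum_(i < k) 'C(k, i.+1)%:R *
    wnorm w q (fun a => `|x a - y a| ^+ i.+1 * `|y a| ^+ (k - i - 1)).
Proof.
move=> /funext -> w0 w1 n0 p1 pq C0 HC.
have q1 : 1 <= q by exact: le_trans pq.
have W0 := prodw_ge0 (n := n) w0.
apply: (le_trans (symmetrization n _ w0 w1 q1)).
pose lam (i : 'I_k) a : R := `|x a - y a| ^+ i.+1 * `|y a| ^+ (k - i - 1).
have lam0 i a : 0 <= lam i a by rewrite mulr_ge0// exprn_ge0.
apply: (@le_trans _ _ (2 * wnorm (prodw (n := n) w) q (fun a : {ffun 'I_n -> A} =>
    \sum_(i < k) ('C(k, i.+1)%:R * (8 * k%:R * C)) *
       (\sum_j lam i (a j) `^ p) `^ p^-1))).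
  rewrite ler_wpM2l//; apply: le_wnorm => // a.
  rewrite !ger0_norm ?wnorm_ge0//; last first.
    by apply: sumr_ge0 => i _; rewrite !mulr_ge0// powR_ge0.
  apply: (le_trans (wnorm_sign_Tpow_le Ts (fun j => x (a j)) (fun j => y (a j)) p1 q1 C0 HC)).
  by apply: ler_sum => i _; rewrite !mulrA.
apply: (@le_trans _ _ (2 * \sum_(i < k) ('C(k, i.+1)%:R * (8 * k%:R * C)) *
   (n%:R `^ p^-1 * wnorm w q (lam i)))).
  rewrite ler_wpM2l//; apply: (le_trans (wnorm_sum q1 W0 _ _)).
  apply: ler_sum => i _; rewrite wnormZ//.
  have c0 : 0 <= 'C(k, i.+1)%:R * (8 * k%:R * C) by rewrite !mulr_ge0.
  by rewrite (ger0_norm c0) ler_wpM2l// wnorm_lp_sum_le.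
rewrite le_eqVlt; apply/orP; left; apply/eqP.
rewrite !mulr_sumr; apply: eq_bigr => i _; rewrite /lam; ring.
Qed.

(** * Finitely valued random variables *)

Section FiniteValued.
Context d (Om : measurableType d) (R : realType) (P : probability Om R).
Implicit Types A B : finType.

Definition fin_rv A (s : Om -> A) := forall a, measurable (s @^-1` [set a]).

Definition lawf A (s : Om -> A) (a : A) : R := fine (P (s @^-1` [set a])).

Lemma fin_rv_preimage A (s : Om -> A) (B : set A) : fin_rv s ->
  measurable (s @^-1` B).
Proof.
move=> ms; have -> : s @^-1` B = \bigcup_(a in B) s @^-1` [set a].
  by apply/seteqP; split=> [w Bw|w [a Ba /= sa]]; [exists (s w)|rewrite /preimage/= sa].
by apply: fin_bigcup_measurable => //; exact: finite_finset.
Qed.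

Lemma fin_rv_pair A B (s : Om -> A) (t : Om -> B) : fin_rv s -> fin_rv t ->
  fin_rv (fun w => (s w, t w)).
Proof.
move=> ms mt [a b].
have -> : (fun w => (s w, t w)) @^-1` [set (a, b)] =
    s @^-1` [set a] `&` t @^-1` [set b].
  by apply/seteqP; split=> w /= [sa tb]; [split|rewrite sa tb].
exact: measurableI.
Qed.

Lemma lawf_ge0 A (s : Om -> A) a : 0 <= lawf s a.
Proof. exact: fine_ge0. Qed.

Lemma lawfE A (s : Om -> A) a : fin_rv s -> P (s @^-1` [set a]) = (lawf s a)%:E.
Proof. by move=> ms; rewrite /lawf fineK// fin_num_measure. Qed.

Lemma integral_fin A (s : Om -> A) (g : A -> R) : fin_rv s -> (forall a, 0 <= g a) ->
  (\int[P]_w (g (s w))%:E = (\sum_a lawf s a * g a)%:E)%E.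
Proof.
move=> ms g0.
have gE w : g (s w) = \sum_a g a * \1_(s @^-1` [set a]) w.
  rewrite (bigD1 (s w))//= indicE mem_set// mulr1 big1 ?addr0// => a asw.
  rewrite indicE memNset ?mulr0//= => sa.
  by move: asw; rewrite -sa eqxx.
under eq_integral => w _ do rewrite gE -sumEFin.
rewrite ge0_integral_sum//; last 2 first.
- move=> a; apply/measurable_EFinP; apply: measurable_funM => //.
- by move=> a w _; rewrite lee_fin mulr_ge0.
rewrite -sumEFin; apply: eq_bigr => a _.
under eq_integral => w _ do rewrite EFinM.
rewrite ge0_integralZl_EFin//; last first.
  by apply/measurable_EFinP; apply: measurable_indic; exact: ms.
by rewrite integral_indic ?setIT; [rewrite EFinM muleC -lawfE| |exact: ms].
Qed.

Lemma lawf_sum1 A (s : Om -> A) : fin_rv s -> \sum_a lawf s a = 1.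
Proof.
move=> ms; have := integral_fin ms (fun=> ler01).
rewrite integral_cst// mul1e => H.
have [->] := etrans (esym (probability_setT P)) H.
by apply: eq_bigr => a _; rewrite mulr1.
Qed.

Lemma fin_rv_fiber A (B : eqType) (s : Om -> A) (h : A -> B) b : fin_rv s ->
  fine (P ((h \o s) @^-1` [set b])) = \sum_(a | h a == b) lawf s a.
Proof.
move=> ms; have mh : measurable ((h \o s) @^-1` [set b]).
  exact: (fin_rv_preimage (h @^-1` [set b]) ms).
apply: EFin_inj; rewrite fineK ?fin_num_measure//.
have H := @integral_fin _ s (fun a => (h a == b)%:R) ms (fun=> ler0n _ _).
have I := integral_indic P measurableT mh; rewrite setIT in I.
apply: (etrans (esym I)).
have E : (fun w => (\1_((h \o s) @^-1` [set b]) w)%:E) =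
    (fun w => ((h (s w) == b)%:R : R)%:E).
  apply/funext => w; rewrite indicE; congr ((nat_of_bool _)%:R%:E).
  by apply/idP/eqP => [/set_mem//|hb]; apply/mem_set.
rewrite E; apply: (etrans H); congr (_%:E); rewrite [RHS]big_mkcond/=.
by apply: eq_bigr => a _; case: ifP => _; rewrite ?mulr1 ?mulr0.
Qed.

Lemma lawf_comp A B (s : Om -> A) (h : A -> B) b : fin_rv s ->
  lawf (h \o s) b = \sum_(a | h a == b) lawf s a.
Proof. exact: fin_rv_fiber. Qed.

Variable F : completeNormedModType R.

Lemma normL_fin A (s : Om -> A) (g : A -> F) (q : R) : fin_rv s ->
  normL P q (g \o s) = (wnorm (lawf s) q (fun a => `|g a|))%:E.
Proof.
move=> ms; rewrite /normL unlock.
by rewrite /= (@integral_fin _ _ (fun a => `| `|g a| | `^ q)).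
Qed.

Lemma simple_rv_fin A (s : Om -> A) (g : A -> F) : fin_rv s -> simple_rv (g \o s).
Proof.
move=> ms; split; last by move=> y; exact: (fin_rv_preimage (g @^-1` [set y]) ms).
apply: (@sub_finite_set _ _ (g @` [set: A])).
  by move=> _ [w _ <-]; exists (s w).
by apply: finite_image; exact: finite_finset.
Qed.

Lemma simple_rv_preimage (f : Om -> F) (B : set F) : simple_rv f ->
  measurable (f @^-1` B).
Proof.
move=> [fin mf]; have -> : f @^-1` B = \bigcup_(y in range f `&` B) f @^-1` [set y].
  apply/seteqP; split=> [w Bw|w [y [_ By] /= fy]]; last by rewrite /preimage/= fy.
  by exists (f w) => //; split=> //; exists w.
apply: fin_bigcup_measurable => //; exact: finite_setIl.
Qed.

(** The values are listed and [s] is the index of the current one, so that sums over a finite type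
    replace sums over the range. The spare index makes that type nonempty, as [inord] requires. *)
Lemma simple_rvP (f : Om -> F) : simple_rv f ->
  exists N (s : Om -> 'I_N.+1) (v : 'I_N.+1 -> F), fin_rv s /\ f = v \o s.
Proof.
move=> sf; have /finite_seqP[r rE] := sf.1.
pose s w : 'I_(size r).+1 := inord (index (f w) r).
exists (size r), s, (fun i => nth 0 r i).
have fr w : f w \in r.
  have : range f (f w) by exists w.
  by rewrite rE.
split.
  move=> i; exact: (simple_rv_preimage [set y | inord (index y r) = i] sf).
apply/funext => w; rewrite /s /= inordK ?nth_index// ltnS.
exact: index_size.
Qed.

(** [g] need not be injective nor [s] surjective: indices with the same value are grouped, and
    values outside the range carry no mass. *)
Lemma simple_integralE A (s : Om -> A) (g : A -> F) : fin_rv s ->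
  simple_integral P (g \o s) = \sum_a lawf s a *: g a.
Proof.
move=> ms; have [fin _] := simple_rv_fin g ms.
rewrite /simple_integral fsbig_finite//.
set r := finmap.enum_fset _.
have rP y : (y \in r) = (y \in range (g \o s)) by rewrite in_fset_set.
transitivity (\sum_(y <- r) \sum_a (if g a == y then lawf s a *: g a else 0)).
  apply: eq_bigr => y _; rewrite fin_rv_fiber// scaler_suml big_mkcond/=.
  by apply: eq_bigr => a _; case: eqP => // ->.
rewrite exchange_big/=; apply: eq_bigr => a _.
have [gr|gr] := boolP (g a \in r).
  rewrite (bigD1_seq (g a))//= ?eqxx ?big1 ?addr0//; last exact: finmap.fset_uniq.
  by move=> y; rewrite eq_sym => /negbTE ->.
have -> : lawf s a = 0.
  rewrite /lawf; have -> : s @^-1` [set a] = set0; last by rewrite measure0.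
  apply/seteqP; split=> // w sw; move: gr; rewrite rP => /negP; apply.
  by apply/mem_set; exists w => //=; rewrite sw.
by rewrite scale0r big1// => y _; case: ifP.
Qed.

End FiniteValued.

(** * Bochner measurable functions and their L_q norms *)

Section BochnerMeasurable.
Context d (Om : measurableType d) (R : realType) (P : probability Om R).

Lemma simple_rv_comp (F F' : completeNormedModType R) (h : F -> F') (s : Om -> F) :
  simple_rv s -> simple_rv (h \o s).
Proof.
move=> /simple_rvP[N [t [v [mt ->]]]]; exact: (simple_rv_fin (h \o v) mt).
Qed.

Lemma simple_rv_comp2 (F F' F'' : completeNormedModType R) (h : F -> F' -> F'')
    (s : Om -> F) (t : Om -> F') :
  simple_rv s -> simple_rv t -> simple_rv (fun w => h (s w) (t w)).
Proof.
move=> /simple_rvP[N [s' [v [ms ->]]]] /simple_rvP[M [t' [u [mt ->]]]].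
exact: (simple_rv_fin (fun ij => h (v ij.1) (u ij.2)) (fin_rv_pair ms mt)).
Qed.

Lemma bochner_measurable_simple (F : completeNormedModType R) (s : Om -> F) :
  simple_rv s -> bochner_measurable P s.
Proof.
by move=> ss; exists (fun=> s); split=> //; apply/nearW => w; exact: cvg_cst.
Qed.

Lemma simple_rv_cst (F : completeNormedModType R) (c : F) : simple_rv (fun _ : Om => c).
Proof.
have m : fin_rv (fun _ : Om => tt) by move=> a; rewrite preimage_cst; case: ifP.
exact: (simple_rv_fin (fun=> c) m).
Qed.

Lemma bochner_measurable_cst (F : completeNormedModType R) (c : F) :
  bochner_measurable P (fun=> c).
Proof. by apply: bochner_measurable_simple; exact: simple_rv_cst. Qed.

Lemma bochner_measurable_comp (F F' : completeNormedModType R) (h : F -> F') f :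
  continuous h -> bochner_measurable P f -> bochner_measurable P (h \o f).
Proof.
move=> hc [s [ss sf]]; exists (fun n => h \o s n); split.
  by move=> n; exact: simple_rv_comp.
apply: filterS sf => w sw /=.
exact: (continuous_cvg _ (hc _)).
Qed.

Lemma bochner_measurableD (F : completeNormedModType R) (f g : Om -> F) :
  bochner_measurable P f -> bochner_measurable P g ->
  bochner_measurable P (f \+ g).
Proof.
move=> [s [ss sf]] [t [st tg]]; exists (fun n w => s n w + t n w); split.
  by move=> n; exact: simple_rv_comp2.
by apply: filterS2 sf tg => w sw tw; exact: cvgD.
Qed.

Lemma bochner_measurableN (F : completeNormedModType R) (f : Om -> F) :
  bochner_measurable P f -> bochner_measurable P (\- f).
Proof.
by apply: (@bochner_measurable_comp _ _ -%R) => x; exact: oppr_continuous.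
Qed.

Lemma bochner_measurableB (F : completeNormedModType R) (f g : Om -> F) :
  bochner_measurable P f -> bochner_measurable P g ->
  bochner_measurable P (f \- g).
Proof.
by move=> mf mg; apply: bochner_measurableD => //; exact: bochner_measurableN.
Qed.

Lemma bochner_measurableZ (F : completeNormedModType R) (c : R) (f : Om -> F) :
  bochner_measurable P f -> bochner_measurable P (fun w => c *: f w).
Proof.
by apply: (@bochner_measurable_comp _ _ ( *:%R c)); exact: scaler_continuous.
Qed.

Lemma bochner_measurable_sum (F : completeNormedModType R) (I : Type) (r : seq I)
    (f : I -> Om -> F) : (forall i, bochner_measurable P (f i)) ->
  bochner_measurable P (fun w => \sum_(i <- r) f i w).
Proof.
move=> mf; elim: r => [|i r IH].
  under eq_fun do rewrite big_nil; exact: bochner_measurable_cst.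
under eq_fun do rewrite big_cons; exact: bochner_measurableD.
Qed.

Hypothesis hP : measure_is_complete P.

(** Convergence almost everywhere suffices because [P] is complete: the convergence set [Q] is
    measurable, on it the norm is a limit of norms of simple functions, and its complement is a null
    set. *)
Lemma measurable_norm_bochner (F : completeNormedModType R) (f : Om -> F) :
  bochner_measurable P f -> measurable_fun setT (fun w => `|f w|).
Proof.
move=> [s [ss sf]].
pose Q : set Om := [set w | s n w @[n --> \oo] --> f w].
have mQ : measurable Q by rewrite -[Q]setCK; apply: measurableC; exact: hP.
pose h w := \1_Q w * `|f w| : R.
have mh : measurable_fun setT h.
  apply: (@measurable_fun_cvg _ _ _ _ (fun n w => \1_Q w * `|s n w|)).
  - move=> n; apply: measurable_funM; first exact: measurable_indic.
    move=> _ B mB; rewrite setTI.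
    exact: (simple_rv_preimage [set y | B `|y|] (ss n)).
  - move=> w _; rewrite /h indicE; case: (boolP (w \in Q)) => wQ.
      apply: cvgM; first exact: cvg_cst.
      by apply: cvg_norm; exact: set_mem wQ.
    under eq_fun do rewrite mul0r.
    by rewrite mul0r; exact: cvg_cst.
apply/measurable_EFinP.
apply: (ae_measurable_fun hP (f := EFin \o h)); last exact/measurable_EFinP.
apply: filterS sf => w sw _ /=; rewrite /h indicE mem_set ?mul1r//.
Qed.

End BochnerMeasurable.

(** * Inequalities between L_q norms *)

Section NormL.
Context d (Om : measurableType d) (R : realType) (P : probability Om R).
Hypothesis hP : measure_is_complete P.
Local Open Scope ereal_scope.

Lemma normL_ge0 (F : completeNormedModType R) (q : R) (f : Om -> F) :
  0 <= normL P q f.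
Proof. exact: Lnorm_ge0. Qed.

Lemma normLE (F : completeNormedModType R) (q : R) (f : Om -> F) :
  normL P q f = (\int[P]_w (`|f w| `^ q)%:E) `^ q^-1.
Proof.
rewrite /normL unlock /=; congr (_ `^ _); apply: eq_integral => w _ /=.
by rewrite normr_id.
Qed.

Lemma measurable_norm_powR (F : completeNormedModType R) (q : R) (f : Om -> F) :
  bochner_measurable P f -> measurable_fun setT (fun w => (`|f w| `^ q)%:E).
Proof.
move=> mf; apply/measurable_EFinP.
apply: (@measurableT_comp _ _ _ _ _ _ (@powR R ^~ q)).
  exact: measurable_powR.
exact: (measurable_norm_bochner hP mf).
Qed.

Lemma le_normL (F F' : completeNormedModType R) (q : R) (f : Om -> F) (g : Om -> F') :
  (0 <= q)%R -> bochner_measurable P f -> bochner_measurable P g ->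
  (forall w, (`|f w| <= `|g w|)%R) -> normL P q f <= normL P q g.
Proof.
move=> q0 mf mg fg; rewrite !normLE; apply: gt0_ler_poweR.
- by rewrite invr_ge0.
- by rewrite in_itv/= leey andbT; apply: integral_ge0 => w _; rewrite lee_fin powR_ge0.
- by rewrite in_itv/= leey andbT; apply: integral_ge0 => w _; rewrite lee_fin powR_ge0.
apply: ge0_le_integral => //.
- exact: measurable_norm_powR.
- exact: measurable_norm_powR.
- by move=> w _; rewrite lee_fin; apply: ler_powR2.
Qed.

(** Minkowski's inequality for the real functions [|g|] and [|h|]. Only norms are compared, so the
    three functions may live in different Banach spaces and real majorants are allowed. *)
Lemma normL_triangle (F F1 F2 : completeNormedModType R) (q : R)
   (f : Om -> F) (g : Om -> F1) (h : Om -> F2) :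
  (1 <= q)%R -> bochner_measurable P f -> bochner_measurable P g ->
  bochner_measurable P h ->
  (forall w, (`|f w| <= `|g w| + `|h w|)%R) ->
  normL P q f <= normL P q g + normL P q h.
Proof.
move=> q1 mf mg mh fgh.
have := @minkowski_EFin _ _ _ P (fun w => `|g w|%R) (fun w => `|h w|%R) q
  (measurable_norm_bochner hP mg) (measurable_norm_bochner hP mh) q1.
apply: le_trans.
have q0 : (0 <= q)%R by exact: le_trans q1.
rewrite normLE unlock; apply: gt0_ler_poweR.
- by rewrite invr_ge0.
- by rewrite in_itv/= leey andbT; apply: integral_ge0 => w _; rewrite lee_fin powR_ge0.
- by rewrite in_itv/= leey andbT; apply: integral_ge0 => w _; rewrite lee_fin powR_ge0.
apply: ge0_le_integral => //.
- exact: measurable_norm_powR.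
- apply/measurable_EFinP.
  apply: (@measurableT_comp _ _ _ _ _ _ (@powR R ^~ q)).
    exact: measurable_powR.
  under eq_fun do rewrite ger0_norm ?addr_ge0//.
  by apply: measurable_funD; [exact: (measurable_norm_bochner hP mg)|exact: (measurable_norm_bochner hP mh)].
- move=> w _ /=; rewrite lee_fin; apply: ler_powR2 => //.
  by rewrite (le_trans (fgh w))// ler_norm.
Qed.

Lemma normLD (F : completeNormedModType R) (q : R) (f g : Om -> F) :
  (1 <= q)%R -> bochner_measurable P f -> bochner_measurable P g ->
  normL P q (f \+ g)%R <= normL P q f + normL P q g.
Proof.
move=> q1 mf mg; apply: normL_triangle => // [|w].
  exact: bochner_measurableD.
exact: ler_normD.
Qed.

Lemma normLZ (F : completeNormedModType R) (q c : R) (f : Om -> F) :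
  (0 < q)%R -> bochner_measurable P f ->
  normL P q (fun w => c *: f w)%R = `|c|%:E * normL P q f.
Proof.
move=> q0 mf; rewrite !normLE.
under eq_integral => w _ do rewrite normrZ powRM// EFinM.
rewrite ge0_integralZl_EFin ?powR_ge0//; last exact: measurable_norm_powR.
rewrite poweRM ?lee_fin ?powR_ge0//; last first.
  by apply: integral_ge0 => w _; rewrite lee_fin powR_ge0.
by rewrite poweR_EFin powRK// gt_eqF.
Qed.

Lemma normL_cst (F : completeNormedModType R) (q : R) (c : F) : (0 < q)%R ->
  normL P q (fun=> c) = `|c|%:E.
Proof.
move=> q0; rewrite normLE integral_cst//.
rewrite [X in (_ * X) `^ _](_ : _ = 1); last exact: probability_setT.
by rewrite mule1 poweR_EFin powRK// gt_eqF.
Qed.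

Lemma normL_sum (F : completeNormedModType R) (q : R) (I : Type) (r : seq I)
    (f : I -> Om -> F) :
  (1 <= q)%R -> (forall i, bochner_measurable P (f i)) ->
  normL P q (fun w => \sum_(i <- r) f i w)%R <= \sum_(i <- r) normL P q (f i).
Proof.
move=> q1 mf; have q0 : (0 < q)%R by exact: lt_le_trans q1.
elim: r => [|i r IH].
  under eq_fun do rewrite big_nil.
  by rewrite big_nil normL_cst// normr0.
under eq_fun do rewrite big_cons.
rewrite big_cons; apply: (le_trans (normLD q1 (mf i) _)).
  exact: bochner_measurable_sum.
by rewrite leeD2l.
Qed.

Lemma normL1_le (F : completeNormedModType R) (q : R) (f : Om -> F) :
  (1 <= q)%R -> bochner_measurable P f ->
  \int[P]_w `|f w|%:E <= normL P q f.
Proof.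
move=> q1 mf; have q0 : (0 < q)%R by exact: lt_le_trans q1.
have [q1'|q1'] := eqVneq q 1%R.
  by rewrite q1' /normL Lnorm1; under [leRHS]eq_integral do rewrite /= normr_id.
have iq : (q^-1 < 1)%R by rewrite invf_lt1// lt_neqAle eq_sym q1'.
have := @hoelder _ _ _ P (fun w => `|f w|%R) (fun=> 1%R) q (1 - q^-1)^-1
  (measurable_norm_bochner hP mf) (measurable_cst _) q0.
rewrite invr_gt0 subr_gt0 iq invrK addrC subrK => /(_ isT erefl).
rewrite Lnorm1; under eq_integral do rewrite /= mulr1 normr_id.
move=> /le_trans; apply.
rewrite [X in _ * X](_ : _ = 1) ?mule1//.
have := @normL_cst R (1 - q^-1)^-1 (1%R : R^o); rewrite invr_gt0 subr_gt0 => /(_ iq).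
by rewrite /normL /= normr1.
Qed.

End NormL.

Section MixedHoelder.
Context d (Om : measurableType d) (R : realType) (P : probability Om R).
Hypothesis hP : measure_is_complete P.
Local Open Scope ereal_scope.

Lemma expe_poweR (x : \bar R) (n : nat) : 0 <= x -> x ^+ n = x `^ n%:R.
Proof.
move=> x0; elim: n => [|n IH]; first by rewrite expe0 poweRe0.
rewrite expeS IH -[X in X * _]poweRe1// -[(n.+1)%:R%R]natr1 addrC.
have [->|xn0] := eqVneq x 0.
  by rewrite poweRe1// mul0e poweR0r// natr1 pnatr_eq0.
by rewrite poweRD// nneg_neq0_poweRD_def// ler0n.
Qed.

Lemma normL_powR (F : completeNormedModType R) (r s : R) (f : Om -> F) : (r != 0)%R ->
  normL P r f `^ s = (\int[P]_w (`|f w| `^ r)%:E) `^ (s / r)%R.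
Proof. by move=> r0; rewrite normLE -poweRrM mulrC. Qed.

(** Hölder's inequality with exponents [k / a] and [k / b], conjugate because [a + b = k]. The case
    [b = 0] is separate since the second exponent would be infinite. *)
Lemma normL_mixed_le (F : completeNormedModType R) (q : R) (k a b : nat) (f g : Om -> F) :
  (0 < q)%R -> (0 < a)%N -> (a + b = k)%N ->
  bochner_measurable P f -> bochner_measurable P g ->
  normL P q (fun w => `|f w| ^+ a * `|g w| ^+ b : R^o)%R <=
  normL P (k%:R * q)%R f ^+ a * normL P (k%:R * q)%R g ^+ b.
Proof.
move=> q0 a0 abk mf mg.
have k0 : (0 < k%:R :> R)%R by rewrite ltr0n -abk ltn_addr.
have a0' : (0 < a%:R :> R)%R by rewrite ltr0n.
have kq0 : (k%:R * q != 0)%R by rewrite mulf_neq0// gt_eqF.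
rewrite !expe_poweR ?normL_ge0// !normL_powR// normLE.
have powX (x : R) n r : (0 <= x -> (x ^+ n) `^ r = x `^ (n%:R * r))%R.
  by move=> x0; rewrite -powR_mulrn// powRrM.
have intE : \int[P]_w (`| `|f w| ^+ a * `|g w| ^+ b| `^ q)%:E =
    \int[P]_w (`|f w| `^ (a%:R * q) * `|g w| `^ (b%:R * q))%:E.
  apply: eq_integral => w _; congr (_%:E).
  by rewrite ger0_norm ?mulr_ge0 ?exprn_ge0// powRM ?exprn_ge0// !powX.
rewrite intE {intE}.
have [b0|b0] := posnP b.
  move: abk; rewrite b0 addn0 => <-.
  under eq_integral do rewrite mul0r powRr0 mulr1.
  rewrite mul0r poweRe0 mule1.
  by rewrite invfM mulrA divff ?mul1r// gt_eqF.
have b0' : (0 < b%:R :> R)%R by rewrite ltr0n.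
have mp (h : Om -> F) r : bochner_measurable P h ->
    measurable_fun setT (fun w => `|h w| `^ r)%R.
  by move=> mh; apply/measurable_EFinP; exact: (measurable_norm_powR hP r mh).
have := @hoelder _ _ _ P (fun w => `|f w| `^ (a%:R * q))%R
  (fun w => `|g w| `^ (b%:R * q))%R (k%:R / a%:R)%R (k%:R / b%:R)%R
  (mp _ _ mf) (mp _ _ mg).
rewrite !divr_gt0// => /(_ isT isT).
rewrite !invf_div -mulrDl -natrD abk divff ?gt_eqF// => /(_ erefl).
rewrite Lnorm1 unlock /=.
under eq_integral do rewrite ger0_norm ?mulr_ge0 ?powR_ge0//.
have sub (h : Om -> F) (n : nat) : (0 < n)%N ->
    \int[P]_w (`| `|h w| `^ (n%:R * q)| `^ (k%:R / n%:R))%:E =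
    \int[P]_w (`|h w| `^ (k%:R * q))%:E.
  move=> n0; apply: eq_integral => w _; rewrite ger0_norm ?powR_ge0// -powRrM.
  by congr (_ `^ _)%:E; field; rewrite pnatr_eq0 -lt0n.
rewrite !sub// => H.
apply: le_trans (gt0_ler_poweR _ _ _ H) _.
- by rewrite invr_ge0 ltW.
- by rewrite in_itv/= leey andbT; apply: integral_ge0 => w _; rewrite lee_fin mulr_ge0 ?powR_ge0.
- by rewrite in_itv/= leey andbT mule_ge0// poweR_ge0.
rewrite poweRM ?poweR_ge0// -!poweRrM !invf_div le_eqVlt; apply/orP; left; apply/eqP.
by congr (_ `^ _ * _ `^ _); rewrite invfM; ring.
Qed.

End MixedHoelder.

Section SimpleApproximation.
Context d (Om : measurableType d) (R : realType) (P : probability Om R).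
Hypothesis hP : measure_is_complete P.
Variable F : completeNormedModType R.
Implicit Types f s : Om -> F.

Lemma fin_rv_set (A : set Om) : measurable A -> fin_rv (fun w => w \in A).
Proof.
move=> mA b; rewrite [X in measurable X](_ : _ = if b then A else ~` A).
  by case: b => //; exact: measurableC.
apply/seteqP; split=> w /=; case: b => /=.
- by move/set_mem.
- by move/negbT; rewrite notin_setE.
- by move/mem_set.
- by move=> nA; apply/negbTE; rewrite notin_setE.
Qed.

Lemma simple_rv_if (A : set Om) s : measurable A -> simple_rv s ->
  simple_rv (fun w => if w \in A then s w else 0).
Proof.
move=> mA /simple_rvP[N [t [v [mt ->]]]].
exact: (simple_rv_fin (fun ib => if ib.2 then v ib.1 else 0)
         (fin_rv_pair mt (fin_rv_set mA))).
Qed.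

Lemma normL_lty_int (r : R) f : 0 < r -> (normL P r f < +oo)%E ->
  (\int[P]_w (`|f w| `^ r)%:E < +oo)%E.
Proof.
by move=> r0; rewrite normLE => /lty_poweRy; apply; rewrite invr_eq0 gt_eqF.
Qed.

(** The given sequence need not be dominated. Replacing [s n] by 0 where its norm exceeds [2 * |f|]
    gives domination by [3 * |f|] and keeps convergence: where [f w] is nonzero, [s n w] is kept
    from some index on, and where [f w = 0] the truncated terms are zero. *)
Lemma simple_approx (r e : R) f : 0 < r -> inL P r f -> 0 < e ->
  exists2 s, simple_rv s & (normL P r (f \- s)%R <= e%:E)%E.
Proof.
move=> r0 [mf flt] e0; have [s [ss sf]] := mf.
pose A n := [set w | `|s n w| <= 2 * `|f w|].
have mA n : measurable (A n).
  have mh : measurable_fun setT (fun w => 2 * `|f w| - `|s n w|).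
    apply: measurable_funB; last first.
      exact: (measurable_norm_bochner hP (bochner_measurable_simple P (ss n))).
    apply: measurable_funM; first exact: measurable_cst.
    exact: (measurable_norm_bochner hP mf).
  have := mh measurableT [set` `[0, +oo[] (measurable_itv _); rewrite setTI.
  congr measurable; apply/seteqP; split=> w /=.
    by rewrite in_itv/= andbT subr_ge0.
  by rewrite in_itv/= andbT subr_ge0.
pose t n w := if w \in A n then s n w else 0.
have st n : simple_rv (t n) by exact: simple_rv_if.
have mt n : bochner_measurable P (t n) by exact: bochner_measurable_simple.
have mft n : bochner_measurable P (f \- t n) by exact: bochner_measurableB.
have tf w : s n w @[n --> \oo] --> f w -> t n w @[n --> \oo] --> f w.
  move=> sw; have [f0|fn0] := eqVneq (f w) 0.
    have -> : (fun n => t n w) = (fun=> f w); last exact: cvg_cst.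
    apply/funext => n; rewrite /t f0; case: ifP => // /set_mem; rewrite /A /=.
    by rewrite f0 normr0 mulr0 normr_le0 => /eqP.
  have H : \forall n \near \oo, s n w = t n w.
    have nw : `|s n w| @[n --> \oo] --> `|f w| by exact: cvg_norm.
    have fp : `|f w| < 2 * `|f w| by rewrite ltr_pMl ?normr_gt0// ltr1n.
    have nl : \forall n \near \oo, `|s n w| < 2 * `|f w| by exact: (cvgr_lt _ nw).
    apply: filterS nl => n nle.
    by rewrite /t mem_set// /A /= ltW.
  apply: cvg_trans sw; exact: near_eq_cvg.
have bnd n w : `|f w - t n w| <= 3 * `|f w|.
  apply: (le_trans (ler_normB _ _)).
  have : `|t n w| <= 2 * `|f w|.
    rewrite /t; case: ifP => [/set_mem//|_]; rewrite normr0 mulr_ge0//.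
  by move: (`|f w|) (`|t n w|) => x y; lra.
have mg : measurable_fun setT (fun w => ((3 * `|f w|) `^ r)%:E).
  have := measurable_norm_powR hP r (bochner_measurableZ 3 mf).
  by under eq_fun do rewrite normrZ ger0_norm//.
have [] := @dominated_convergence _ _ _ P setT measurableT
  (fun n w => (`|f w - t n w| `^ r)%:E) (cst 0%E) (fun w => ((3 * `|f w|) `^ r)%:E).
- by move=> n; exact: (measurable_norm_powR hP r (mft n)).
- exact: measurable_cst.
- apply: filterS sf => w /tf tw _.
  apply/fine_cvgP; split; first by near=> n.
  apply/cvgr0Pnorm_lt => eps eps0.
  have er0 : 0 < eps `^ r^-1 by rewrite powR_gt0.
  have /cvgrPdist_lt/(_ _ er0) tl := tw; apply: filterS tl => n H /=.
  rewrite ger0_norm ?powR_ge0//.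
  rewrite -[ltRHS](@powRVK _ r) ?gt_eqF ?(ltW eps0)//.
  by apply: gt0_ltr_powR => //; rewrite nnegrE ?normr_ge0 ?powR_ge0.
- apply/integrableP; split=> //.
  under eq_integral => w _.
    rewrite gee0_abs ?lee_fin ?powR_ge0// powRM// EFinM. over.
  rewrite ge0_integralZl_EFin ?powR_ge0//; last exact: (measurable_norm_powR hP r mf).
  by rewrite lte_mul_pinfty// ?lee_fin ?powR_ge0//; exact: normL_lty_int.
- apply/nearW => w n _; rewrite gee0_abs ?lee_fin ?powR_ge0//.
  by apply: ler_powR2; [exact: ltW|exact: normr_ge0|exact: bnd].
move=> _ _; rewrite integral0 => /fine_cvgP[fn /cvgr0Pnorm_lt].
move=> /(_ (e `^ r)); rewrite powR_gt0// => /(_ isT) c0.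
have : \forall n \near \oo, (normL P r (f \- t n)%R <= e%:E)%E.
  near=> n; rewrite normLE -[e](@powRK _ r) ?gt_eqF ?(ltW e0)// -poweR_EFin.
  apply: gt0_ler_poweR; first by rewrite invr_ge0 ltW.
  - by rewrite in_itv/= leey andbT; apply: integral_ge0 => w _; rewrite lee_fin powR_ge0.
  - by rewrite in_itv/= leey andbT lee_fin powR_ge0.
  have fnn : (\int[P]_w (`|f w - t n w| `^ r)%:E)%E \is a fin_num by near: n.
  rewrite -[leLHS]fineK// lee_fin ltW//.
  apply: le_lt_trans (ler_norm _) _; near: n; exact: c0.
by move=> /filter_ex [n Hn]; exists (t n).
Unshelve. all: by end_near. Qed.

End SimpleApproximation.

(** * Borel rounding *)

Section NearestPoint.
Context {R : realType} {F : completeNormedModType R}.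
Implicit Types (r : seq F) (e : R) (y : F).

(** Rounding to the first listed point within [e], or to the extra index when there is none. It
    depends on the value [y] alone, so equality of laws and independence pass to the rounded
    variables. *)
Definition near_idx e r y : 'I_(size r).+1 := inord (find (fun v => `|y - v| < e) r).

(* The default value [0] of [nth] is used exactly when no entry of [r] is
   within distance [e] of [y]. *)
Definition near_pt r (i : 'I_(size r).+1) : F := nth 0 r i.
Arguments near_pt : clear implicits.

Lemma near_idxE e r y : near_idx e r y = find (fun v => `|y - v| < e) r :> nat.
Proof. by rewrite /near_idx inordK// ltnS find_size. Qed.

(** If a listed point is within [e], so is the rounding. Otherwise the rounding is 0: then
    [|y| <= |y - z1| + B], and [e <= |y - z2|] turns the constant [B] into [B / e * |y - z2|]. In
    use, [z1] is a rough bounded approximation and [z2] a fine one with listed values. *)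
Lemma near_pt_dist e r y (z1 z2 : F) (B : R) : 0 < e -> z2 \in r -> `|z1| <= B ->
  `|y - near_pt r (near_idx e r y)| <= e + `|y - z1| + B / e * `|y - z2|.
Proof.
move=> e0 z2r z1B; have B0 : 0 <= B by exact: le_trans z1B.
rewrite /near_pt near_idxE; case: (boolP (has (fun v => `|y - v| < e) r)) => [hr|nr].
  have := nth_find 0 hr => /ltW/le_trans; apply.
  rewrite -addrA lerDl addr_ge0// mulr_ge0// divr_ge0// ltW//.
rewrite (hasNfind nr) nth_default// subr0.
have ey : e <= `|y - z2|.
  by rewrite leNgt; apply: contra nr => yz; apply/hasP; exists z2.
have h1 : `|y| <= `|y - z1| + B.
  by rewrite -{1}(subrK z1 y) (le_trans (ler_normD _ _))// lerD2l.
have h2 : B <= B / e * `|y - z2|.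
  rewrite -mulrA -{1}[B]mulr1 ler_wpM2l// mulrC ler_pdivlMr// mul1r//.
by move: e0 h1 h2; move: (`|y|) (`|y - z1|) (B / e * _) => a b c; lra.
Qed.

(** The domain is left general so as to serve twice: for random variables, and for the identity of
    [F] with its Borel sigma-algebra. *)
Lemma fin_rv_near_idx d (Om : measurableType d) (h : Om -> F) e r :
  (forall v, measurable [set w | `|h w - v| < e]) ->
  fin_rv (fun w => near_idx e r (h w)).
Proof.
move=> mh i.
have key (n : nat) (s : seq F) :
    measurable [set w | find (fun v => `|h w - v| < e) s = n].
  elim: s n => [|v s IH] n /=.
    case: n => [|n].
      by rewrite [X in measurable X](_ : _ = setT)//; apply/seteqP; split.
    by rewrite [X in measurable X](_ : _ = set0)//; apply/seteqP; split.
  case: n => [|n].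
    rewrite [X in measurable X](_ : _ = [set w | `|h w - v| < e])//.
    by apply/seteqP; split=> w /=; case: ifP.
  rewrite [X in measurable X](_ : _ = ~` [set w | `|h w - v| < e] `&`
    [set w | find (fun v => `|h w - v| < e) s = n]).
    by apply: measurableI => //; exact: measurableC.
  apply/seteqP; split=> w /=; first by case: ifP => // /negP hv [].
  by move=> [/negP/negbTE -> ->].
have := key i r; congr measurable; apply/seteqP; split=> w /=.
  by move=> H; apply: val_inj; rewrite /= near_idxE.
by move=> <-; rewrite near_idxE.
Qed.

End NearestPoint.
Arguments near_pt {R F} r i.

Section BorelLaws.
Context {R : realType} {F : completeNormedModType R}.
Local Notation opens := [set A : set F | open A].

Lemma borel_set_near_idx (e : R) (r : seq F) (i : 'I_(size r).+1) :
  borel_set (near_idx e r @^-1` [set i]).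
Proof.
apply: (@fin_rv_near_idx R F _ (g_sigma_algebraType opens) id e r) => v.
apply: sub_sigma_algebra => /=.
rewrite [X in open X](_ : _ = ball v e); first exact: ball_open.
by rewrite -ball_normE; apply/seteqP; split=> w /=; rewrite distrC.
Qed.

Lemma borel_set_norm (B : set R) : measurable B ->
  borel_set (F := F) [set y | B `|y|].
Proof.
move=> mB.
have mn : measurable_fun setT (fun y : g_sigma_algebraType opens => `|(y : F)|).
  apply: (measurability _ (RGenOInfty.measurableE R)) => _ [_ [x ->] <-].
  rewrite setTI; apply: sub_sigma_algebra => /=.
  apply: (@open_comp _ _ (fun y : F => `|y|)); last first.
    by rewrite set_itvE; exact: open_gt.
  by move=> y _; exact: norm_continuous.
by have := mn measurableT B mB; rewrite setTI.
Qed.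

Context d (Om : measurableType d) (P : probability Om R).
Hypothesis hP : measure_is_complete P.

Lemma same_law_normL (q : R) (Y Z : Om -> F) :
  bochner_measurable P Y -> bochner_measurable P Z -> same_law P Y Z ->
  normL P q Y = normL P q Z.
Proof.
move=> mY mZ YZ; rewrite !normLE; congr (_ `^ _)%E.
have mq : measurable_fun setT (fun x : R => (x `^ q)%:E).
  by apply/measurable_EFinP; exact: measurable_powR.
have nY := measurable_norm_bochner hP mY.
have nZ := measurable_norm_bochner hP mZ.
have H (V : Om -> F) (mV : measurable_fun setT (fun w => `|V w|)) :=
  @ge0_integral_pushforward _ _ _ _ _ _ mV P setT (fun x => (x `^ q)%:E)
    measurableT mq (fun x _ => powR_ge0 x q).
have := H _ nY; have := H _ nZ; rewrite !preimage_setT => <- <-.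
apply: eq_measure_integral => B mB _.
by rewrite /pushforward; exact: (YZ _ (borel_set_norm mB)).
Qed.

Lemma fin_rv_near_idx_bochner (f : Om -> F) (e : R) (r : seq F) :
  bochner_measurable P f -> fin_rv (fun w => near_idx e r (f w)).
Proof.
move=> mf; apply: fin_rv_near_idx => v.
have mn := measurable_norm_bochner hP
  (bochner_measurableB mf (bochner_measurable_cst P v)).
have := mn measurableT [set` `]-oo, e[] (measurable_itv _); rewrite setTI.
by congr measurable; apply/seteqP; split=> w /=; rewrite in_itv/=.
Qed.

(** The list may be enlarged freely beyond [r0], so that a single list can serve several random
    variables at once. *)
Lemma near_pt_approx (f : Om -> F) (q e : R) : 1 <= q -> inL P q f -> 0 < e ->
  exists r0 : seq F, forall r : seq F, {subset r0 <= r} ->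
    (normL P q (fun w => f w - near_pt r (near_idx e r (f w)))%R <= (3 * e)%:E)%E.
Proof.
move=> q1 Lf e0; have q0 : 0 < q by exact: lt_le_trans q1.
have mf := Lf.1.
have [s1 ss1 fs1] := simple_approx hP q0 Lf e0.
have [N1 [t1 [v1 [mt1 s1E]]]] := simple_rvP ss1.
pose B := \sum_i `|v1 i|.
have B0 : 0 <= B by apply: sumr_ge0.
have s1B w : `|s1 w| <= B.
  by rewrite s1E /= /B (bigD1 (t1 w))//= lerDl sumr_ge0.
(* This accuracy compensates the factor [B / e] of [near_pt_dist]; the added 1 keeps the denominator
   positive when [B = 0]. *)
have e'0 : 0 < e ^+ 2 / (B + 1) by rewrite divr_gt0 ?exprn_gt0// ltr_wpDl.
have [s2 ss2 fs2] := simple_approx hP q0 Lf e'0.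
have [N2 [t2 [v2 [mt2 s2E]]]] := simple_rvP ss2.
exists (codom v2) => r sub.
have ms1 := bochner_measurable_simple P ss1.
have ms2 := bochner_measurable_simple P ss2.
have mfs1 := bochner_measurableB mf ms1.
have mfs2 := bochner_measurableB mf ms2.
have mi : fin_rv (fun w => near_idx e r (f w)) by exact: fin_rv_near_idx_bochner.
have mn : bochner_measurable P (fun w => f w - near_pt r (near_idx e r (f w))).
  apply: bochner_measurableB => //.
  exact: (bochner_measurable_simple P (simple_rv_fin (near_pt r) mi)).
have BZ : bochner_measurable P (fun w => (B / e) *: (f w - s2 w)).
  exact: bochner_measurableZ.
have mc1 : bochner_measurable P (fun w => e + `|f w - s1 w| : R^o).
  apply: (@bochner_measurableD _ _ _ _ R^o); first exact: bochner_measurable_cst.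
  by apply: (@bochner_measurable_comp _ _ _ _ F R^o Num.norm) mfs1; exact: norm_continuous.
apply: (le_trans (normL_triangle hP q1 mn mc1 BZ _)).
  move=> w; rewrite normrZ !ger0_norm ?divr_ge0 ?(ltW e0) ?addr_ge0//; last exact: ltW.
  by apply: near_pt_dist => //; apply: sub; rewrite s2E; exact: codom_f.
have q3 : (3 * e)%:E = ((e + e)%:E + e%:E)%E by rewrite -EFinD; congr EFin; ring.
rewrite q3; apply: leeD.
  apply: (le_trans (normL_triangle hP q1 mc1 (bochner_measurable_cst P (e : R^o)) mfs1 _)).
    by move=> w; rewrite (le_trans (ler_normD _ _))// normr_id.
  by rewrite normL_cst// (ger0_norm (ltW e0)) EFinD leeD2l.
rewrite normLZ// ger0_norm; last by rewrite divr_ge0// ltW.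
apply: (@le_trans _ _ ((B / e)%:E * (e ^+ 2 / (B + 1))%:E)%E).
  by apply: lee_wpmul2l => //; rewrite lee_fin divr_ge0// ltW.
rewrite -EFinM lee_fin.
have -> : B / e * (e ^+ 2 / (B + 1)) = e * (B / (B + 1)) by field; lra.
rewrite -[leRHS]mulr1 ler_wpM2l ?(ltW e0)// ler_pdivrMr ?mul1r; lra.
Qed.

End BorelLaws.

(** * Bochner integrals *)

Section BochnerIntegral.
Context d (Om : measurableType d) (R : realType) (P : probability Om R).
Hypothesis hP : measure_is_complete P.

Section OneSpace.
Variable F : completeNormedModType R.
Implicit Types f s : Om -> F.

Lemma normL1E f : normL P 1 f = (\int[P]_w `|f w|%:E)%E.
Proof. by rewrite /normL Lnorm1; under eq_integral do rewrite /= normr_id. Qed.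

Lemma simple_integral_dist s s' : simple_rv s -> simple_rv s' ->
  (`|simple_integral P s - simple_integral P s'|%:E <= normL P 1 (s \- s')%R)%E.
Proof.
move=> /simple_rvP[N [t [v [mt ->]]]] /simple_rvP[N' [t' [v' [mt' ->]]]].
have mtt := fin_rv_pair mt mt'.
have -> : v \o t = (v \o fst) \o (fun w => (t w, t' w)) by [].
have -> : v' \o t' = (v' \o snd) \o (fun w => (t w, t' w)) by [].
rewrite !simple_integralE// normL1E.
rewrite (@integral_fin _ _ _ P _ _ (fun a => `|v a.1 - v' a.2|) mtt)// lee_fin.
rewrite -sumrB; apply: (le_trans (ler_norm_sum _ _ _)).
apply: ler_sum => a _; rewrite -scalerBr normrZ ger0_norm//; exact: lawf_ge0.
Qed.

Lemma bochner_integral_dist f m s : is_bochner_integral P f m -> simple_rv s ->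
  (`|simple_integral P s - m|%:E <= normL P 1 (f \- s)%R)%E.
Proof.
move=> [mf [t [st ft tm]]] ss.
have ms := bochner_measurable_simple P ss.
have mt n := bochner_measurable_simple P (st n).
apply/lee_addgt0Pr => e e0.
have e20 : 0 < e / 2 by rewrite divr_gt0.
move: ft => /fine_cvgP[fin /cvgr0Pnorm_lt/(_ _ e20) fe].
have [n [/= finn fn tn]] : exists n, [/\
    (\int[P]_w `|f w - t n w|%:E)%E \is a fin_num,
    `|fine (\int[P]_w `|f w - t n w|%:E)%E| < e / 2 &
    `|m - simple_integral P (t n)| < e / 2].
  have H : \forall n \near \oo, [/\
    (\int[P]_w `|f w - t n w|%:E)%E \is a fin_num,
    `|fine (\int[P]_w `|f w - t n w|%:E)%E| < e / 2 &
    `|m - simple_integral P (t n)| < e / 2].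
    near=> n; split; near: n => //.
    by have /cvgrPdist_lt/(_ _ e20) := tm.
  exact: filter_ex H.
have fn' : (normL P 1 (f \- t n)%R <= (e / 2)%:E)%E.
  rewrite normL1E -[leLHS]fineK// lee_fin ltW//.
  exact: le_lt_trans (ler_norm _) fn.
apply: (@le_trans _ _ (`|simple_integral P s - simple_integral P (t n)|%:E + (e / 2)%:E)%E).
  rewrite -EFinD lee_fin.
  apply: (le_trans (ler_distD (simple_integral P (t n)) _ _)).
  by rewrite lerD2l distrC ltW.
rewrite [e in leRHS](splitr e) EFinD addeA leeD2r//.
apply: (le_trans (simple_integral_dist ss (st n))).
apply: (@le_trans _ _ (normL P 1 (f \- s)%R + normL P 1 (f \- t n)%R)%E); last first.
  by rewrite leeD2l.
apply: normL_triangle => //; try by apply: bochner_measurableB.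
move=> w /=; rewrite [X in _ <= X + _]distrC; exact: ler_distD.
Unshelve. all: by end_near. Qed.

Lemma bochner_integral_unique f m m' :
  is_bochner_integral P f m -> is_bochner_integral P f m' -> m = m'.
Proof.
move=> fm fm'; apply/eqP; rewrite -subr_eq0 -normr_le0.
apply/ler_addgt0Pr => e e0; rewrite add0r.
have e20 : 0 < e / 2 by rewrite divr_gt0.
have [mf [t [st /fine_cvgP[fin /cvgr0Pnorm_lt/(_ _ e20) fe] tm]]] := fm.
have [n [/= finn fn]] : exists n,
    (\int[P]_w `|f w - t n w|%:E)%E \is a fin_num /\
    `|fine (\int[P]_w `|f w - t n w|%:E)%E| < e / 2.
  have H : \forall n \near \oo, 
    (\int[P]_w `|f w - t n w|%:E)%E \is a fin_num /\
    `|fine (\int[P]_w `|f w - t n w|%:E)%E| < e / 2.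
    by near=> n; split; near: n.
  exact: filter_ex H.
have fn' : (normL P 1 (f \- t n)%R <= (e / 2)%:E)%E.
  rewrite normL1E -[leLHS]fineK// lee_fin ltW//.
  exact: le_lt_trans (ler_norm _) fn.
have h1 := le_trans (bochner_integral_dist fm (st n)) fn'.
have h2 := le_trans (bochner_integral_dist fm' (st n)) fn'.
rewrite lee_fin in h1; rewrite lee_fin in h2.
rewrite (splitr e); apply: le_trans (lerD h1 h2).
by rewrite [X in _ <= X + _]distrC; exact: ler_distD.
Unshelve. all: by end_near. Qed.

(** Simple functions within [1 / (n + 1)] of [f] have Cauchy integrals, and completeness of [F]
    supplies the limit. *)
Lemma bochner_integral_exists f : bochner_measurable P f ->
  (forall e, 0 < e -> exists2 s, simple_rv s & (normL P 1 (f \- s)%R <= e%:E)%E) ->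
  exists m, is_bochner_integral P f m.
Proof.
move=> mf H.
have [t tP] : {t : nat -> Om -> F & forall n, simple_rv (t n) /\
    (normL P 1 (f \- t n)%R <= (n.+1%:R^-1)%:E)%E}.
  apply: (@choice _ _ (fun n s => simple_rv s /\ (normL P 1 (f \- s)%R <= (n.+1%:R^-1)%:E)%E)).
  by move=> n; have [|s ss fs] := H n.+1%:R^-1; [rewrite invr_gt0|exists s].
have st n := (tP n).1.
have mt n := bochner_measurable_simple P (st n).
have ft : (\int[P]_w `|f w - t n w|%:E)%E @[n --> \oo] --> 0%E.
  apply: (@squeeze_cvge _ _ _ _ (cst 0%E) _ (fun n => (n.+1%:R^-1)%:E)).
  - near=> n; apply/andP; split; first by apply: integral_ge0 => w _; rewrite lee_fin.
    by have := (tP n).2; rewrite normL1E.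
  - exact: cvg_cst.
  - by apply: cvg_EFin; [near=> n|exact: cvg_harmonic].
suff [m tm] : exists m : F, simple_integral P (t n) @[n --> \oo] --> m.
  by exists m; split=> //; exists t; split.
exists (lim (simple_integral P (t n) @[n --> \oo])).
apply/cauchy_cvgP/cauchy_ballP => e e0.
have e20 : 0 < e / 2 by rewrite divr_gt0.
have /cvgr0Pnorm_lt/(_ _ e20) [n0 _ Hn] := @cvg_harmonic R.
pose tail := (fun n => simple_integral P (t n)) @` [set n | (n0 <= n)%N].
exists (tail, tail).
  by split; exists n0 => // n /= nn; exists n.
move=> _ [[i /Hn/= hi <-] [j /Hn/= hj <-]].
rewrite -ball_normE /=.
have := simple_integral_dist (st i) (st j).
have := @normL_triangle _ _ _ _ hP _ _ _ 1 (t i \- t j) (f \- t i) (f \- t j) (lexx 1)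
  (bochner_measurableB (mt i) (mt j)) (bochner_measurableB mf (mt i))
  (bochner_measurableB mf (mt j)).
move=> h1 h2.
have {}h1 : (normL P 1 (t i \- t j)%R <= (i.+1%:R^-1 + j.+1%:R^-1)%:E)%E.
  apply: le_trans (h1 _) _.
    by move=> w /=; rewrite [X in _ <= X + _]distrC; exact: ler_distD.
  by rewrite EFinD leeD// (tP _).2.
have := le_trans h2 h1; rewrite lee_fin => /le_lt_trans; apply.
rewrite (splitr e); apply: ltrD.
  exact: le_lt_trans (ler_norm _) hi.
exact: le_lt_trans (ler_norm _) hj.
Unshelve. all: by end_near. Qed.

End OneSpace.

Lemma is_bochner_integral_linear (F F' : completeNormedModType R)
    (J : {linear F -> F'}) f m : continuous J ->
  is_bochner_integral P f m -> is_bochner_integral P (J \o f) (J m).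
Proof.
move=> Jc [mf [t [st ft tm]]].
have /linear_boundedP := (linear_bounded_continuous J).2 Jc.
move=> /pinfty_ex_gt0 [r r0 Jr].
have mt n := bochner_measurable_simple P (st n).
split; first exact: bochner_measurable_comp.
exists (fun n => J \o t n); split.
- by move=> n; exact: simple_rv_comp.
- apply: (@squeeze_cvge _ _ _ _ (cst 0%E) _
    (fun n => r%:E * \int[P]_w `|f w - t n w|%:E)%E); last 2 first.
  + exact: cvg_cst.
  + by rewrite -(mule0 r%:E); apply: cvgeZl.
  near=> n; apply/andP; split; first by apply: integral_ge0 => w _; rewrite lee_fin.
  have mft := bochner_measurableB mf (mt n).
  rewrite -!normL1E -[r%:E](_ : `|r|%:E = _); last by rewrite gtr0_norm.
  rewrite -normLZ//; apply: (@le_normL _ _ _ _ hP _ _ 1 (J \o f \- (J \o t n))) => //.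
  + by apply: bochner_measurableB; exact: bochner_measurable_comp.
  + exact: bochner_measurableZ.
  + by move=> w /=; rewrite -linearB normrZ gtr0_norm//; exact: Jr.
- have JE n : simple_integral P (J \o t n) = J (simple_integral P (t n)).
    have /simple_rvP[N [s [v [ms ->]]]] := st n.
    rewrite (simple_integralE P v ms) (simple_integralE P (J \o v) ms).
    by rewrite linear_sum; apply: eq_bigr => a _; rewrite linearZ.
  under eq_fun do rewrite JE.
  exact: (continuous_cvg _ (Jc _)).
Unshelve. all: by end_near. Qed.

End BochnerIntegral.

(** * Tensor powers of random variables *)

Section TensorPowerMoments.
Context d (Om : measurableType d) (R : realType) (P : probability Om R).
Hypothesis hP : measure_is_complete P.
Context (E : completeNormedModType R) (k : nat) (Ts : sym_inj_tensor E k).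
Hypothesis k0 : (0 < k)%N.

Lemma Tpow_lip (x y : E) : `|x - y| <= 1 ->
  `|Tpow Ts x - Tpow Ts y| <=
  `|x - y| * \sum_(i < k) 'C(k, i.+1)%:R * `|y| ^+ (k - i - 1).
Proof.
move=> xy1; apply: (le_trans (norm_Tpow_diff_le Ts x y)).
rewrite mulr_sumr; apply: ler_sum => i _; rewrite [leRHS]mulrCA ler_wpM2l//.
rewrite ler_wpM2r ?exprn_ge0// exprS ler_piMr//.
exact: exprn_ile1.
Qed.

Lemma Tpow_continuous : continuous (Tpow Ts).
Proof.
move=> y; apply/cvgrPdist_lt => e e0.
pose K := \sum_(i < k) 'C(k, i.+1)%:R * `|y| ^+ (k - i - 1) : R.
have K0 : 0 <= K by apply: sumr_ge0 => i _; rewrite mulr_ge0// exprn_ge0.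
have K1 : 0 < K + 1 by rewrite ltr_wpDl.
have d0 : 0 < Num.min 1 (e / (K + 1)) by rewrite lt_min ltr01 divr_gt0.
have near_y : \forall x \near y, `|y - x| < Num.min 1 (e / (K + 1)).
  by have /cvgrPdist_lt/(_ _ d0) := @cvg_id _ (nbhs y).
apply: filterS near_y => x; rewrite lt_min distrC => /andP[xy1 xye].
rewrite distrC; apply: (le_lt_trans (Tpow_lip (ltW xy1))).
rewrite -/K; apply: (@le_lt_trans _ _ (`|x - y| * (K + 1))).
  by rewrite ler_wpM2l// lerDl.
by rewrite -ltr_pdivlMr.
Qed.

Lemma bochner_measurable_Tpow (X : Om -> E) :
  bochner_measurable P X -> bochner_measurable P (Tpow Ts \o X).
Proof. by apply: bochner_measurable_comp; exact: Tpow_continuous. Qed.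

Lemma bochner_measurable_mixed (a b : nat) (X Y : Om -> E) :
  bochner_measurable P X -> bochner_measurable P Y ->
  bochner_measurable P (fun w => `|X w| ^+ a * `|Y w| ^+ b : R^o).
Proof.
move=> [s [ss sX]] [t [st tY]].
exists (fun n w => `|s n w| ^+ a * `|t n w| ^+ b : R^o); split.
  move=> n; exact: (@simple_rv_comp2 _ _ R E E R^o (fun x y => `|x| ^+ a * `|y| ^+ b) _ _ (ss n) (st n)).
apply: filterS2 sX tY => w sw tw.
have cvX (u : nat -> E) (v : E) (c : nat) : u n @[n --> \oo] --> v ->
    `|u n| ^+ c @[n --> \oo] --> `|v| ^+ c.
  move=> uv; apply: (continuous_cvg _ (@exprn_continuous R c _)).
  exact: cvg_norm.
by apply: cvgM; exact: cvX.
Qed.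

Lemma normL_mixed_sum_le (q : R) (c : 'I_k -> R) (f : Om -> Ts) (X Y : Om -> E) :
  1 <= q -> (forall i, 0 <= c i) ->
  bochner_measurable P f -> bochner_measurable P X -> bochner_measurable P Y ->
  (forall w, `|f w| <= \sum_(i < k) c i * (`|X w| ^+ i.+1 * `|Y w| ^+ (k - i - 1))) ->
  (normL P q f <= \sum_(i < k) (c i)%:E *
     (normL P (k%:R * q) X ^+ i.+1 * normL P (k%:R * q) Y ^+ (k - i - 1)))%E.
Proof.
move=> q1 c0 mf mX mY fXY; have q0 : 0 < q by exact: lt_le_trans q1.
pose h (i : 'I_k) w : R^o := c i *: (`|X w| ^+ i.+1 * `|Y w| ^+ (k - i - 1) : R^o).
have mh i : bochner_measurable P (h i).
  by apply: bochner_measurableZ; exact: bochner_measurable_mixed.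
apply: (@le_trans _ _ (normL P q (fun w => \sum_(i < k) h i w))).
  apply: le_normL => //; [exact: ltW|exact: bochner_measurable_sum|].
  move=> w; rewrite [leRHS]ger0_norm; first exact: fXY.
  by apply: sumr_ge0 => i _; rewrite !mulr_ge0// exprn_ge0.
apply: (le_trans (normL_sum hP _ q1 mh)).
apply: lee_sum => i _; rewrite normLZ//; last exact: bochner_measurable_mixed.
rewrite ger0_norm//; apply: lee_wpmul2l; first by rewrite lee_fin.
by apply: normL_mixed_le => //; rewrite -subnDA addn1 subnKC.
Qed.

Lemma normL_Tpow_diff_le (q : R) (X Y : Om -> E) :
  1 <= q -> bochner_measurable P X -> bochner_measurable P Y ->
  (normL P q ((Tpow Ts \o X) \- (Tpow Ts \o Y))%R <= \sum_(i < k) 'C(k, i.+1)%:R%:E *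
     (normL P (k%:R * q) (X \- Y)%R ^+ i.+1 *
      normL P (k%:R * q) Y ^+ (k - i - 1)))%E.
Proof.
move=> q1 mX mY; apply: (normL_mixed_sum_le (c := fun i : 'I_k => 'C(k, i.+1)%:R)) => //.
- by apply: bochner_measurableB; exact: bochner_measurable_Tpow.
- exact: bochner_measurableB.
- by move=> w; exact: norm_Tpow_diff_le.
Qed.

(** Local Lipschitz constant at [X], for perturbations of [L_{kq}] norm at most 1, of the map
    sending a variable to its tensor power in [L_q]. *)
Definition moment_lip (q : R) (X : Om -> E) : R :=
  \sum_(i < k) 'C(k, i.+1)%:R * fine (normL P (k%:R * q) X) ^+ (k - i - 1).

Lemma moment_lip_ge0 q X : 0 <= moment_lip q X.
Proof.
by apply: sumr_ge0 => i _; rewrite mulr_ge0// exprn_ge0// fine_ge0// normL_ge0.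
Qed.

Lemma normL_Tpow_approx (q e : R) (X Y : Om -> E) :
  1 <= q -> bochner_measurable P X -> inL P (k%:R * q) Y ->
  0 <= e <= 1 -> (normL P (k%:R * q) (X \- Y)%R <= e%:E)%E ->
  (normL P q ((Tpow Ts \o X) \- (Tpow Ts \o Y))%R <= (e * moment_lip q Y)%:E)%E.
Proof.
move=> q1 mX [mY Yfin] /andP[e0 e1] XYe.
apply: (le_trans (normL_Tpow_diff_le q1 mX mY)).
rewrite /moment_lip mulr_sumr -sumEFin; apply: lee_sum => i _.
rewrite mulrCA [leRHS]EFinM; apply: lee_wpmul2l; first by rewrite lee_fin.
have Yf : normL P (k%:R * q) Y \is a fin_num by rewrite ge0_fin_numE ?normL_ge0.
rewrite EFinM EFin_expe fineK//.
apply: lee_pmul; rewrite ?expe_ge0 ?normL_ge0//.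
have De : normL P (k%:R * q) (X \- Y)%R \is a fin_num.
  by rewrite ge0_fin_numE ?normL_ge0//; exact: (le_lt_trans XYe (ltry e)).
move: XYe; rewrite -(fineK De) -EFin_expe !lee_fin => XYe.
have D0 : 0 <= fine (normL P (k%:R * q) (X \- Y)%R) by rewrite fine_ge0 ?normL_ge0.
rewrite exprS; apply: (le_trans _ XYe); rewrite ler_piMr//.
by rewrite exprn_ile1// (le_trans XYe).
Qed.

Lemma Tpow_simple_approx (q e : R) (X : Om -> E) :
  1 <= q -> inL P (k%:R * q) X -> 0 < e ->
  exists s : Om -> E, [/\ simple_rv s, (normL P (k%:R * q) (s \- X)%R <= e%:E)%E &
    (normL P q ((Tpow Ts \o s) \- (Tpow Ts \o X))%R <= e%:E)%E].
Proof.
move=> q1 LX e0; have q0 : 0 < q by exact: lt_le_trans q1.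
pose K := moment_lip q X; have K0 : 0 <= K := moment_lip_ge0 q X.
have K1 : 0 < K + 1 by rewrite ltr_wpDl.
(* The three bounds serve in turn the distance to [X], the restriction to perturbations of norm at
   most 1, and the Lipschitz constant [K]. *)
pose e' := Num.min e (Num.min 1 (e / (K + 1))).
have e'0 : 0 < e' by rewrite !lt_min e0 ltr01 divr_gt0.
have kq0 : 0 < k%:R * q by rewrite mulr_gt0// ltr0n.
have [s ss Xs] := simple_approx hP kq0 LX e'0.
have ms := bochner_measurable_simple P ss.
have mX := LX.1.
have sX : (normL P (k%:R * q) (s \- X)%R <= e'%:E)%E.
  apply: le_trans Xs; apply: (le_normL hP (ltW kq0)); try exact: bochner_measurableB.
  by move=> w /=; rewrite distrC.
exists s; split=> //.
  by apply: (le_trans sX); rewrite lee_fin /e' ge_min lexx.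
apply: (le_trans (normL_Tpow_approx q1 ms LX _ sX)).
  by rewrite (ltW e'0)/= /e' !ge_min lexx !orbT.
rewrite lee_fin -/K; apply: (@le_trans _ _ (e / (K + 1) * K)).
  by rewrite ler_wpM2r// /e' !ge_min lexx !orbT.
by rewrite mulrAC -mulrA ler_piMr ?(ltW e0)// ler_pdivrMr// mul1r lerDl.
Qed.

Lemma Tpow_inL (q : R) (X : Om -> E) : 1 <= q -> inL P (k%:R * q) X ->
  inL P q (Tpow Ts \o X).
Proof.
move=> q1 [mX Xfin]; split; first exact: bochner_measurable_Tpow.
have m0 := bochner_measurable_cst P (0 : E).
have H := normL_Tpow_diff_le q1 mX m0.
apply: (le_lt_trans (le_trans _ H)).
  apply: le_normL => //; first by apply: le_trans q1.
  - exact: bochner_measurable_Tpow.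
  - by apply: bochner_measurableB; exact: bochner_measurable_Tpow.
  - by move=> w /=; rewrite Tpow0// subr0.
have kq0 : 0 < k%:R * q by rewrite mulr_gt0 ?ltr0n// (lt_le_trans ltr01).
rewrite normL_cst// normr0.
have -> : (X \- (fun=> 0)) = X by apply/funext => w /=; rewrite subr0.
have Xf : normL P (k%:R * q) X \is a fin_num by rewrite ge0_fin_numE ?normL_ge0.
rewrite -(fineK Xf).
under eq_bigr do rewrite -!EFin_expe -!EFinM.
by rewrite sumEFin ltry.
Qed.

Lemma Tpow_bochner_integral (q : R) (X : Om -> E) : 1 <= q ->
  inL P (k%:R * q) X -> exists m, is_bochner_integral P (Tpow Ts \o X) m.
Proof.
move=> q1 LX; have mX := LX.1.
apply: bochner_integral_exists => //; first exact: bochner_measurable_Tpow.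
move=> e e0; have [s [ss _ sT]] := Tpow_simple_approx q1 LX e0.
exists (Tpow Ts \o s); first exact: simple_rv_comp.
have ms := bochner_measurable_simple P ss.
have mTX := bochner_measurable_Tpow mX; have mTs := bochner_measurable_Tpow ms.
rewrite normL1E; apply: (le_trans (normL1_le hP q1 (bochner_measurableB mTX mTs))).
apply: le_trans sT; apply: le_normL => //; try exact: bochner_measurableB.
  exact: le_trans q1.
by move=> w /=; rewrite distrC.
Qed.

End TensorPowerMoments.

Section Grouping.
Context {R : realType} {A B : finType} (n : nat) (w : A -> R) (h : A -> B).

Lemma prodw_group (b : {ffun 'I_n -> B}) :
  \prod_j (\sum_(x | h x == b j) w x) =
  \sum_(a : {ffun 'I_n -> A} | [ffun j => h (a j)] == b) prodw w a.
Proof.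
transitivity (\prod_(j < n) \sum_x (h x == b j)%:R * w x).
  apply: eq_bigr => j _; rewrite big_mkcond/=; apply: eq_bigr => x _.
  by case: ifP; rewrite ?mul1r ?mul0r.
rewrite (bigA_distr_bigA (fun j x => (h x == b j)%:R * w x)) [RHS]big_mkcond/=.
apply: eq_bigr => a _; rewrite big_split/=.
have [<-|ab] := eqVneq [ffun j => h (a j)] b.
  by rewrite big1 ?mul1r// => j _; rewrite ffunE eqxx.
suff [j hj] : exists j, h (a j) != b j.
  by rewrite (bigD1 j)//= (negbTE hj) !mul0r.
apply/existsP; rewrite -negb_forall; apply: contra ab => /forallP ab.
by apply/eqP/ffunP => j; rewrite ffunE; apply/eqP.
Qed.

(** The image of a product law under a coordinatewise map is the product of the image laws. A norm
    over rounded samples can thus be computed on samples that carry more information. *)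
Lemma wnorm_prodw_group (w' : B -> R) (q : R) (G : {ffun 'I_n -> B} -> R) :
  (forall b, w' b = \sum_(x | h x == b) w x) ->
  wnorm (prodw w') q G = wnorm (prodw w) q (fun a : {ffun 'I_n -> A} => G [ffun j => h (a j)]).
Proof.
move=> w'E; rewrite /wnorm; congr (_ `^ _).
rewrite [RHS](partition_big (fun a : {ffun 'I_n -> A} => [ffun j => h (a j)]) xpredT)//=.
apply: eq_bigr => b _; rewrite /prodw.
under eq_bigr do rewrite w'E.
rewrite prodw_group mulr_suml; apply: eq_bigr => a /eqP ab.
by rewrite ab.
Qed.

End Grouping.

(** Three sources of error: the replacement of [c] by [c'], the fluctuation of the centred sum, and
    the replacement of [zeta] by [v]. The last costs a single-sample norm because every coordinate
    has law [w]. *)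
Lemma wnorm_mean_le {R : realType} {A : finType} (n : nat) (w : A -> R) (q B : R)
    (F : completeNormedModType R) (v zeta : A -> F) (c c' : F) :
  1 <= q -> (0 < n)%N -> (forall a, 0 <= w a) -> \sum_a w a = 1 ->
  wnorm (prodw (n := n) w) q (fun a => `|\sum_j (zeta (a j) - c')|) <= B ->
  wnorm (prodw (n := n) w) q (fun a => `|c - n%:R^-1 *: \sum_j v (a j)|) <=
  `|c - c'| + n%:R^-1 * B + wnorm w q (fun a => `|zeta a - v a|).
Proof.
move=> q1 n0 w0 w1 HB.
have W0 := prodw_ge0 (n := n) w0; have W1 := prodw1 n w1.
have n0' : (n%:R : R) != 0 by rewrite pnatr_eq0 -lt0n.
have ni0 : 0 <= n%:R^-1 :> R by rewrite invr_ge0.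
pose g (a : {ffun 'I_n -> A}) : R := n%:R^-1 * `|\sum_j (zeta (a j) - c')|.
pose h (a : {ffun 'I_n -> A}) : R := n%:R^-1 * \sum_j `|zeta (a j) - v (a j)|.
have h0 a : 0 <= h a by rewrite mulr_ge0// sumr_ge0.
have g0 a : 0 <= g a by rewrite mulr_ge0.
apply: (@le_trans _ _ (wnorm (prodw w) q (fun a => (`|c - c'| + g a) + h a))).
  apply: (le_wnorm q1 W0) => a; rewrite normr_id [leRHS]ger0_norm; last first.
    by rewrite !addr_ge0.
  have -> : c - n%:R^-1 *: \sum_j v (a j) = (c - c') -
      n%:R^-1 *: (\sum_j (zeta (a j) - c')) + n%:R^-1 *: (\sum_j (zeta (a j) - v (a j))).
    rewrite !sumrB sumr_const card_ord -[c' *+ n]scaler_nat !scalerBr scalerA.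
    by rewrite mulVf// scale1r opprB !subrKA.
  apply: (le_trans (ler_normD _ _)); apply: lerD.
    by apply: (le_trans (ler_normB _ _)); rewrite lerD2l normrZ ger0_norm.
  rewrite normrZ ger0_norm// ler_wpM2l//; exact: ler_norm_sum.
apply: (le_trans (wnormD q1 W0 _ _)); apply: lerD.
  apply: (le_trans (wnormD q1 W0 _ _)); rewrite wnorm_cst// normr_id lerD2l.
  by rewrite wnormZ// ger0_norm// ler_wpM2l.
rewrite wnormZ// ger0_norm//.
apply: (@le_trans _ _ (n%:R^-1 * \sum_(j < n) wnorm w q (fun a => `|zeta a - v a|))).
  rewrite ler_wpM2l//; apply: (le_trans (wnorm_sum q1 W0 _ _)).
  apply: ler_sum => j _.
  by rewrite (wnorm_prodw w1 q (fun x => `|zeta x - v x|) j).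
by rewrite sumr_const card_ord -[X in _ * X <= _]mulr_natl mulrA mulVf// mul1r.
Qed.

Section JointLaw.
Context d (Om : measurableType d) (R : realType) (P : probability Om R).
Hypothesis hP : measure_is_complete P.

Lemma fin_rv_ffun (n : nat) (B : finType) (t : 'I_n -> Om -> B) :
  (forall j, fin_rv (t j)) -> fin_rv (fun w => [ffun j => t j w]).
Proof.
move=> mt b.
rewrite [X in measurable X](_ : _ = \bigcap_(j in [set: 'I_n]) (t j @^-1` [set b j])).
  by apply: fin_bigcap_measurable => [|j _]; [exact: finite_finset|exact: mt].
apply/seteqP; split=> w /=; first by move=> <- j _; rewrite /= ffunE.
by move=> H; apply/ffunP => j; rewrite ffunE; exact: H.
Qed.

(** Independence and equality of laws are stated for Borel sets, and the fibres of the rounding map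
    are Borel. *)
Lemma joint_law (F : completeNormedModType R) (n : nat) (xi : 'I_n -> Om -> F)
    (zeta : Om -> F) (e : R) (r : seq F) :
  bochner_measurable P zeta -> independent_copies P xi zeta ->
  lawf P (fun w => [ffun j => near_idx e r (xi j w)]) =
  prodw (n := n) (lawf P (fun w => near_idx e r (zeta w))).
Proof.
move=> mz [mxi law ind]; apply/funext => b.
have mt j : fin_rv (fun w => near_idx e r (xi j w)).
  exact: (fin_rv_near_idx_bochner hP e (mxi j)).
have mtz : fin_rv (fun w => near_idx e r (zeta w)).
  exact: (fin_rv_near_idx_bochner hP e mz).
have mJ := fin_rv_ffun mt.
apply: EFin_inj; rewrite -lawfE//.
have bor j : borel_set (near_idx e r @^-1` [set b j]) := @borel_set_near_idx R F e r (b j).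
have H := ind [set: 'I_n]%SET _ bor.
rewrite [X in P X](_ : _ = \bigcap_(i in [set i | i \in [set: 'I_n]%SET])
   (xi i @^-1` (near_idx e r @^-1` [set b i]))); last first.
  apply/seteqP; split=> w /=; first by move=> <- j _; rewrite /= ffunE.
  by move=> G; apply/ffunP => j; rewrite ffunE; apply: G; rewrite /= inE.
rewrite H /prodw (big_morph EFin EFinM (erefl _)).
apply: eq_big => [j|j _]; first by rewrite inE.
by rewrite (law j _ (bor j)) -lawfE.
Qed.

End JointLaw.

(** * Sampling error on one level *)

Section SamplingError.
Context d (Om : measurableType d) (R : realType) (P : probability Om R).
Hypothesis hP : measure_is_complete P.
Context (E : completeNormedModType R) (k n : nat) (Ts : sym_inj_tensor E k).
Hypotheses (k0 : (0 < k)%N) (n0 : (0 < n)%N).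
Context (p q C : R).
Hypotheses (p1 : 1 <= p) (pq : p <= q) (C0 : 0 <= C) (HC : sign_type_bound E n p q C).
Context (X Y : Om -> E) (xi : 'I_n -> Om -> Ts) (mX mY : Ts).
Hypotheses (LX : inL P (k%:R * q) X) (LY : inL P (k%:R * q) Y).
Hypothesis (hxi : independent_copies P xi (fun w => Tpow Ts (X w) - Tpow Ts (Y w))).
Hypotheses (hmX : is_bochner_integral P (Tpow Ts \o X) mX)
  (hmY : is_bochner_integral P (Tpow Ts \o Y) mY).

Let q1 : 1 <= q. Proof. exact: le_trans pq. Qed.
Let q0 : 0 < q. Proof. exact: lt_le_trans q1. Qed.
Let kq1 : 1 <= k%:R * q.
Proof. by apply: (le_trans q1); rewrite ler_peMl ?(ltW q0)// ler1n. Qed.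

Let Dn := fine (normL P (k%:R * q) (X \- Y)).
Let Yn := fine (normL P (k%:R * q) Y).
Let K0 := n%:R^-1 * (16 * k%:R * C * n%:R `^ p^-1).

Let zeta w := Tpow Ts (X w) - Tpow Ts (Y w).

Let mzeta : bochner_measurable P zeta.
Proof.
by apply: bochner_measurableB; apply: bochner_measurable_Tpow; [exact: LX.1|exact: LY.1].
Qed.

Let zetaL : inL P q zeta.
Proof.
split; first exact: mzeta.
have [mTX TXf] := Tpow_inL hP Ts k0 q1 LX.
have [mTY TYf] := Tpow_inL hP Ts k0 q1 LY.
apply: le_lt_trans (normL_triangle hP q1 mzeta mTX mTY _) _.
  by move=> w; exact: ler_normB.
by rewrite lte_add_pinfty.
Qed.

Let xiL j : inL P q (xi j).
Proof.
have [mxi law _] := hxi; split; first exact: mxi.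
by rewrite (same_law_normL hP q (mxi j) mzeta (law j)) zetaL.2.
Qed.

Let XYf : normL P (k%:R * q) (X \- Y) \is a fin_num.
Proof.
rewrite ge0_fin_numE ?normL_ge0//.
have mXY := bochner_measurableB LX.1 LY.1.
apply: le_lt_trans (normL_triangle hP kq1 mXY LX.1 LY.1 _) _.
  by move=> w; exact: ler_normB.
by apply: lte_add_pinfty; [exact: LX.2|exact: LY.2].
Qed.

Let Yf : normL P (k%:R * q) Y \is a fin_num.
Proof. by rewrite ge0_fin_numE ?normL_ge0//; exact: LY.2. Qed.

Lemma sampling_error_simple (e : R) (sX sY : Om -> E) :
  simple_rv sX -> simple_rv sY ->
  (normL P (k%:R * q) (sX \- X)%R <= e%:E)%E ->
  (normL P (k%:R * q) (sY \- Y)%R <= e%:E)%E ->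
  (normL P (k%:R * q) (sX \- sY)%R <= (Dn + 2 * e)%:E)%E /\
  (normL P (k%:R * q) sY <= (Yn + e)%:E)%E.
Proof.
move=> ssX ssY hsX hsY.
have msX := bochner_measurable_simple P ssX.
have msY := bochner_measurable_simple P ssY.
have [mX' mY'] := (LX.1, LY.1).
have mXY := bochner_measurableB mX' mY'.
have msXX := bochner_measurableB msX mX'.
have msYY := bochner_measurableB msY mY'.
have msXY := bochner_measurableB msX msY.
split; last first.
  apply: (le_trans (normL_triangle hP kq1 msY mY' msYY _)).
    by move=> w /=; rewrite -{1}(subrKC (Y w) (sY w)); exact: ler_normD.
  by rewrite EFinD fineK// leeD2l.
have msXY' := bochner_measurableB msX mY'.
apply: (le_trans (normL_triangle hP kq1 msXY msXY' msYY _)).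
  by move=> w /=; rewrite [X in _ <= _ + X]distrC; exact: ler_distD.
have -> : (Dn + 2 * e)%:E = ((Dn + e)%:E + e%:E)%E by rewrite -EFinD; congr EFin; ring.
apply: leeD => //.
apply: (le_trans (normL_triangle hP kq1 msXY' mXY msXX _)).
  by move=> w /=; rewrite [leRHS]addrC; exact: ler_distD.
by rewrite EFinD fineK// leeD2l.
Qed.

Lemma near_family (e : R) : 0 < e -> exists r : seq Ts,
  (normL P q (fun w => zeta w - near_pt r (near_idx e r (zeta w)))%R <= (3 * e)%:E)%E /\
  forall j, (normL P q (fun w => xi j w - near_pt r (near_idx e r (xi j w)))%R <= (3 * e)%:E)%E.
Proof.
move=> e0; have [r0 Hr0] := near_pt_approx hP q1 zetaL e0.
have [r Hr] := choice (fun j => near_pt_approx hP q1 (xiL j) e0).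
exists (r0 ++ flatten [seq r j | j <- enum 'I_n]); split.
  by apply: Hr0 => y yr; rewrite mem_cat yr.
move=> j; apply: Hr => y yr; rewrite mem_cat; apply/orP; right.
by apply/flatten_mapP; exists j => //; rewrite mem_enum.
Qed.

(** The error [10 * e] is made of [3 * e] for rounding the copies, [2 * e] for the two means, and
    [5 * e] for exchanging rounded tensors with the tensors of the simple functions. *)
Lemma sampling_error_approx (e : R) : 0 < e ->
  (normL P q (fun w => (mX - mY) - n%:R^-1 *: \sum_j xi j w)%R <=
   (10 * e + K0 * \sum_(i < k) 'C(k, i.+1)%:R *
     ((Dn + 2 * e) ^+ i.+1 * (Yn + e) ^+ (k - i - 1)))%:E)%E.
Proof.
move=> e0.
have [sX [ssX hsX hTX]] := Tpow_simple_approx hP Ts k0 q1 LX e0.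
have [sY [ssY hsY hTY]] := Tpow_simple_approx hP Ts k0 q1 LY e0.
have [hXY hYY] := sampling_error_simple ssX ssY hsX hsY.
have [r [hz hr]] := near_family e0.
have [mxi _ _] := hxi.
set c := mX - mY.
have ni0 : 0 <= n%:R^-1 :> R by rewrite invr_ge0.
pose phi (y : Ts) := near_pt r (near_idx e r y).
have mi (f : Om -> Ts) : bochner_measurable P f -> fin_rv (fun w => near_idx e r (f w)).
  by move=> mf; exact: (fin_rv_near_idx_bochner hP e mf).
have mphi (f : Om -> Ts) : bochner_measurable P f -> bochner_measurable P (fun w => phi (f w)).
  by move=> mf; exact: (bochner_measurable_simple P (simple_rv_fin (near_pt r) (mi f mf))).
pose V w := c - n%:R^-1 *: \sum_j phi (xi j w).
have mV : bochner_measurable P V.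
  apply: bochner_measurableB; first exact: bochner_measurable_cst.
  apply: bochner_measurableZ; apply: bochner_measurable_sum => j; exact: mphi.
have mxp j : bochner_measurable P (fun w => xi j w - phi (xi j w)).
  by apply: bochner_measurableB => //; exact: mphi.
have msum : bochner_measurable P (fun w => \sum_j (xi j w - phi (xi j w))).
  exact: bochner_measurable_sum.
have mZ : bochner_measurable P (fun w => n%:R^-1 *: \sum_j (xi j w - phi (xi j w))).
  exact: bochner_measurableZ.
have mW : bochner_measurable P (fun w => c - n%:R^-1 *: \sum_j xi j w).
  apply: bochner_measurableB; first exact: bochner_measurable_cst.
  by apply: bochner_measurableZ; apply: bochner_measurable_sum => j; exact: mxi.
have step1 : (normL P q (fun w => c - n%:R^-1 *: \sum_j xi j w)%R <=
    normL P q V + (3 * e)%:E)%E.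
  apply: (le_trans (normL_triangle hP q1 mW mV mZ _)).
    move=> w; apply: le_trans (ler_normB _ _).
    by rewrite /V sumrB scalerBr opprB addrA subrK lexx.
  rewrite leeD2l// normLZ// ger0_norm//.
  apply: (@le_trans _ _ (n%:R^-1%:E * (\sum_(j < n) (3 * e)%:E))%E).
    apply: lee_wpmul2l; first by rewrite lee_fin.
    by apply: (le_trans (normL_sum hP _ q1 mxp)); apply: lee_sum => j _; exact: hr.
  rewrite sumEFin -EFinM lee_fin sumr_const card_ord -[X in _ * X <= _]mulr_natl.
  by rewrite mulrA mulVf ?mul1r// pnatr_eq0 -lt0n.
have [NX [tX [vX [mtX sXE]]]] := simple_rvP ssX.
have [NY [tY [vY [mtY sYE]]]] := simple_rvP ssY.
(* The rounded tensor is recorded jointly with the simple functions; its law, which is that of each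
   rounded copy, is the first marginal. *)
pose s w := (near_idx e r (zeta w), (tX w, tY w)).
have ms : fin_rv s := fin_rv_pair (mi _ mzeta) (fin_rv_pair mtX mtY).
pose w := lawf P s.
have w0 a : 0 <= w a := lawf_ge0 P s a.
have w1 : \sum_a w a = 1 := lawf_sum1 P ms.
pose A := ('I_(size r).+1 * ('I_NX.+1 * 'I_NY.+1))%type.
pose x (a : A) := vX a.2.1; pose y (a : A) := vY a.2.2.
pose z (a : A) := Tpow Ts (x a) - Tpow Ts (y a).
pose v (a : A) := near_pt r a.1.
pose c' := \sum_b w b *: z b.
pose S := \sum_(i < k) 'C(k, i.+1)%:R *
    wnorm w q (fun a => `|x a - y a| ^+ i.+1 * `|y a| ^+ (k - i - 1)).
have HB := discrete_sampling_error (fun a => erefl (z a)) w0 w1 n0 p1 pq C0 HC.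
(* The copies enter only through the product law of their roundings, which is lifted along [fst] to
   the product of [w]; there each sample has its own [x] and [y]. *)
have step2 : (normL P q V <= (`|c - c'| + K0 * S + wnorm w q (fun a => `|z a - v a|))%:E)%E.
  pose J u := [ffun j => near_idx e r (xi j u)].
  have mJ : fin_rv J by apply: fin_rv_ffun => j; exact: mi.
  have -> : V = (fun b : {ffun 'I_n -> 'I_(size r).+1} =>
      c - n%:R^-1 *: \sum_j near_pt r (b j)) \o J.
    apply/funext => u; rewrite /V /=; congr (_ - _ *: _).
    by apply: eq_bigr => j _; rewrite ffunE.
  rewrite normL_fin// lee_fin (joint_law hP e r mzeta hxi).
  rewrite (@wnorm_prodw_group _ A _ n w fst); last first.
    by move=> b; exact: (lawf_comp P fst b ms).
  have := wnorm_mean_le v c q1 n0 w0 w1 HB; rewrite -/c' -/S.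
  have -> : n%:R^-1 * (16 * k%:R * C * n%:R `^ p^-1 * S) = K0 * S by rewrite /K0 mulrA.
  apply: le_trans; rewrite le_eqVlt; apply/orP; left; apply/eqP.
  congr wnorm; apply/funext => a; congr (`|_ - _ *: _|).
  by apply: eq_bigr => j _; rewrite ffunE.
have TsE (u : Om) : z (s u) = Tpow Ts (sX u) - Tpow Ts (sY u) by rewrite /z /x /y sXE sYE.
have [mTX mTY] : bochner_measurable P (Tpow Ts \o X) /\ bochner_measurable P (Tpow Ts \o Y).
  by split; apply: bochner_measurable_Tpow; [exact: LX.1|exact: LY.1].
have sTX : simple_rv (Tpow Ts \o sX) by exact: simple_rv_comp.
have sTY : simple_rv (Tpow Ts \o sY) by exact: simple_rv_comp.
have msTX := bochner_measurable_simple P sTX.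
have msTY := bochner_measurable_simple P sTY.
have step3 : `|c - c'| <= 2 * e.
  have c'E : c' = simple_integral P (Tpow Ts \o sX) - simple_integral P (Tpow Ts \o sY).
    rewrite sXE sYE (simple_integralE P (Tpow Ts \o x) ms) (simple_integralE P (Tpow Ts \o y) ms).
    by rewrite -sumrB; apply: eq_bigr => a _; rewrite -scalerBr.
  have one (Z sZ : Om -> E) mz : is_bochner_integral P (Tpow Ts \o Z) mz ->
      simple_rv sZ -> bochner_measurable P Z ->
      (normL P q ((Tpow Ts \o sZ) \- (Tpow Ts \o Z))%R <= e%:E)%E ->
      `|mz - simple_integral P (Tpow Ts \o sZ)| <= e.
    move=> hmz ssZ mmZ hZ; rewrite -lee_fin; apply: le_trans hZ.
    rewrite distrC; apply: (le_trans (bochner_integral_dist hP hmz (simple_rv_comp _ ssZ))).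
    have m1 := bochner_measurable_Tpow Ts mmZ.
    have m2 := bochner_measurable_Tpow Ts (bochner_measurable_simple P ssZ).
    have m12 := bochner_measurableB m2 m1.
    apply: le_trans (normL1_le hP q1 m12); rewrite normL1E.
    by under eq_integral do rewrite /= distrC.
  have h1 := one X sX mX hmX ssX LX.1 hTX.
  have h2 := one Y sY mY hmY ssY LY.1 hTY.
  have -> : c - c' = (mX - simple_integral P (Tpow Ts \o sX)) -
                    (mY - simple_integral P (Tpow Ts \o sY)).
    by rewrite c'E /c !opprB addrACA [RHS]addrACA; congr (_ + _); exact: addrC.
  apply: (le_trans (ler_normB _ _)); rewrite mulr_natl mulr2n; exact: lerD.
have step4 : wnorm w q (fun a => `|z a - v a|) <= 5 * e.
  rewrite -lee_fin -(normL_fin P (fun a => z a - v a) q ms).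
  pose f1 := (Tpow Ts \o sX) \- (Tpow Ts \o X).
  pose f2 := (Tpow Ts \o sY) \- (Tpow Ts \o Y).
  have mf1 : bochner_measurable P f1 by exact: bochner_measurableB.
  have mf2 : bochner_measurable P f2 by exact: bochner_measurableB.
  have mf3 : bochner_measurable P (fun u => zeta u - phi (zeta u)).
    by apply: bochner_measurableB => //; exact: mphi.
  have mf12 := bochner_measurableB mf1 mf2.
  have mzv := bochner_measurable_simple P (simple_rv_fin (fun a => z a - v a) ms).
  apply: (le_trans (normL_triangle hP q1 mzv mf12 mf3 _)).
    move=> u; rewrite -[leLHS]/(`|z (s u) - v (s u)|).
    have -> : z (s u) - v (s u) = (f1 \- f2) u + (zeta u - phi (zeta u)).
      have vE : v (s u) = phi (zeta u) by [].
      rewrite vE TsE /f1 /f2 /=; move: (phi (zeta u)) => v1; rewrite /zeta.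
      move: (Tpow Ts (sX u)) (Tpow Ts (sY u)) (Tpow Ts (X u)) (Tpow Ts (Y u)).
      move=> a b a' b'; rewrite addrA; congr (_ - _).
      by rewrite opprB -[in RHS]addrA [X in _ = _ + X]addrC !subrKA.
    exact: ler_normD.
  have -> : (5 * e)%:E = ((e%:E + e%:E) + (3 * e)%:E)%E by rewrite -!EFinD; congr EFin; ring.
  apply: leeD => //.
  apply: (le_trans (normL_triangle hP q1 mf12 mf1 mf2 _)).
    by move=> u; exact: ler_normB.
  exact: leeD.
have step5 : S <= \sum_(i < k) 'C(k, i.+1)%:R *
     ((Dn + 2 * e) ^+ i.+1 * (Yn + e) ^+ (k - i - 1)).
  apply: ler_sum => i _; rewrite ler_wpM2l//.
  have msX := bochner_measurable_simple P ssX.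
  have msY := bochner_measurable_simple P ssY.
  have ik : (i.+1 + (k - i - 1) = k)%N by rewrite -subnDA addn1 subnKC.
  have := normL_mixed_le hP q0 (ltn0Sn i) ik (bochner_measurableB msX msY) msY.
  have -> : (fun w0 => `|(sX \- sY) w0| ^+ i.+1 * `|sY w0| ^+ (k - i - 1) : R^o) =
      (fun a => `|x a - y a| ^+ i.+1 * `|y a| ^+ (k - i - 1) : R^o) \o s.
    by apply/funext => u; rewrite sXE sYE.
  rewrite (normL_fin P _ q ms) => H.
  rewrite -lee_fin.
  have -> : wnorm w q (fun a => `|x a - y a| ^+ i.+1 * `|y a| ^+ (k - i - 1)) =
    wnorm w q (fun a => `| (`|x a - y a| ^+ i.+1 * `|y a| ^+ (k - i - 1) : R^o) |).
    by rewrite /wnorm; under [in RHS]eq_bigr do rewrite normr_id.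
  apply: (le_trans H); rewrite EFinM !EFin_expe.
  have epow (a b : \bar R) m : (0 <= a -> a <= b -> a ^+ m <= b ^+ m)%E.
    move=> a0 ab; elim: m => [|m IH]; first by rewrite !expe0.
    by rewrite !expeS; apply: lee_pmul => //; exact: expe_ge0.
  by apply: lee_pmul; rewrite ?expe_ge0 ?normL_ge0//; apply: epow => //; exact: normL_ge0.
have K00 : 0 <= K0 by rewrite /K0 !mulr_ge0// powR_ge0.
apply: (le_trans step1).
have -> : (10 * e + K0 * \sum_(i < k) 'C(k, i.+1)%:R *
     ((Dn + 2 * e) ^+ i.+1 * (Yn + e) ^+ (k - i - 1)))%:E =
  ((2 * e + K0 * (\sum_(i < k) 'C(k, i.+1)%:R *
     ((Dn + 2 * e) ^+ i.+1 * (Yn + e) ^+ (k - i - 1))) + 5 * e)%:E + (3 * e)%:E)%E.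
  by rewrite -EFinD; congr EFin; ring.
rewrite leeD2r//; apply: (le_trans step2); rewrite lee_fin.
by rewrite !lerD// ler_wpM2l.
Qed.

(** The bound of [sampling_error_approx] is a polynomial in [e], hence continuous at 0, and [e] may
    tend to 0. *)
Lemma sampling_error :
  (normL P q (fun w => (mX - mY) - n%:R^-1 *: \sum_j xi j w)%R <=
   (K0 * \sum_(i < k) 'C(k, i.+1)%:R * (Dn ^+ i.+1 * Yn ^+ (k - i - 1)))%:E)%E.
Proof.
pose g (e : R) := 10 * e + K0 * \sum_(i < k) 'C(k, i.+1)%:R *
     ((Dn + 2 * e) ^+ i.+1 * (Yn + e) ^+ (k - i - 1)).
have gl e : 0 < e -> (normL P q (fun w => (mX - mY) - n%:R^-1 *: \sum_j xi j w)%R <= (g e)%:E)%E.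
  exact: sampling_error_approx.
have Wf : normL P q (fun w => (mX - mY) - n%:R^-1 *: \sum_j xi j w)%R \is a fin_num.
  rewrite ge0_fin_numE ?normL_ge0//; exact: (le_lt_trans (gl 1 ltr01) (ltry _)).
move: gl; rewrite -(fineK Wf); set W := fine _ => gl; rewrite lee_fin.
pose G : {poly R} := 10%:P * 'X + K0%:P * \sum_(i < k) ('C(k, i.+1)%:R)%:P *
   ((Dn%:P + 2%:P * 'X) ^+ i.+1 * (Yn%:P + 'X) ^+ (k - i - 1)).
have gE e : g e = G.[e].
  rewrite /g /G !hornerE horner_sum; congr (_ + _ * _); apply: eq_bigr => i _.
  by rewrite !(hornerE, horner_exp).
have G0 : G.[0] = K0 * \sum_(i < k) 'C(k, i.+1)%:R * (Dn ^+ i.+1 * Yn ^+ (k - i - 1)).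
  rewrite -gE /g mulr0 add0r; congr (_ * _); apply: eq_bigr => i _.
  by rewrite mulr0 !addr0.
rewrite -G0 leNgt; apply/negP => GW.
have cG : {for 0, continuous (horner G)} by exact: continuous_horner.
have cs : G.[n.+1%:R^-1] @[n --> \oo] --> G.[0].
  exact: (continuous_cvg _ cG (@cvg_harmonic R)).
have : \forall n \near \oo, G.[n.+1%:R^-1] < W by exact: (cvgr_lt _ cs).
move=> /filter_ex[m]; apply/negP; rewrite -leNgt -gE -lee_fin.
by apply: gl; rewrite invr_gt0.
Qed.

End SamplingError.

(** * Rademacher sums on the cube and the constants *)

(** A separate name to carry the discrete sigma-algebra. On this space the signs form a Rademacher
    family, so the constants, defined through all such families, yield inequalities between finite
    sums. *)
Definition cube (n : nat) : Type := {ffun 'I_n -> bool}.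
HB.instance Definition _ n := Finite.on (cube n).
HB.instance Definition _ n := isPointed.Build (cube n) [ffun=> true].
HB.instance Definition _ n := @isMeasurable.Build default_measure_display
  (cube n) discrete_measurable discrete_measurable0
  discrete_measurableC discrete_measurableU.

Section CubeProbability.
Context {R : realType} (n : nat).
Local Notation cw := (@cube_weight R n).

(** One scaled Dirac mass per sign vector, indexed by its rank in the enumeration, makes the uniform
    law a finite sum of measures. *)
Definition cube_atom (i : nat) : {measure set (cube n) -> \bar R} :=
  mscale (2^-1 ^+ n)%:nng \d_(nth [ffun=> true] (enum {: {ffun 'I_n -> bool}}) i : cube n).

Definition cube_prob : set (cube n) -> \bar R :=
  msum cube_atom #|{: {ffun 'I_n -> bool}}|.

HB.instance Definition _ := Measure.on cube_prob.

Lemma cube_probE (A : set (cube n)) :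
  cube_prob A = (\sum_(e : {ffun 'I_n -> bool}) cw e * ((e : cube n) \in A)%:R)%:E.
Proof.
have -> : \sum_(e : {ffun 'I_n -> bool}) cw e * ((e : cube n) \in A)%:R =
    \sum_(e <- enum {: {ffun 'I_n -> bool}}) cw e * ((e : cube n) \in A)%:R.
  by rewrite big_enum.
rewrite /cube_prob /msum -sumEFin (big_nth [ffun=> true]) big_mkord cardT.
apply: eq_bigr => i _; rewrite EFinM; congr (_ * _)%E; exact: diracE.
Qed.

Let cube_prob_setT : cube_prob setT = 1%E.
Proof.
rewrite cube_probE; under eq_bigr do rewrite in_setT mulr1.
by rewrite cube_weight1.
Qed.

HB.instance Definition _ :=
  Measure_isProbability.Build _ _ _ cube_prob cube_prob_setT.

Lemma cube_prob_complete : measure_is_complete (cube_prob : probability (cube n) R).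
Proof. by []. Qed.

Let half (_ : bool) : R := 2^-1.

Let half1 : \sum_b half b = 1.
Proof. by rewrite big_bool /half /=; field. Qed.

Let cwE e : cw e = prodw half e.
Proof. by rewrite /cube_weight /prodw prodr_const card_ord. Qed.

Lemma cube_prob_coord (j : 'I_n) (B : set R) :
  cube_prob ((fun e : cube n => sg (e : {ffun 'I_n -> bool}) j : R) @^-1` B) =
  (\sum_(b : bool) half b * ((-1) ^+ b \in B)%:R)%:E.
Proof.
rewrite cube_probE; congr EFin.
rewrite -(@prodw_expectR R _ n half half1 (fun b => ((-1) ^+ b \in B)%:R) j).
by apply: eq_bigr => e _; rewrite cwE; congr (_ * _%:R).
Qed.

Lemma cube_rademacher :
  rademacher_family (cube_prob : probability (cube n) R)
    (fun j (e : cube n) => sg (e : {ffun 'I_n -> bool}) j).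
Proof.
split.
- by move=> j _ B mB.
- by move=> j e; rewrite /sg; case: (_ j); [left|right].
- have n11 : (-1 == 1 :> R) = false by apply/eqP => H; have := @ltr10 R; lra.
  have in1 (x y : R) : (x \in [set y]) = (x == y).
    by apply/idP/eqP => [/set_mem//|->]; exact/mem_set.
  move=> j; split; apply: (etrans (cube_prob_coord j _)).
    by rewrite big_bool /= !in1 !(expr0, expr1) (eq_sym 1) n11 eqxx mulr0 mulr1 addr0.
  by rewrite big_bool /= !in1 !(expr0, expr1) n11 eqxx mulr0 mulr1 add0r.
- move=> J A _.
  pose g (j : 'I_n) (b : bool) : R :=
    if j \in J then ((-1) ^+ b \in A j)%:R else 1.
  transitivity (\prod_(j in J) (\sum_b half b * ((-1) ^+ b \in A j)%:R)%:E)%E; last first.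
    by apply: eq_bigr => j _; exact: (esym (cube_prob_coord j (A j))).
  rewrite -(big_morph EFin EFinM (erefl _)); apply: (etrans (cube_probE _)); congr EFin.
  transitivity (\sum_(e : {ffun 'I_n -> bool}) \prod_j (half (e j) * g j (e j))).
    apply: eq_bigr => e _; rewrite big_split/= cwE; congr (_ * _).
    have [eA|eA] := boolP ((e : cube n) \in _).
      rewrite big1// => j _; rewrite /g; case: ifP => // jJ.
      by rewrite mem_set//; exact: (set_mem eA j jJ).
    suff [j jJ jA] : exists2 j, j \in J & (-1) ^+ (e j) \notin A j.
      by rewrite (bigD1 j)//= /g jJ (negbTE jA) mul0r.
    move: eA; rewrite notin_setE => eA; apply: contrapT => H; apply: eA => j /= jJ.
    apply: set_mem; apply/negPn/negP => jA; apply: H; exists j => //.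
  rewrite -(bigA_distr_bigA (fun j b => half b * g j b)) [RHS]big_mkcond/=.
  apply: eq_bigr => j _; rewrite /g; case: ifP => // _.
  by under eq_bigr do rewrite mulr1; exact: half1.
Qed.

Lemma normL_cube (F : completeNormedModType R) (q : R) (f : {ffun 'I_n -> bool} -> F) :
  normL (cube_prob : probability (cube n) R) q (f : cube n -> F) =
  (wnorm cw q (fun e => `|f e|))%:E.
Proof.
have mid : fin_rv (id : cube n -> {ffun 'I_n -> bool}) by move=> a.
have := @normL_fin _ _ R (cube_prob : probability (cube n) R) F _ _ f q mid.
rewrite (_ : lawf _ _ = cw)//; apply/funext => e.
rewrite /lawf /= cube_probE /= (bigD1 e)//= mem_set// mulr1 big1 ?addr0// => e' e'e.
by rewrite memNset ?mulr0// => H; move: e'e; rewrite -H eqxx.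
Qed.

End CubeProbability.

Section Constants.
Context {R : realType} (E : completeNormedModType R).

Lemma kahane_khintchine_cube (q p K : R) (F : completeNormedModType R) n (z : 'I_n -> F) :
  kahane_khintchine_bound q p K ->
  wnorm (@cube_weight R n) q (fun e => `|\sum_j sg e j *: z j|) <=
  K * wnorm (@cube_weight R n) p (fun e => `|\sum_j sg e j *: z j|).
Proof.
move=> [_ /(_ _ _ _ (@cube_prob_complete R n) n _ (@cube_rademacher R n) F z)].
by rewrite /rad_sum !normL_cube -EFinM lee_fin.
Qed.

Lemma type_bound_cube (p tau : R) n (z : 'I_n -> E) : type_bound E p tau ->
  wnorm (@cube_weight R n) p (fun e => `|\sum_j sg e j *: z j|) <=
  tau * (\sum_j `|z j| `^ p) `^ p^-1.
Proof.
move=> [_ /(_ _ _ _ (@cube_prob_complete R n) n _ (@cube_rademacher R n) z)].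
by rewrite /rad_sum normL_cube lee_fin.
Qed.

Lemma sign_type_bound_constants (n : nat) (p q K tau : R) :
  kahane_khintchine_bound q p K -> type_bound E p tau ->
  sign_type_bound E n p q (K * tau).
Proof.
move=> HK Ht z; apply: (le_trans (kahane_khintchine_cube z HK)).
rewrite -mulrA ler_wpM2l ?(ltW HK.1)//; exact: type_bound_cube.
Qed.

Lemma sign_type_bound_crude (n : nat) (p q : R) : 1 <= p -> 1 <= q ->
  sign_type_bound E n p q n%:R.
Proof.
move=> p1 q1 z; have p0 : 0 < p by exact: lt_le_trans p1.
have S0 : 0 <= \sum_j `|z j| `^ p by apply: sumr_ge0 => j _; exact: powR_ge0.
apply: le_wnorm_cst => //.
- exact: cube_weight_ge0.
- exact: cube_weight1.
- by rewrite mulr_ge0// powR_ge0.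
move=> e; rewrite normr_id; apply: (le_trans (ler_norm_sum _ _ _)).
apply: (@le_trans _ _ (\sum_(j < n) (\sum_j `|z j| `^ p) `^ p^-1)).
  apply: ler_sum => j _; rewrite normrZ normr_sg mul1r.
  rewrite -[leLHS](@powRK _ p) ?gt_eqF//.
  apply: ler_powR2; [by rewrite invr_ge0 ltW|exact: powR_ge0|].
  by rewrite (bigD1 j)//= lerDl sumr_ge0// => i _; exact: powR_ge0.
by rewrite sumr_const card_ord -[X in X <= _]mulr_natl.
Qed.

Lemma sign_type_bound_trivial (n : nat) (p q : R) : 1 <= q -> (forall x : E, x = 0) ->
  sign_type_bound E n p q 0.
Proof.
move=> q1 E0 z; rewrite mul0r; apply: le_wnorm_cst => //.
- exact: cube_weight_ge0.
- exact: cube_weight1.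
- by move=> e; rewrite [\sum_j _]E0 !normr0.
Qed.

Lemma wnorm_cube1 (F : completeNormedModType R) (q : R) (x : F) : 0 < q ->
  wnorm (@cube_weight R 1) q (fun e => `|\sum_(j < 1) sg e j *: x|) = `|x|.
Proof.
move=> q0; rewrite /wnorm.
under eq_bigr do rewrite big_ord1 normrZ normr_sg mul1r normr_id.
by rewrite -mulr_suml cube_weight1 mul1r powRK// gt_eqF.
Qed.

(** The norm of a one-term sum is the same for every exponent. *)
Lemma kahane_khintchine_ge1 (q p : R) : 1 <= q -> 1 <= p ->
  (1 <= kahane_khintchine q p)%E.
Proof.
move=> q1 p1; apply: le_ereal_inf_tmp => _ [K HK <-]; rewrite lee_fin.
have := kahane_khintchine_cube (fun _ : 'I_1 => (1 : R^o)) HK.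
rewrite !wnorm_cube1 ?normr1 ?mulr1//.
- exact: lt_le_trans p1.
- exact: lt_le_trans q1.
Qed.

(** A one-term sum again; as a consequence the type constant can vanish only for the zero space. *)
Lemma type_bound_ge1 (p tau : R) (x : E) : 1 <= p -> x != 0 -> type_bound E p tau -> 1 <= tau.
Proof.
move=> p1 x0 Ht; have p0 : 0 < p by exact: lt_le_trans p1.
have := type_bound_cube (fun _ : 'I_1 => x) Ht.
rewrite wnorm_cube1// big_ord1 powRK ?gt_eqF//.
by rewrite -[X in X <= _]mul1r ler_pM2r// normr_gt0.
Qed.

End Constants.

Section FinalConstant.
Context {R : realType} (E : completeNormedModType R).
Local Open Scope ereal_scope.

(* No bound on the Kahane-Khintchine constant is available, so [+oo] has to be
   allowed for it; the products [+oo * 0] that may then arise are harmless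
   because [sign_type_bound] always holds with the crude constant [n]. *)
Lemma le_C_ML (n k : nat) (p q B : R) (W S : \bar R) (T : R) :
  (0 < k)%N -> (1 <= p)%R -> (p <= q)%R -> rademacher_type E p ->
  (0 <= T)%R -> T%:E <= S ->
  (forall C : R, (0 <= C)%R -> sign_type_bound E n p q C -> W <= (16 * k%:R * C * T)%:E) ->
  W <= C_ML E q p k B * S.
Proof.
move=> k0 p1 pq [tau0 Htau0] T0 TS HW; have q1 : (1 <= q)%R by exact: le_trans pq.
have S0 : 0 <= S by apply: le_trans TS; rewrite lee_fin.
set a := kahane_khintchine q p; set b := type_constant E p.
set a2 := kahane_khintchine q 2.
have a1 : 1 <= a := kahane_khintchine_ge1 q1 p1.
have a21 : 1 <= a2 by apply: kahane_khintchine_ge1 => //; rewrite ler1n.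
have b0 : 0 <= b.
  by apply: le_ereal_inf_tmp => _ [t [t0 _] <-]; rewrite lee_fin ltW.
have bfin : b \is a fin_num.
  rewrite ge0_fin_numE//; apply: (@le_lt_trans _ _ tau0%:E); last exact: ltry.
  by apply: ereal_inf_lbound; exists tau0.
have kc : (0 < 16 * k%:R :> R)%R by rewrite mulr_gt0// ltr0n.
have kc0 : 0 <= (16 * k%:R)%:E :> \bar R by rewrite lee_fin ltW.
have a0 : 0 <= a by apply: le_trans a1; rewrite lee_fin.
have kab0 : 0 <= (16 * k%:R)%:E * a * b by rewrite !mule_ge0.
have sp1 : (1 <= Num.sqrt pi :> R)%R.
  rewrite -[leLHS](@sqrtr1 R); apply: ler_wsqrtr.
  by apply: le_trans (pi_ge2 R); rewrite ler1n.
(* The constant obtained, [16 * k%:R] times [a] and [b], is below [C_diff] because the square root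
   of [pi] and [a2] are at least 1. *)
have c1 : (16 * k%:R)%:E <= (16 * k%:R * Num.sqrt pi)%R%:E :> \bar R.
  by rewrite lee_fin ler_peMr// ltW.
have Cd : (16 * k%:R)%:E * a * b <= C_diff E q p k.
  rewrite /C_diff -/a -/b -/a2 -[leLHS]mule1.
  apply: lee_pmul => //.
  by apply: lee_wpmul2r => //; exact: lee_wpmul2r.
have Cd0 : 0 <= C_diff E q p k.
  exact: le_trans Cd.
have CM : C_diff E q p k <= C_ML E q p k B.
  rewrite /C_ML; apply: (@le_trans _ _ (maxe (C_diff E q p k) B%:E)).
    by rewrite le_max lexx.
  rewrite -[leLHS]mul1e; apply: lee_wpmul2r; first by rewrite le_max Cd0.
  by rewrite lee_fin ler1n.
have CM0 : 0 <= C_ML E q p k B by exact: le_trans CM.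
have zero : W <= 0 -> W <= C_ML E q p k B * S.
  by move=> /le_trans; apply; exact: mule_ge0.
have [T00|Tn0] := eqVneq T 0%R.
  apply: zero; have := HW n%:R (ler0n _ _) (sign_type_bound_crude p1 q1).
  by rewrite T00 mulr0.
have Tp : (0 < T)%R by rewrite lt_neqAle eq_sym Tn0.
(* A zero infimum of type bounds forces the zero space, where [C = 0] is admissible. *)
have [bz|bn0] := eqVneq b 0.
  apply: zero; have := HW 0%R (lexx _); rewrite mulr0 mul0r; apply.
  apply: sign_type_bound_trivial => // x; apply/eqP/negPn/negP => x0.
  have : 1 <= b.
    apply: le_ereal_inf_tmp => _ [t Ht <-]; rewrite lee_fin.
    exact: (type_bound_ge1 p1 x0 Ht).
  by rewrite bz lee_fin ler10.
have bp : 0 < b by rewrite lt0e bn0.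
(* An infinite [a] makes the right side infinite, since [b] and [S] are positive here. *)
have [ay|ay] := eqVneq a +oo.
  have Cy : C_ML E q p k B = +oo.
    apply/eqP; rewrite -leye_eq; apply: le_trans CM; apply: le_trans Cd.
    by rewrite ay gt0_muley ?lte_fin// gt0_mulye.
  rewrite Cy gt0_mulye ?leey//; apply: lt_le_trans TS; by rewrite lte_fin.
have afin : a \is a fin_num.
  by rewrite ge0_fin_numE// ltey.
apply: (@le_trans _ _ ((16 * k%:R)%:E * a * b * T%:E)); last first.
  by apply: lee_pmul => //; exact: le_trans CM.
have WKt K tau : kahane_khintchine_bound q p K -> type_bound E p tau ->
    W <= (16 * k%:R * (K * tau) * T)%:E.
  move=> HK Ht; apply: HW; first by rewrite mulr_ge0 ?ltW// ?HK.1 ?Ht.1.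
  exact: sign_type_bound_constants.
(* Division by the positive remaining factors turns a bound for every admissible constant into one
   for the infimum, first in [K] and then in [tau]. *)
have Wt tau : type_bound E p tau -> W <= (16 * k%:R)%:E * a * tau%:E * T%:E.
  move=> Ht; have tp := Ht.1.
  have cp : (0 < 16 * k%:R * tau * T)%R by do 2 apply: mulr_gt0 => //.
  rewrite [leRHS](_ : _ = (16 * k%:R * tau * T)%:E * a); last first.
    by rewrite -(fineK afin) -!EFinM; congr EFin; ring.
  rewrite -lee_pdivrMl//; apply: le_ereal_inf_tmp => _ [K HK <-].
  rewrite lee_pdivrMl// -EFinM (_ : (_ * K)%R = 16 * k%:R * (K * tau) * T)%R; last by ring.
  exact: WKt.
have cap : (0 < 16 * k%:R * fine a * T)%R.
  apply: mulr_gt0 => //; apply: mulr_gt0 => //.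
  by apply: (@lt_le_trans _ _ 1%R) => //; rewrite -lee_fin fineK.
rewrite [leRHS](_ : _ = (16 * k%:R * fine a * T)%:E * b); last first.
  by rewrite -{1}(fineK afin) -(fineK bfin) -!EFinM; congr EFin; ring.
rewrite -lee_pdivrMl//; apply: le_ereal_inf_tmp => _ [tau Ht <-].
rewrite lee_pdivrMl// -EFinM (_ : (_ * tau)%R = 16 * k%:R * fine a * tau * T)%R; last by ring.
by have := Wt tau Ht; rewrite -{1}(fineK afin) -!EFinM.
Qed.

End FinalConstant.

Section LevelBound.
Context d (Om : measurableType d) (R : realType) (P : probability Om R).
Local Open Scope ereal_scope.

(** Each term contains the norm of the difference at least once; with one factor taken out, the
    comparison is term by term. *)
Lemma Sigma_ML_ge (E : completeNormedModType R) (q : R) (k l : nat) (X : nat -> Om -> E) :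
  \sum_(i < k) 'C(k, i.+1)%:R%:E * (normL P (k%:R * q) (X l \- X l.-1)%R ^+ i.+1 *
    normL P (k%:R * q) (X l.-1) ^+ (k - i - 1)) <=
  normL P (k%:R * q) (X l \- X l.-1)%R * Sigma_ML P q k X l.
Proof.
rewrite /Sigma_ML big_mkord ge0_sume_distrr; last first.
  move=> i _; rewrite mule_ge0 ?expe_ge0 ?normL_ge0// adde_ge0 ?expe_ge0 ?normL_ge0//.
  by rewrite mule_ge0 ?expe_ge0 ?normL_ge0// lee_fin.
apply: lee_sum => i _; rewrite expeS -[in leLHS]muleA [leLHS]muleCA.
apply: lee_wpmul2l; first exact: normL_ge0.
rewrite [leLHS]muleA; apply: lee_wpmul2r; first by rewrite expe_ge0 ?normL_ge0.
by rewrite leeDl// expe_ge0 ?normL_ge0.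
Qed.

End LevelBound.

(** * The multilevel estimate *)

Section Moments.
Context d (Om : measurableType d) (R : realType) (P : probability Om R).
Hypothesis hP : measure_is_complete P.
Context (E : completeNormedModType R) (k : nat) (Ts : sym_inj_tensor E k)
  (Tf : inj_tensor E k) (J : {linear Ts -> Tf}).

(** [inj_moment] is a chosen value, meaningful only if the integral exists. Existence is carried
    over from the symmetric space by the continuous linear map [J], and uniqueness then identifies
    the chosen value. *)
Lemma is_bochner_integral_inj_moment (X : Om -> E) (m : Ts) :
  (0 < k)%N -> canonical_inclusion J ->
  is_bochner_integral P (Tpow Ts \o X) m -> J m = inj_moment P Tf X.
Proof.
move=> k0 hJ hm.
have HJ : is_bochner_integral P (fun w => compl_emb Tf (tpow k (X w))) (J m).
  have := is_bochner_integral_linear hP hJ.1 hm.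
  by congr is_bochner_integral; apply/funext => w /=; exact: hJ.2 (sym_tpow _).
apply: (bochner_integral_unique hP HJ).
exact: (getPex (ex_intro _ _ HJ)).
Qed.

Lemma is_bochner_integral_cst0 (F : completeNormedModType R) (m : F) :
  is_bochner_integral P (fun=> 0) m -> m = 0.
Proof.
move=> hm; apply: (bochner_integral_unique hP hm).
have s0 : simple_rv (fun _ : Om => (0 : F)) by exact: simple_rv_cst.
have m0 : fin_rv (fun _ : Om => tt) by move=> a; rewrite preimage_cst; case: ifP.
split; first exact: bochner_measurable_simple.
exists (fun _ _ => 0); split=> //.
  under eq_fun do under eq_integral do rewrite subr0 normr0.
  by rewrite integral0; exact: cvg_cst.
have -> : simple_integral P (fun _ : Om => (0 : F)) = 0.
  have := simple_integralE P (fun _ : unit => (0 : F)) m0.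
  by rewrite big1 // => a _; rewrite scaler0.
exact: cvg_cst.
Qed.

Lemma level_bound (n : nat) (p q Bq : R) (X Y : Om -> E) (xi : 'I_n -> Om -> Ts) (mX mY : Ts)
    (S : \bar R) :
  (0 < k)%N -> (0 < n)%N -> 1 <= p -> p <= q -> rademacher_type E p ->
  inL P (k%:R * q) X -> inL P (k%:R * q) Y ->
  independent_copies P xi (fun w => Tpow Ts (X w) - Tpow Ts (Y w)) ->
  is_bochner_integral P (Tpow Ts \o X) mX -> is_bochner_integral P (Tpow Ts \o Y) mY ->
  (\sum_(i < k) 'C(k, i.+1)%:R%:E * (normL P (k%:R * q) (X \- Y)%R ^+ i.+1 *
    normL P (k%:R * q) Y ^+ (k - i - 1)) <= S)%E ->
  (normL P q (fun w => (mX - mY) - n%:R^-1 *: \sum_j xi j w)%R <=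
   C_ML E q p k Bq * ((n%:R `^ (- (1 - p^-1)))%:E * S))%E.
Proof.
move=> k0 n0 p1 pq hE LX LY hxi hmX hmY hS.
have q1 : 1 <= q by exact: le_trans pq.
have kq1 : 1 <= k%:R * q.
  by apply: (le_trans q1); rewrite ler_peMl ?(le_trans _ q1)// ler1n.
have mXY := bochner_measurableB LX.1 LY.1.
have XYf : normL P (k%:R * q) (X \- Y) \is a fin_num.
  rewrite ge0_fin_numE ?normL_ge0//.
  apply: le_lt_trans (normL_triangle hP kq1 mXY LX.1 LY.1 _) _.
    by move=> w; exact: ler_normB.
  by apply: lte_add_pinfty; [exact: LX.2|exact: LY.2].
have Yf : normL P (k%:R * q) Y \is a fin_num.
  by rewrite ge0_fin_numE ?normL_ge0//; exact: LY.2.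
pose Dn := fine (normL P (k%:R * q) (X \- Y)); pose Yn := fine (normL P (k%:R * q) Y).
pose T := \sum_(i < k) 'C(k, i.+1)%:R * (Dn ^+ i.+1 * Yn ^+ (k - i - 1)).
have T0 : 0 <= T.
  by apply: sumr_ge0 => i _; rewrite !mulr_ge0// exprn_ge0// fine_ge0// normL_ge0.
have TS : (T%:E <= S)%E.
  apply: le_trans hS; rewrite /T -sumEFin; apply: lee_sum => i _.
  by rewrite !EFinM !EFin_expe /Dn /Yn !fineK.
have N0 : 0 <= n%:R `^ (- (1 - p^-1)) :> R by exact: powR_ge0.
apply: (@le_C_ML _ E n k p q Bq _ _ (n%:R `^ (- (1 - p^-1)) * T)) => //.
- exact: mulr_ge0.
- by rewrite EFinM; apply: lee_wpmul2l.
move=> C C0 HC.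
apply: (le_trans (sampling_error hP k0 n0 p1 pq C0 HC LX LY hxi hmX hmY)).
rewrite lee_fin -/Dn -/Yn -/T le_eqVlt; apply/orP; left; apply/eqP.
(* The factor [n%:R^-1] comes from the mean, the power [1/p] from the type inequality. *)
have -> : n%:R `^ (- (1 - p^-1)) = n%:R^-1 * n%:R `^ p^-1 :> R.
  rewrite opprB powRD; last by rewrite pnatr_eq0 -lt0n n0 implybT.
  by rewrite powR_inv1// mulrC.
ring.
Qed.

End Moments.

Unset Implicit Arguments.

Theorem theorem3p24 (R : realType)
  (d : measure_display) (Om : measurableType d) (P : probability Om R)
  (hP : measure_is_complete P)
  (E : completeNormedModType R) (p q : R) (k L : nat)
  (hp1 : 1 <= p) (hp2 : p <= 2) (hE : rademacher_type E p) (hq : p <= q)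
  (hk : (0 < k)%N) (hL : (0 < L)%N)
  (Bq : R) (hBq : khintchine_bound q Bq)
  (Ts : sym_inj_tensor E k) (Tf : inj_tensor E k)
  (J : {linear Ts -> Tf}) (hJ : canonical_inclusion J)
  (X : nat -> Om -> E) (hX0 : X 0%N = fun=> 0)
  (hX : forall l, (1 <= l <= L)%N -> inL P (k%:R * q) (X l))
  (M : nat -> nat) (hM : forall l, (1 <= l <= L)%N -> (0 < M l)%N)
  (xi : forall l, 'I_(M l) -> Om -> Ts)
  (hxi : forall l, (1 <= l <= L)%N ->
     independent_copies P (xi l)
       (fun w => compl_emb Ts (tpow k (X l w))
                 - compl_emb Ts (tpow k (X l.-1 w))))
  (m : Ts) (hm : J m = inj_moment P Tf (X L))
  (U : Ts) :
  (normL P q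
     (fun w =>
        (U - \sum_(1 <= l < L.+1) (M l)%:R^-1 *: \sum_(j < M l) xi l j w)%R)
   <= `|U - m|%:E
      + C_ML E q p k Bq *
        \sum_(1 <= l < L.+1)
          (((M l)%:R `^ (- (1 - p^-1)))%:E
           * normL P (k%:R * q) (X l \- X l.-1)%R
           * Sigma_ML P q k X l))%E.
Proof.
have q1 : 1 <= q by exact: le_trans hq.
have kq1 : 1 <= k%:R * q.
  by apply: (le_trans q1); rewrite ler_peMl ?(le_trans _ q1)// ler1n.
have LX l : (l <= L)%N -> inL P (k%:R * q) (X l).
  case: l => [_|l lL]; last exact: hX.
  rewrite hX0; split; first exact: bochner_measurable_cst.
  by rewrite normL_cst ?ltry// (lt_le_trans ltr01).
have [mm mmP] : {mm : nat -> Ts & forall l, (l <= L)%N ->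
    is_bochner_integral P (Tpow Ts \o X l) (mm l)}.
  apply: (@choice _ _ (fun l m0 => (l <= L)%N -> is_bochner_integral P (Tpow Ts \o X l) m0)).
  move=> l; have [lL|lL] := leqP l L; last by exists 0.
  by have [m0 Hm0] := Tpow_bochner_integral hP Ts hk q1 (LX l lL); exists m0.
(* Since [0 < k], the tensor power of [X 0] is zero, so the telescoping sum of moments reduces to
   its last term. *)
have mm0 : mm 0%N = 0.
  apply: (is_bochner_integral_cst0 hP); have := mmP 0%N (leq0n L).
  rewrite hX0; congr is_bochner_integral; apply/funext => w /=; exact: Tpow0.
(* [J] does not decrease norms, so equal images force equal tensors. *)
have mE : m = mm L.
  apply/eqP; rewrite -subr_eq0 -normr_le0.
  apply: (le_trans (canonical_inclusion_ge _ hk hJ)).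
  rewrite linearB hm (is_bochner_integral_inj_moment hP hk hJ (mmP L (leqnn L))).
  by rewrite subrr normr0.
have iL (i : 'I_L) : (1 <= i.+1 <= L)%N by rewrite /= ltn_ord.
pose W (i : 'I_L) w : Ts := (mm i.+1 - mm i) - (M i.+1)%:R^-1 *: \sum_j xi i.+1 j w.
have mxi (i : 'I_L) j : bochner_measurable P (xi i.+1 j).
  by have [H _ _] := hxi _ (iL i); exact: H.
have mW i : bochner_measurable P (W i).
  apply: bochner_measurableB; first exact: bochner_measurable_cst.
  by apply: bochner_measurableZ; apply: bochner_measurable_sum => j; exact: mxi.
have mS : bochner_measurable P (fun w => \sum_i W i w) by exact: bochner_measurable_sum.
have mU : bochner_measurable P (fun=> U - m) by exact: bochner_measurable_cst.
have -> : (fun w => U - \sum_(1 <= l < L.+1) (M l)%:R^-1 *: \sum_(j < M l) xi l j w) =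
    (fun=> U - m) \+ (fun w => \sum_i W i w).
  apply/funext => w /=; rewrite big_add1 /= big_mkord /W sumrB.
  have -> : \sum_(i < L) (mm i.+1 - mm i) = m.
    by rewrite mE -(big_mkord xpredT (fun i => mm i.+1 - mm i)) telescope_sumr// mm0 subr0.
  by rewrite addrA subrK.
apply: (le_trans (normLD hP q1 mU mS)).
rewrite normL_cst; last exact: lt_le_trans q1.
(* Levels are combined by the triangle inequality alone, as the dependence between them is
   arbitrary. *)
rewrite leeD2l//; apply: (le_trans (normL_sum hP _ q1 mW)).
rewrite big_add1 /= big_mkord ge0_sume_distrr; last first.
  move=> i _; rewrite mule_ge0//.
    by rewrite mule_ge0 ?normL_ge0// lee_fin powR_ge0.
  apply: sume_ge0 => j _; rewrite mule_ge0 ?expe_ge0 ?normL_ge0// adde_ge0 ?expe_ge0 ?normL_ge0//.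
  by rewrite mule_ge0 ?expe_ge0 ?normL_ge0// lee_fin.
apply: lee_sum => i _; rewrite -[X in (_ <= _ * X)%E]muleA.
have iLt := iL i; have /andP[_ iL1] := iLt.
apply: (level_bound hP Bq hk (hM _ iLt) hp1 hq hE (LX _ iL1) (LX _ (ltnW iL1)) (hxi _ iLt)
  (mmP _ iL1) (mmP _ (ltnW iL1))).
exact: Sigma_ML_ge.
Qed.
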